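(* Assume the hypotheses below hold with some $q>4$, $p\in[1,4)$ and $\kappa\in(0,1/2]$. Let $b_n\to\infty$ be integers with $b_n/n^{2/(3\max(p,2))}\to0$ and $b_n/n^{(\kappa q-2)/(q+2)}\to0$. Then, as $n\to\infty$, $$Q_n(u)=\frac1n\sum_{t=\tau_n+L_n}^{\lfloor nu\rfloor-b_n}\frac1{b_n}\Big[Df(\hat\mu_{t-L_n,n})\sum_{i=1}^{b_n}(X_{t+i,n}-\hat\mu_{t-L_n,n})\Big]^2\ \to\ Q(u)=\int_0^uDf(\mu_v)\Sigma(v)Df(\mu_v)^T\,dv$$ in probability, uniformly in $u\in[0,1]$, where $\Sigma(v)=\sum_{h=-\infty}^\infty\operatorname{Cov}(G(v,\boldsymbol{\epsilon}_0),G(v,\boldsymbol{\epsilon}_h))$.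
   Context: Model: $(\epsilon_i)_{i\in\mathbb Z}$ i.i.d., $(\epsilon^*_i)$ an independent copy; $\boldsymbol{\epsilon}_t=(\epsilon_t,\epsilon_{t-1},\dots)$, $\tilde{\boldsymbol{\epsilon}}_{t,j}=(\epsilon_t,\dots,\epsilon_{t-j+1},\epsilon^*_{t-j},\epsilon_{t-j-1},\dots)$. Measurable kernels $G_n,G:\mathbb R\times\mathbb R^\infty\to\mathbb R^d$, $X_{t,n}=G_n(t/n,\boldsymbol{\epsilon}_t)$. $\|Y\|_{L_q}=(\mathbb E\|Y\|^q)^{1/q}$; $\|G_n\|_{p\text{-var}}=\sup_{0=u_0<\dots<u_m=1}(\sum_i\|G_n(u_i,\boldsymbol{\epsilon}_0)-G_n(u_{i-1},\boldsymbol{\epsilon}_0)\|_{L_q}^p)^{1/p}$. (A.1) $\sup_u\|G_n(u,\boldsymbol{\epsilon}_0)-G(u,\boldsymbol{\epsilon}_0)\|_{L_q}\to0$. (A.2) $\sup_n\sup_u\|G_n(u,\boldsymbol{\epsilon}_0)\|_{L_q}+\sup_n\|G_n\|_{p\text{-var}}\le C_G<\infty$. (A.3) for some $\rho\in(0,1)$, $\|G_n(u,\boldsymbol{\epsilon}_t)-G_n(u,\tilde{\boldsymbol{\epsilon}}_{t,j})\|_{L_q}\le C_G\rho^j$ for all $j,n,u$. $\mu^n_u=\mathbb EG_n(u,\boldsymbol{\epsilon}_0)$, $\mu_u=\mathbb EG(u,\boldsymbol{\epsilon}_0)$, $\mathcal M=\mathrm{conv}\{\mu_u\}$, $\mathcal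 M^\delta$ its open $\delta$-neighborhood. $f:\mathbb R^d\to\mathbb R$ twice differentiable, $Df\in\mathbb R^{1\times d}$, Hessian $D^2f$. (A.4) for some $\delta\in(0,\infty]$, $C_f$: $|f|+\|Df\|+\|D^2f\|\le C_f$ on $\mathcal M^\delta$. Pilot estimators $\hat\mu_{t,n}$ are $\sigma(\epsilon_t,\epsilon_{t-1},\dots)$-measurable; integers $\tau_n\ge1$, $L_n\to\infty$, $L_n/\tau_n\to0$. (C.5* ) $\sum_{t=\tau_n}^n\|\hat\mu_{t,n}-\mu^n_{t/n}\|^2=o_P(n^{1-\kappa})$. (A.6) $P(\hat\mu_{t,n}\in\mathcal M^\delta,\ t=\tau_n,\dots,n)\to1$. Further: $\tau_n/n\to0$, $\log(n)^{1+a}/L_n\to0$ for some $a\in(0,1)$, $L_n/n^{1/p-1/4}\to0$, $L_n/n^{1/(2p)}\to0$. *)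

(* Defs.v *)
From HB Require Import structures.
From mathcomp Require Import all_boot all_order all_algebra.
From mathcomp Require Import all_classical all_reals all_analysis.
Set Implicit Arguments.
Unset Strict Implicit.
Unset Printing Implicit Defensive.
Import Order.TTheory GRing.Theory Num.Theory.
Import numFieldNormedType.Exports.
Local Open Scope classical_set_scope.
Local Open Scope ring_scope.

Section Defs.
Context {R : realType} {d0 : measure_display} {Omega : measurableType d0}.
Implicit Types (P : probability Omega R).

Definition enorm (d : nat) (x : 'rV[R]_d) : R := Num.sqrt (\sum_i x 0 i ^+ 2).

Definition mutual_indep P (I : eqType) (X : I -> Omega -> R) : Prop :=
  forall (J : seq I), uniq J -> forall B : I -> set R, (forall i, measurable (B i)) ->
    fine (P (\bigcap_(i in [set` J]) (X i @^-1` B i))) =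
    \prod_(i <- J) fine (P (X i @^-1` B i)).

Definition ident_distr P (I : Type) (X : I -> Omega -> R) : Prop :=
  forall i j (B : set R), measurable B -> P (X i @^-1` B) = P (X j @^-1` B).

Definition epsseq (eps : int -> Omega -> R) (t : int) : Omega -> nat -> R :=
  fun w k => eps (t - k%:Z) w.

Definition epstilde (eps epss : int -> Omega -> R) (t : int) (j : nat) : Omega -> nat -> R :=
  fun w k => if k == j then epss (t - j%:Z) w else eps (t - k%:Z) w.

Definition past_sigma (eps : int -> Omega -> R) (t : int) : set (set Omega) :=
  <<s [set A | exists s (B : set R), s <= t /\ measurable B /\ A = eps s @^-1` B] >>.

(* product sigma-algebra on R x R^N, generated by U x {x | x_k in B} *)
Definition cyl_sets : set (set (R * (nat -> R))) :=
  [set A | exists (U : set R) (k : nat) (B : set R),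
     measurable U /\ measurable B /\ A = [set p | U p.1 /\ B (p.2 k)]].

Definition kernel_measurable (d : nat) (K : R -> (nat -> R) -> 'rV[R]_d) : Prop :=
  forall (i : 'I_d) (B : set R), measurable B ->
    (<<s cyl_sets >>) [set p | B (K p.1 p.2 0 i)].

Definition LqN P (q : R) (d : nat) (Y : Omega -> 'rV[R]_d) : \bar R :=
  Lnorm P q%:E (fun w => (enorm (Y w))%:E).

Definition vexp P (d : nat) (Y : Omega -> 'rV[R]_d) : 'rV[R]_d :=
  \row_i fine (\int[P]_w ((Y w 0 i)%:E)).

Definition vcov P (d : nat) (Y Z : Omega -> 'rV[R]_d) : 'M[R]_d :=
  \matrix_(i, j) fine (\int[P]_w (((Y w 0 i - vexp P Y 0 i) * (Z w 0 j - vexp P Z 0 j))%:E)).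

(* long-run covariance Sigma(v) = sum_{h in Z} Cov(G(v,eps_0), G(v,eps_h)),
   as limit of the partial sums over h = -H..H *)
Definition long_run_cov P (eps : int -> Omega -> R) (d : nat)
    (G : R -> (nat -> R) -> 'rV[R]_d) (v : R) : 'M[R]_d :=
  limn (fun H : nat => \sum_(0 <= k < (2 * H).+1)
     vcov P (fun w => G v (epsseq eps 0 w)) (fun w => G v (epsseq eps (k%:Z - H%:Z) w))).

Definition pvariation P (eps : int -> Omega -> R) (q p : R) (d : nat)
    (K : R -> (nat -> R) -> 'rV[R]_d) : \bar R :=
  ereal_sup [set z | exists (m : nat) (s : nat -> R),
     s 0%N = 0 /\ s m = 1 /\ (forall i, (i < m)%N -> s i < s i.+1) /\
     z = ((\sum_(i < m) (LqN P q (fun w => (K (s i.+1) (epsseq eps 0 w) - K (s i) (epsseq eps 0 w))%R)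
                            `^ p)%E) `^ p^-1)%E].

End Defs.

Definition conv_curve {R : realType} (d : nat) (mu : R -> 'rV[R]_d) : set 'rV[R]_d :=
  [set x | exists (m : nat) (wt s : 'I_m -> R),
     (forall i, 0 <= wt i) /\ \sum_i wt i = 1 /\ (forall i, 0 <= s i <= 1) /\
     x = \sum_i wt i *: mu (s i)].

Definition nbhd_set {R : realType} (d : nat) (M : set 'rV[R]_d) (delta : \bar R) : set 'rV[R]_d :=
  [set x | exists y, M y /\ ((enorm (x - y))%:E < delta)%E].

Definition grad {R : realType} (d : nat) (f : 'rV[R]_d -> R) (x : 'rV[R]_d) : 'rV[R]_d :=
  \row_i derive f x (delta_mx 0 i).

Definition hessian {R : realType} (d : nat) (f : 'rV[R]_d -> R) (x : 'rV[R]_d) : 'M[R]_d :=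
  \matrix_(i, j) derive (fun y => grad f y 0 i) x (delta_mx 0 j).

Definition twice_differentiable {R : realType} (d : nat) (f : 'rV[R]_d -> R) : Prop :=
  (forall x, differentiable f x) /\ (forall x, differentiable (grad f) x).

Definition fnorm {R : realType} (m n : nat) (A : 'M[R]_(m, n)) : R :=
  Num.sqrt (\sum_i \sum_j A i j ^+ 2).

(* Main.v *)
Require Import Defs.
From HB Require Import structures.
From mathcomp Require Import all_boot all_order all_algebra.
From mathcomp Require Import all_classical all_reals all_analysis.
From mathcomp Require Import ring lra zify.
From mathcomp Require Import measurable_realfun.
Import Order.TTheory GRing.Theory Num.Theory.
Import numFieldNormedType.Exports.
Local Open Scope classical_set_scope.
Local Open Scope ring_scope.

(** Writing X_{t+i} - muhat_{t-L} as the centred X_{t+i}, plus a shift of the means, minus the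
    error of the pilot estimator, the block sum splits into three parts.  The second is
    controlled by the p-variation and the third by the rate of the pilot estimators; the
    estimated gradient may then be replaced by the gradient at mu_{(t-L)/n}, because a variable
    of the past up to t - L nearly decorrelates from the squared centred block sum, by the
    coupling assumption.  What remains is an average of weakly dependent squares with second
    moments O(b_n^2), hence with variance O(b_n^3 / n + b_n rho^b_n).  Its mean is a double sum
    of covariances that the p-variation compares, cell by cell, with the integrand of Q.  The
    uniformity in u follows from the monotonicity of the partial sums on a finite grid. *)

(** Independence is used exactly: a functional is compared with its value on the path whose
    innovations of times s-N to s are taken from the copy, and that value is uncorrelated with a
    variable of finitely many innovations up to s once N is large. The comparison error is uniform
    in N, so density in L2 extends the estimate to the whole past sigma-algebra. This matters for
    the estimated gradients, whose dependence on the past is arbitrary. The summands are squares, so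
    couplings are measured in L4, which q > 4 provides, and pass to squares in L2. The obstacle to
    replacing the gradient is that its error multiplies the unbounded S^2/b, where S is a centred
    block sum. Decorrelation across the lag L leaves, up to a remainder with the factor rho^L, the
    product of the means, hence only the time average of the gradient errors. Off the event that the
    pilots stay in the neighbourhood the gradient is uncontrolled, so its error is cut at 2 C_f
    before expectations are taken. Kernels may have jumps, so increments over a short window are
    small only on average over its position. The weight e of the quadratic comparison and the grid
    size m are fixed before n tends to infinity. *)

Set Implicit Arguments.
Unset Strict Implicit.

(** * Moments *)

Section Moments.
Context {R : realType} {d0 : measure_display} {Omega : measurableType d0}.
Variable P : probability Omega R.
Implicit Types X Y Z : Omega -> R.

Definition Ex Y : R := Rintegral P setT Y.
Definition intg Y : Prop := P.-integrable setT (EFin \o Y).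
Definition L2 Y : Prop := measurable_fun setT Y /\ intg (fun w => Y w ^+ 2).
Definition L4 Y : Prop := measurable_fun setT Y /\ intg (fun w => Y w ^+ 4).
Definition N2 Y : R := Num.sqrt (Ex (fun w => Y w ^+ 2)).
(** The L4 norm as the square root of the L2 norm of the square: its inequalities follow from those
    of [N2] applied to squares and products. *)
Definition N4 Y : R := Num.sqrt (N2 (fun w => Y w ^+ 2)).

Lemma intg_meas Y : intg Y -> measurable_fun setT Y.
Proof. by move=> /integrableP[/measurable_EFinP]. Qed.

Lemma intg_le X Y : measurable_fun setT X -> intg Y ->
  (forall w, `|X w| <= `|Y w|) -> intg X.
Proof.
move=> mX iY XY; apply: (le_integrable _ _ _ iY) => //.
- exact/measurable_EFinP.
- by move=> w _; rewrite /= lee_fin.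
Qed.

Lemma intg_cst (c : R) : intg (fun=> c).
Proof. exact: finite_measure_integrable_cst. Qed.

Lemma intgD X Y : intg X -> intg Y -> intg (fun w => X w + Y w).
Proof. by move=> iX iY; exact: (@integrableD _ _ _ P setT measurableT _ _ iX iY). Qed.

Lemma intgZ (c : R) X : intg X -> intg (fun w => c * X w).
Proof. by move=> iX; exact: (@integrableZl _ _ _ P setT measurableT c _ iX). Qed.

Lemma intgB X Y : intg X -> intg Y -> intg (fun w => X w - Y w).
Proof. by move=> iX iY; exact: (@integrableB _ _ _ P setT measurableT _ _ iX iY). Qed.

Lemma intg_sum (I : Type) (r : seq I) (Q : pred I) (F : I -> Omega -> R) :
  (forall i, Q i -> intg (F i)) -> intg (fun w => \sum_(i <- r | Q i) F i w).
Proof.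
move=> iF; elim: r => [|i r IH].
  by rewrite (_ : (fun _ => _) = fun=> 0) ?funeqE => [|w]; [exact: intg_cst|rewrite big_nil].
case Qi : (Q i).
  rewrite (_ : (fun _ => _) = fun w => F i w + \sum_(i <- r | Q i) F i w).
    by apply: intgD => //; exact: iF.
  by apply/funext => w; rewrite big_cons Qi.
by rewrite (_ : (fun _ => _) = fun w => \sum_(i <- r | Q i) F i w) //;
   apply/funext => w; rewrite big_cons Qi.
Qed.

Lemma ExD X Y : intg X -> intg Y -> Ex (fun w => X w + Y w) = Ex X + Ex Y.
Proof. by move=> iX iY; rewrite /Ex RintegralD. Qed.

Lemma ExB X Y : intg X -> intg Y -> Ex (fun w => X w - Y w) = Ex X - Ex Y.
Proof. by move=> iX iY; rewrite /Ex RintegralB. Qed.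

Lemma ExZ (c : R) X : intg X -> Ex (fun w => c * X w) = c * Ex X.
Proof. by move=> iX; rewrite /Ex RintegralZl. Qed.

Lemma Ex_cst (c : R) : Ex (fun=> c) = c.
Proof. by rewrite /Ex Rintegral_cst// -[RHS]mulr1; congr (_ * _); rewrite [X in fine X]probability_setT. Qed.

Lemma Ex_sum (I : Type) (r : seq I) (Q : pred I) (F : I -> Omega -> R) :
  (forall i, Q i -> intg (F i)) ->
  Ex (fun w => \sum_(i <- r | Q i) F i w) = \sum_(i <- r | Q i) Ex (F i).
Proof.
move=> iF; elim: r => [|i r IH].
  by rewrite big_nil -[RHS](Ex_cst 0); congr Ex; apply/funext => w; rewrite big_nil.
rewrite big_cons; case Qi : (Q i).
  rewrite -IH -ExD; [|exact: iF|exact: intg_sum].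
  by congr Ex; apply/funext => w; rewrite big_cons Qi.
by rewrite -IH; congr Ex; apply/funext => w; rewrite big_cons Qi.
Qed.

Lemma Ex_ge0 X : (forall w, 0 <= X w) -> 0 <= Ex X.
Proof. by move=> X0; apply: Rintegral_ge0. Qed.

Lemma le_Ex X Y : intg X -> intg Y -> (forall w, X w <= Y w) -> Ex X <= Ex Y.
Proof. by move=> iX iY XY; apply: le_Rintegral. Qed.

Lemma intg_abs X : intg X -> intg (fun w => `|X w|).
Proof.
move=> iX; apply: (intg_le _ iX) => [|w]; last by rewrite normr_id.
by apply: measurableT_comp => //; exact: intg_meas.
Qed.

Lemma L2_meas Y : L2 Y -> measurable_fun setT Y. Proof. by case. Qed.
Lemma measX n Y : measurable_fun setT Y -> measurable_fun setT (fun w => Y w ^+ n).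
Proof. by move=> mY; exact: measurable_funX. Qed.

Lemma L2_intgM X Y : L2 X -> L2 Y -> intg (fun w => X w * Y w).
Proof.
move=> [mX iX] [mY iY]; apply: (intg_le _ (intgD iX iY)).
  exact: measurable_funM.
move=> w; rewrite [leRHS]ger0_norm ?addr_ge0 ?sqr_ge0// normrM.
rewrite -(@real_normK _ (X w)) ?num_real// -(@real_normK _ (Y w)) ?num_real//.
have := normr_ge0 (X w); have := normr_ge0 (Y w); set x := `|X w|; set y := `|Y w|.
by have := sqr_ge0 (x - y); nra.
Qed.

Lemma L2_cst (c : R) : L2 (fun=> c).
Proof. by split; [exact: measurable_cst|exact: intg_cst]. Qed.

Lemma L2_intg X : L2 X -> intg X.
Proof.
move=> LX; have := L2_intgM LX (L2_cst 1).
by congr intg; apply/funext => w; rewrite mulr1.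
Qed.

Lemma L2D X Y : L2 X -> L2 Y -> L2 (fun w => X w + Y w).
Proof.
move=> LX LY; split; first exact: measurable_funD (L2_meas LX) (L2_meas LY).
have := intgD (intgD LX.2 LY.2) (intgZ 2 (L2_intgM LX LY)).
by congr intg; apply/funext => w; ring.
Qed.

Lemma L2Z (c : R) X : L2 X -> L2 (fun w => c * X w).
Proof.
move=> LX; split; first exact: measurable_funM (measurable_cst _) (L2_meas LX).
by have := intgZ (c ^+ 2) LX.2; congr intg; apply/funext => w; ring.
Qed.

Lemma L2B X Y : L2 X -> L2 Y -> L2 (fun w => X w - Y w).
Proof.
move=> LX LY; have := L2D LX (L2Z (-1) LY).
by congr L2; apply/funext => w; ring.
Qed.

Lemma L2_sum (I : Type) (r : seq I) (Q : pred I) (F : I -> Omega -> R) :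
  (forall i, Q i -> L2 (F i)) -> L2 (fun w => \sum_(i <- r | Q i) F i w).
Proof.
move=> iF; elim: r => [|i r IH].
  by rewrite (_ : (fun _ => _) = fun=> 0) ?funeqE => [|w]; [exact: L2_cst|rewrite big_nil].
case Qi : (Q i).
  rewrite (_ : (fun _ => _) = fun w => F i w + \sum_(i <- r | Q i) F i w).
    by apply: L2D => //; exact: iF.
  by apply/funext => w; rewrite big_cons Qi.
by rewrite (_ : (fun _ => _) = fun w => \sum_(i <- r | Q i) F i w) //;
   apply/funext => w; rewrite big_cons Qi.
Qed.

Lemma Ex_sqr_ge0 X : 0 <= Ex (fun w => X w ^+ 2).
Proof. by apply: Ex_ge0 => w; rewrite sqr_ge0. Qed.

Lemma N2_ge0 X : 0 <= N2 X. Proof. exact: sqrtr_ge0. Qed.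
Lemma N4_ge0 X : 0 <= N4 X. Proof. exact: sqrtr_ge0. Qed.

Lemma N2_sqr X : N2 X ^+ 2 = Ex (fun w => X w ^+ 2).
Proof. by rewrite sqr_sqrtr// Ex_sqr_ge0. Qed.

Lemma N4_sqr X : N4 X ^+ 2 = N2 (fun w => X w ^+ 2).
Proof. by rewrite sqr_sqrtr// N2_ge0. Qed.

(** The quadratic form E (aX + cY)^2 is nonnegative; a = -m and c = (N2 X)^2 give the inequality up
    to the factor (N2 X)^2. *)
Lemma CS X Y : L2 X -> L2 Y -> `|Ex (fun w => X w * Y w)| <= N2 X * N2 Y.
Proof.
move=> LX LY; set m := Ex (fun w => X w * Y w).
have key (a c : R) : 0 <= a ^+ 2 * N2 X ^+ 2 + 2 * a * c * m + c ^+ 2 * N2 Y ^+ 2.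
  have := Ex_sqr_ge0 (fun w => a * X w + c * Y w).
  rewrite !N2_sqr -(ExZ _ LX.2) -(ExZ _ LY.2) -(ExZ _ (L2_intgM LX LY)).
  have i1 := intgZ (a ^+ 2) LX.2; have i3 := intgZ (c ^+ 2) LY.2.
  have i2 := intgZ (2 * a * c) (L2_intgM LX LY).
  rewrite -(ExD i1 i2) -(ExD (intgD i1 i2) i3).
  by move=> h; apply: (le_trans h); rewrite le_eqVlt; apply/orP; left; apply/eqP;
     congr Ex; apply/funext => w; ring.
have x0 := N2_ge0 X; have y0 := N2_ge0 Y.
have [X0|X0] := eqVneq (N2 X) 0.
  rewrite X0 mul0r; have [->|m0] := eqVneq m 0; first by rewrite normr0.
  (* If [N2 X] vanishes, the form at c = 1 is affine in a; for m nonzero this a would give it the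
     value -1. *)
  have := key (- (N2 Y ^+ 2 + 1) / (2 * m)) 1; rewrite X0.
  by have -> : 2 * (- (N2 Y ^+ 2 + 1) / (2 * m)) * 1 * m = - (N2 Y ^+ 2 + 1);
    [by field|lra].
have xp : 0 < N2 X by rewrite lt_neqAle eq_sym X0.
rewrite -ler_sqr ?nnegrE ?mulr_ge0// real_normK ?num_real//.
have := key (- m) (N2 X ^+ 2).
have -> : (- m) ^+ 2 * N2 X ^+ 2 + 2 * - m * N2 X ^+ 2 * m + (N2 X ^+ 2) ^+ 2 * N2 Y ^+ 2
  = N2 X ^+ 2 * ((N2 X * N2 Y) ^+ 2 - m ^+ 2) by ring.
by rewrite pmulr_rge0 ?exprn_gt0// subr_ge0.
Qed.

Lemma N2_cst (c : R) : N2 (fun=> c) = `|c|.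
Proof. by rewrite /N2 Ex_cst sqrtr_sqr. Qed.

Lemma N2D X Y : L2 X -> L2 Y -> N2 (fun w => X w + Y w) <= N2 X + N2 Y.
Proof.
move=> LX LY; rewrite -ler_sqr ?nnegrE ?addr_ge0 ?N2_ge0// sqrrD !N2_sqr.
have iXY := L2_intgM LX LY.
rewrite [leLHS](_ : _ = Ex (fun w => X w ^+ 2) + 2 * Ex (fun w => X w * Y w) + Ex (fun w => Y w ^+ 2)).
  rewrite lerD2r lerD2l -[leRHS]mulr_natl ler_wpM2l//.
  by rewrite (le_trans (ler_norm _))// CS.
have i2 := intgZ 2 iXY.
rewrite -ExZ// -(ExD LX.2 i2) -(ExD (intgD LX.2 i2) LY.2).
by congr Ex; apply/funext => w; ring.
Qed.

Lemma N2Z (c : R) X : L2 X -> N2 (fun w => c * X w) = `|c| * N2 X.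
Proof.
move=> LX; apply/eqP; rewrite -(eqrXn2 (n := 2)) ?mulr_ge0 ?N2_ge0//.
rewrite exprMn !N2_sqr -ExZ ?real_normK ?num_real//; last exact: LX.2.
by apply/eqP; congr Ex; apply/funext => w; ring.
Qed.

Lemma N2B X Y : L2 X -> L2 Y -> N2 (fun w => X w - Y w) <= N2 X + N2 Y.
Proof.
move=> LX LY; have := N2D LX (L2Z (-1) LY).
rewrite N2Z// normrN normr1 mul1r; apply: le_trans; rewrite le_eqVlt; apply/orP; left.
by apply/eqP; congr N2; apply/funext => w; ring.
Qed.

Lemma N2_le X Y : L2 X -> L2 Y -> (forall w, `|X w| <= `|Y w|) -> N2 X <= N2 Y.
Proof.
move=> LX LY XY; rewrite ler_sqrt ?Ex_sqr_ge0//; apply: le_Ex; [exact: LX.2|exact: LY.2|].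
by move=> w; rewrite -[X w ^+ 2]real_normK ?num_real// -[Y w ^+ 2]real_normK ?num_real// lerXn2r ?nnegrE.
Qed.

Lemma Ex_le_N2 X : L2 X -> `|Ex X| <= N2 X.
Proof.
move=> LX; have := CS LX (L2_cst 1); rewrite N2_cst normr1 mulr1; apply: le_trans.
by rewrite le_eqVlt; apply/orP; left; apply/eqP; congr (`|Ex _|); apply/funext => w; rewrite mulr1.
Qed.

Lemma Exabs_le_N2 X : L2 X -> Ex (fun w => `|X w|) <= N2 X.
Proof.
move=> LX.
have LaX : L2 (fun w => `|X w|).
  split; first by apply: measurableT_comp => //; exact: L2_meas.
  by have := LX.2; congr intg; apply/funext => w; rewrite real_normK ?num_real.
apply: (le_trans (ler_norm _)); apply: (le_trans (Ex_le_N2 LaX)).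
by apply: N2_le => // w; rewrite normr_id.
Qed.

Lemma L4_sqr X : L4 X -> L2 (fun w => X w ^+ 2).
Proof.
move=> LX; split; first exact: measX LX.1.
by have := LX.2; congr intg; apply/funext => w; rewrite -exprM.
Qed.

Lemma L4_L2 X : L4 X -> L2 X.
Proof. by move=> LX; split; [exact: LX.1|exact: L2_intg (L4_sqr LX)]. Qed.

Lemma L4_L2M X Y : L4 X -> L4 Y -> L2 (fun w => X w * Y w).
Proof.
move=> LX LY; split; first exact: measurable_funM LX.1 LY.1.
have := L2_intgM (L4_sqr LX) (L4_sqr LY).
by congr intg; apply/funext => w; rewrite exprMn.
Qed.

Lemma L4_cst (c : R) : L4 (fun=> c).
Proof. by split; [exact: measurable_cst|exact: intg_cst]. Qed.

Lemma L4_sqrE X : measurable_fun setT X -> L2 (fun w => X w ^+ 2) -> L4 X.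
Proof.
move=> mX [_ h]; split => //; move: h.
by congr intg; apply/funext => w; rewrite -exprM.
Qed.

Lemma L4D X Y : L4 X -> L4 Y -> L4 (fun w => X w + Y w).
Proof.
move=> LX LY; apply: L4_sqrE; first exact: measurable_funD LX.1 LY.1.
have := L2D (L2D (L4_sqr LX) (L4_sqr LY)) (L2Z 2 (L4_L2M LX LY)).
by congr L2; apply/funext => w; ring.
Qed.

Lemma L4Z (c : R) X : L4 X -> L4 (fun w => c * X w).
Proof.
move=> LX; apply: L4_sqrE; first exact: measurable_funM (measurable_cst _) LX.1.
by have := L2Z (c ^+ 2) (L4_sqr LX); congr L2; apply/funext => w; ring.
Qed.

Lemma L4B X Y : L4 X -> L4 Y -> L4 (fun w => X w - Y w).
Proof.
move=> LX LY; have := L4D LX (L4Z (-1) LY).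
by congr L4; apply/funext => w; ring.
Qed.

Lemma L4_sum (I : Type) (r : seq I) (Q : pred I) (F : I -> Omega -> R) :
  (forall i, Q i -> L4 (F i)) -> L4 (fun w => \sum_(i <- r | Q i) F i w).
Proof.
move=> iF; elim: r => [|i r IH].
  by rewrite (_ : (fun _ => _) = fun=> 0) ?funeqE => [|w]; [exact: L4_cst|rewrite big_nil].
case Qi : (Q i).
  rewrite (_ : (fun _ => _) = fun w => F i w + \sum_(i <- r | Q i) F i w).
    by apply: L4D => //; exact: iF.
  by apply/funext => w; rewrite big_cons Qi.
by rewrite (_ : (fun _ => _) = fun w => \sum_(i <- r | Q i) F i w) //;
   apply/funext => w; rewrite big_cons Qi.
Qed.

Lemma N2M X Y : L4 X -> L4 Y -> N2 (fun w => X w * Y w) <= N4 X * N4 Y.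
Proof.
move=> LX LY; rewrite -ler_sqr ?nnegrE ?mulr_ge0 ?N2_ge0 ?N4_ge0//.
rewrite exprMn !N4_sqr N2_sqr (le_trans (ler_norm _))//.
have := CS (L4_sqr LX) (L4_sqr LY); apply: le_trans.
by rewrite le_eqVlt; apply/orP; left; apply/eqP; congr (`|Ex _|); apply/funext => w; rewrite exprMn.
Qed.

Lemma N4D X Y : L4 X -> L4 Y -> N4 (fun w => X w + Y w) <= N4 X + N4 Y.
Proof.
move=> LX LY; rewrite -ler_sqr ?nnegrE ?addr_ge0 ?N4_ge0// sqrrD !N4_sqr.
rewrite [in leLHS](_ : (fun w => _) = (fun w => X w ^+ 2 + 2 * (X w * Y w) + Y w ^+ 2)).
  apply: (le_trans (N2D _ (L4_sqr LY))).
    by apply: L2D; [exact: L4_sqr|exact: L2Z (L4_L2M LX LY)].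
  rewrite lerD2r; apply: (le_trans (N2D (L4_sqr LX) (L2Z _ (L4_L2M LX LY)))).
  rewrite lerD2l (N2Z _ (L4_L2M LX LY)) normr_nat -[leRHS]mulr_natl ler_wpM2l//.
  exact: N2M.
by apply/funext => w; ring.
Qed.

Lemma N4_cst (c : R) : N4 (fun=> c) = `|c|.
Proof. by rewrite /N4 N2_cst normrX sqrtr_sqr normr_id. Qed.

Lemma N4Z (c : R) X : L4 X -> N4 (fun w => c * X w) = `|c| * N4 X.
Proof.
move=> LX; apply/eqP; rewrite -(eqrXn2 (n := 2)) ?mulr_ge0 ?N4_ge0//.
rewrite exprMn !N4_sqr -[`|c| ^+ 2]ger0_norm ?sqr_ge0// -N2Z; last exact: L4_sqr.
by apply/eqP; congr N2; apply/funext => w; rewrite real_normK ?num_real// exprMn.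
Qed.

Lemma N4B X Y : L4 X -> L4 Y -> N4 (fun w => X w - Y w) <= N4 X + N4 Y.
Proof.
move=> LX LY; have := N4D LX (L4Z (-1) LY).
rewrite N4Z// normrN normr1 mul1r; apply: le_trans; rewrite le_eqVlt; apply/orP; left.
by apply/eqP; congr N4; apply/funext => w; ring.
Qed.

Lemma N4_sum (I : Type) (r : seq I) (Q : pred I) (F : I -> Omega -> R) :
  (forall i, Q i -> L4 (F i)) ->
  N4 (fun w => \sum_(i <- r | Q i) F i w) <= \sum_(i <- r | Q i) N4 (F i).
Proof.
move=> iF; elim: r => [|i r IH].
  rewrite big_nil (_ : (fun _ => _) = fun=> 0) ?N4_cst ?normr0//.
  by apply/funext => w; rewrite big_nil.
rewrite big_cons; case Qi : (Q i).
  rewrite (_ : (fun _ => _) = fun w => F i w + \sum_(i <- r | Q i) F i w).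
    by apply: (le_trans (N4D (iF _ Qi) (L4_sum r iF))); rewrite lerD2l.
  by apply/funext => w; rewrite big_cons Qi.
by rewrite (_ : (fun _ => _) = fun w => \sum_(i <- r | Q i) F i w) //;
   apply/funext => w; rewrite big_cons Qi.
Qed.

Lemma N2_le_N4 X : L4 X -> N2 X <= N4 X.
Proof.
move=> LX; rewrite -ler_sqr ?nnegrE ?N2_ge0 ?N4_ge0// N2_sqr N4_sqr.
by rewrite (le_trans (ler_norm _))// Ex_le_N2//; exact: L4_sqr.
Qed.

End Moments.

(** * Transfer of laws along injective reindexings *)

Section Cylinders.
Context {R : realType}.

Definition cyl (I : Type) : set (set (I -> R)) :=
  [set A | exists (i : I) (B : set R), measurable B /\ A = [set x | B (x i)]].

Definition rect (I : eqType) (J : seq I) (B : I -> set R) : set (I -> R) :=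
  [set x | forall i, i \in J -> B i (x i)].

Definition rects (I : eqType) : set (set (I -> R)) :=
  [set A | exists (J : seq I) (B : I -> set R),
     (forall i, measurable (B i)) /\ A = rect J B].

(** Real families with the product sigma-algebra. The index type is arbitrary because both single
    paths ([int]) and a path together with its copy ([bool * int]) occur. *)
Definition paths (I : Type) := g_sigma_algebraType (@cyl I).
HB.instance Definition _ (I : Type) := Measurable.on (paths I).

Lemma cyl_meas (I : Type) (i : I) (B : set R) : measurable B ->
  measurable ([set x | B (x i)] : set (paths I)).
Proof. by move=> mB; apply: sub_sigma_algebra; exists i, B. Qed.

Lemma rect_meas (I : eqType) J B : (forall i : I, measurable (B i)) ->
  measurable (rect J B : set (paths I)).
Proof.
move=> mB; elim: J => [|i J IH].
  by rewrite (_ : rect _ _ = setT)//; apply/seteqP; split.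
rewrite (_ : rect _ _ = [set x | B i (x i)] `&` rect J B).
  by apply: measurableI => //; exact: cyl_meas.
apply/seteqP; split => [x h|x [h1 h2] j].
  by split => [|j jJ]; apply: h; rewrite inE ?eqxx ?jJ ?orbT.
by rewrite inE => /orP[/eqP->//|]; exact: h2.
Qed.

Lemma rects_setI (I : eqType) : setI_closed (@rects I).
Proof.
move=> _ _ [J1 [B1 [mB1 ->]]] [J2 [B2 [mB2 ->]]].
exists (J1 ++ J2), (fun i => (if i \in J1 then B1 i else setT) `&`
                            (if i \in J2 then B2 i else setT)); split.
  by move=> i; apply: measurableI; case: ifP.
apply/seteqP; split => [x [h1 h2] i|x h].
  by rewrite mem_cat => iJ; split; case: ifP => // ?; [exact: h1|exact: h2].
split => i iJ; have := h i; rewrite mem_cat iJ ?orbT => /(_ isT) [].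
  by [].
by move=> _.
Qed.

Lemma rects_gen (I : eqType) : <<s @rects I >> = <<s @cyl I >>.
Proof.
apply/seteqP; split; apply: smallest_sub; try exact: smallest_sigma_algebra.
  by move=> _ [J [B [mB ->]]]; exact: rect_meas.
move=> _ [i [B [mB ->]]]; apply: sub_sigma_algebra; exists [:: i], (fun=> B); split => //.
by apply/seteqP; split => [x h j|x]; [rewrite inE => /eqP->|move/(_ i (mem_head _ _))].
Qed.

Lemma meas_paths d (T : measurableType d) (I : Type) (f : T -> paths I) :
  (forall i, measurable_fun setT (fun w => f w i)) -> measurable_fun setT f.
Proof.
move=> mf; apply: (@measurability _ _ T (paths I) setT f (@cyl I)) => //.
move=> _ [_ [i [B [mB ->]]] <-].
by have := mf i measurableT _ mB.
Qed.

Lemma meas_coord (I : Type) (i : I) : measurable_fun setT (fun x : paths I => x i).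
Proof. by move=> _ B mB; rewrite setTI; exact: cyl_meas. Qed.

End Cylinders.

Section Law.
Context {R : realType} {d0 : measure_display} {Omega : measurableType d0}.
Variable P : probability Omega R.
Context {I : eqType}.
Variable xi : I -> Omega -> R.
Hypothesis mxi : forall i, measurable_fun setT (xi i).
Hypothesis indep : mutual_indep P xi.
Hypothesis ident : ident_distr P xi.

Lemma prob_rect (J : seq I) B : uniq J -> (forall i, measurable (B i)) ->
  P [set w | forall i, i \in J -> B i (xi i w)] =
  (\prod_(i <- J) fine (P (xi i @^-1` B i)))%:E.
Proof.
move=> uJ mB; rewrite -(indep uJ mB) fineK.
  by congr (P _); apply/seteqP; split => w h i; exact: h.
apply: fin_num_measure; apply: fin_bigcap_measurable => // i _.
by rewrite -[X in measurable X]setTI; exact: mxi.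
Qed.

Definition sel (I0 : Type) (iota : I0 -> I) (w : Omega) : paths I0 := fun i => xi (iota i) w.

Lemma meas_sel (I0 : Type) (iota : I0 -> I) : measurable_fun setT (@sel I0 iota).
Proof. by apply: meas_paths => i; exact: mxi. Qed.

Lemma rect_event_meas (J : seq I) B : (forall i, measurable (B i)) ->
  measurable [set w | forall i, i \in J -> B i (xi i w)].
Proof.
move=> mB; have := meas_sel id measurableT (rect_meas J mB).
by rewrite setTI.
Qed.

(** Since [iota] avoids J, the joint event is one rectangle over J followed by the image of J0, and
    factors by independence. Identical distribution then replaces [iota] by [iota'] coordinate by
    coordinate; [iota'] may meet J, as the right-hand side is a product of separate
    probabilities. *)
Lemma law_rect (I0 : eqType) (iota iota' : I0 -> I) (J : seq I) B (J0 : seq I0) B0 :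
  injective iota -> injective iota' -> (forall i, iota i \notin J) ->
  (forall i, measurable (B i)) -> (forall i, measurable (B0 i)) ->
  P ([set w | forall i, i \in J -> B i (xi i w)] `&` sel iota @^-1` rect J0 B0) =
  (P [set w | forall i, i \in J -> B i (xi i w)] * P (sel iota' @^-1` rect J0 B0))%E.
Proof.
move=> inj inj' av mB mB0.
wlog uJ : J av / uniq J.
  move=> h; have := h (undup J); rewrite undup_uniq.
  rewrite (_ : [set w | forall i, i \in undup J -> _] = [set w | forall i, i \in J -> B i (xi i w)]).
    by apply => // i; rewrite mem_undup.
  by apply/seteqP; split => w h' i; have := h' i; rewrite mem_undup.
wlog uJ0 : J0 / uniq J0.
  move=> h; have := h (undup J0); rewrite undup_uniq.
  rewrite (_ : rect (undup J0) B0 = rect J0 B0); first by apply.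
  by apply/seteqP; split => w h' i; have := h' i; rewrite mem_undup.
(* A nonempty J0 supplies the default value of [nth] below; an empty one gives the whole space. *)
have [i0|J0n] := pselect (exists i : I0, i \in J0); last first.
  have -> : rect J0 B0 = setT.
    by apply/seteqP; split => // x _ i iJ; exfalso; apply: J0n; exists i.
  by rewrite !preimage_setT setIT [X in (_ * X)%E]probability_setT mule1.
case: i0 => i0 _.
pose inv (io : I0 -> I) j := nth i0 J0 (index j (map io J0)).
have invK io i : injective io -> i \in J0 -> inv io (io i) = i.
  by move=> io_inj iJ; rewrite /inv index_map// nth_index.
pose C j := if j \in map iota J0 then B0 (inv iota j) else B j.
have uJJ : uniq (J ++ map iota J0).
  rewrite cat_uniq uJ map_inj_uniq// uJ0 andbT /=; apply/hasPn => _ /mapP[i _ ->].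
  exact: av.
have mC j : measurable (C j) by rewrite /C; case: ifP.
have CJ j : j \in J -> C j = B j.
  move=> jJ; rewrite /C; case: ifP => // /mapP[i _ ji].
  by have := av i; rewrite -ji jJ.
have CJ0 i : i \in J0 -> C (iota i) = B0 i.
  by move=> iJ; rewrite /C map_f// invK.
have mC' j : measurable (B0 (inv iota' j)) by [].
have -> : [set w | forall i, i \in J -> B i (xi i w)] `&` sel iota @^-1` rect J0 B0 =
    [set w | forall i, i \in J ++ map iota J0 -> C i (xi i w)].
  apply/seteqP; split => [w [h1 h2] j|w h].
    rewrite mem_cat => /orP[jJ|/mapP[i iJ ->]]; first by rewrite CJ//; exact: h1.
    by rewrite CJ0//; exact: h2.
  split => i iJ.
    by rewrite -CJ//; apply: h; rewrite mem_cat iJ.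
  by rewrite -CJ0//; apply: h; rewrite mem_cat map_f ?orbT.
have -> : sel iota' @^-1` rect J0 B0 =
    [set w | forall i, i \in map iota' J0 -> B0 (inv iota' i) (xi i w)].
  apply/seteqP; split => [w h _ /mapP[i iJ ->]|w h i iJ]; first by rewrite invK//; exact: h.
  by have := h (iota' i); rewrite invK//; apply; exact: map_f.
have uJ' : uniq (map iota' J0) by rewrite map_inj_uniq.
rewrite (prob_rect uJJ mC) (prob_rect uJ mB) (prob_rect uJ' mC') -EFinM big_cat/=; congr (_ * _)%:E.
  by apply: eq_big_seq => j jJ; rewrite CJ.
rewrite !big_map; apply: eq_big_seq => i iJ; rewrite CJ0// invK//.
by congr fine; exact: ident.
Qed.

(** Rectangles form a pi-system generating the product sigma-algebra, and for fixed A the sets D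
    that satisfy the identity form a Dynkin system. *)
Lemma law (I0 : eqType) (iota iota' : I0 -> I) (J : seq I) B (D : set (paths I0)) :
  injective iota -> injective iota' -> (forall i, iota i \notin J) ->
  (forall i, measurable (B i)) -> measurable D ->
  P ([set w | forall i, i \in J -> B i (xi i w)] `&` sel iota @^-1` D) =
  (P [set w | forall i, i \in J -> B i (xi i w)] * P (sel iota' @^-1` D))%E.
Proof.
move=> inj inj' av mB mD; set A := [set w | _].
have mA : measurable A by exact: rect_event_meas.
pose H := [set D : set (paths I0) | measurable D /\
   P (A `&` sel iota @^-1` D) = (P A * P (sel iota' @^-1` D))%E].
have mpre io (E : set (paths I0)) : measurable E -> measurable (sel io @^-1` E).
  by move=> mE; rewrite -[X in measurable X]setTI; exact: meas_sel.
suff : <<s @rects R I0 >> `<=` H by rewrite rects_gen => /(_ _ mD) [].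
apply: (lambda_system_subset (@rects_setI _ _) (D := setT)) => //; last first.
  move=> _ [J0 [B0 [mB0 ->]]]; split; first exact: rect_meas.
  exact: law_rect.
apply/dynkin_lambda_system; split.
- by split => //; rewrite !preimage_setT setIT [X in (_ * X)%E]probability_setT mule1.
- move=> E [mE hE]; split; first exact: measurableC.
  have mU := mpre iota _ mE; have mV := mpre iota' _ mE; move: hE mU mV.
  have -> : A `&` sel iota @^-1` (~` E) = A `\` (sel iota @^-1` E) by [].
  have -> : sel iota' @^-1` (~` E) = ~` (sel iota' @^-1` E) by [].
  move: (sel iota @^-1` E) (sel iota' @^-1` E) => U V hUV mU mV.
  rewrite measureD//; last by rewrite ltey_eq fin_num_measure.
  rewrite [X in (_ - X)%E](_ : _ = P A * P V)%E//.
  rewrite [X in _ = (_ * X)%E](_ : _ = 1 - P V)%E; last first.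
    exact: probability_setC.
  rewrite muleBr ?mule1 ?fin_num_measure//.
- move=> F tF hF; have mF n : measurable (F n : set (paths I0)) by have [] := hF n.
  split; first exact: (@bigcupT_measurable _ (paths I0)).
  have tpre io : trivIset setT (fun n => sel io @^-1` F n).
    apply/trivIsetP => i j _ _ ij; rewrite -preimage_setI.
    by move/trivIsetP : tF => /(_ _ _ Logic.I Logic.I ij) ->; rewrite preimage_set0.
  have mU n := mpre iota _ (mF n); have mV n := mpre iota' _ (mF n).
  have key (U V : nat -> set Omega) : (forall n, measurable (U n)) -> (forall n, measurable (V n)) ->
      trivIset setT U -> trivIset setT V -> (forall n, P (A `&` U n) = (P A * P (V n))%E) ->
      P (\bigcup_n (A `&` U n)) = (P A * P (\bigcup_n V n))%E.
    move=> mU' mV' tU tV hU.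
    have mAU n : setT n -> measurable (A `&` U n) by move=> _; exact: measurableI.
    have tAU : trivIset setT (fun n => A `&` U n) by exact: trivIset_setIl.
    rewrite (measure_bigcup P _ _ mAU tAU) (measure_bigcup P _ _ (fun n _ => mV' n) tV).
    have PA : P A \is a fin_num by exact: fin_num_measure.
    rewrite -(fineK PA) -nneseriesZl//.
    by apply: eq_eseriesr => n _; rewrite fineK//; exact: hU.
  rewrite !preimage_bigcup setI_bigcupr; apply: key => // n.
  exact: (hF n).2.
Qed.

(** By [law], the image of P restricted to A under [Phi] along [iota], and P A times the image of P
    under [Phi] along [iota'], are the same measure on the line; both sides integrate the same
    function against it. *)
Lemma ge0_law_integral (I0 : eqType) (iota iota' : I0 -> I) (J : seq I) B
    (Phi : paths I0 -> R) :
  injective iota -> injective iota' -> (forall i, iota i \notin J) ->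
  (forall i, measurable (B i)) -> measurable_fun setT Phi -> (forall x, 0 <= Phi x) ->
  (\int[P]_(w in [set w | forall i, i \in J -> B i (xi i w)]) (Phi (sel iota w))%:E =
  P [set w | forall i, i \in J -> B i (xi i w)] * \int[P]_w (Phi (sel iota' w))%:E)%E.
Proof.
move=> inj inj' av mB mPhi Phi0; set A := [set w | _].
have mA : measurable A by exact: rect_event_meas.
pose c := NngNum (fine_ge0 (measure_ge0 P A)).
(* The change of variables is applied to an integrand that is nonnegative on all of R; the absolute
   value agrees with the identity on the range of [Phi]. *)
pose Phi1 := (fun x => `|x|%:E) : R -> \bar R.
have mPhi1 : measurable_fun setT Phi1.
  by apply/measurable_EFinP; exact: normr_measurable.
have mX io : measurable_fun setT (fun w => Phi (sel io w)).
  by apply: measurableT_comp => //; exact: meas_sel.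
pose m1 := pushforward (mrestr P mA) (fun w => Phi (sel iota w)).
pose m2_ := mscale c (pushforward P (fun w => Phi (sel iota' w))).
pose m2 := m2_ (mX iota').
have Phi10 y : (0 <= Phi1 y)%E by rewrite lee_fin.
have pos io w : Phi1 (Phi (sel io w)) = (Phi (sel io w))%:E by rewrite /Phi1 ger0_norm.
have m12 (U : set R) : measurable U -> m1 U = m2 U.
  move=> mU; rewrite /m1 /m2 /m2_ /pushforward /mrestr /mscale/= fineK ?fin_num_measure// setIC.
  have mD : measurable (Phi @^-1` U : set (paths I0)).
    by rewrite -[X in measurable X]setTI; exact: mPhi.
  exact: (law inj inj' av mB mD).
have mnx io : measurable_fun setT (fun w => Phi1 (Phi (sel io w))).
  by apply: measurableT_comp => //.
transitivity (\int[m1]_x Phi1 x)%E.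
  rewrite (ge0_integral_pushforward (mX iota))//.
  rewrite preimage_setT (ge0_negligible_integral (N := ~` A))//; last 4 first.
  - exact: measurableC.
  - exact: mnx.
  - by move=> w _; exact: Phi10.
  - by rewrite [LHS](_ : _ = P (~` A `&` A))// setICl measure0.
  rewrite setTD setCK (@eq_measure_integral _ _ _ _ P).
    by apply: eq_integral => w _; rewrite /= pos.
  by move=> E mE EA; rewrite [LHS](_ : _ = P (E `&` A))// setIidl.
transitivity (\int[m2]_x Phi1 x)%E.
  by apply: eq_measure_integral => U mU _; exact: m12.
rewrite ge0_integral_mscale// (ge0_integral_pushforward (mX iota'))//.
rewrite preimage_setT /c/= fineK ?fin_num_measure//; congr (_ * _)%E.
by apply: eq_integral => w _; rewrite /= pos.
Qed.

Lemma ge0_law_integral0 (I0 : eqType) (iota iota' : I0 -> I) (Phi : paths I0 -> R) :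
  injective iota -> injective iota' -> measurable_fun setT Phi -> (forall x, 0 <= Phi x) ->
  (\int[P]_w (Phi (sel iota w))%:E = \int[P]_w (Phi (sel iota' w))%:E)%E.
Proof.
move=> inj inj' mPhi Phi0.
have := @ge0_law_integral I0 iota iota' [::] (fun=> setT) Phi inj inj' _ _ mPhi Phi0.
rewrite (_ : [set w | _] = setT); last by apply/seteqP; split.
by rewrite [X in (X * _)%E]probability_setT mul1e; apply.
Qed.

Lemma law_intg (I0 : eqType) (iota iota' : I0 -> I) (Phi : paths I0 -> R) :
  injective iota -> injective iota' -> measurable_fun setT Phi ->
  intg P (fun w => Phi (sel iota' w)) -> intg P (fun w => Phi (sel iota w)).
Proof.
move=> inj inj' mPhi /integrableP[_ fin]; apply/integrableP; split.
  by apply/measurable_EFinP/measurableT_comp => //; exact: meas_sel.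
move: fin; rewrite (ge0_law_integral0 (Phi := fun x => `|Phi x|) inj' inj)//.
exact: measurableT_comp.
Qed.

(** Positive and negative parts are treated separately; both are dominated by [Phi], which keeps
    every expectation finite. *)
Lemma law_Ex_rect (I0 : eqType) (iota iota' : I0 -> I) (J : seq I) B (Phi : paths I0 -> R) :
  injective iota -> injective iota' -> (forall i, iota i \notin J) ->
  (forall i, measurable (B i)) -> measurable_fun setT Phi ->
  intg P (fun w => Phi (sel iota' w)) ->
  let A := [set w | forall i, i \in J -> B i (xi i w)] in
  Ex P (fun w => \1_A w * Phi (sel iota w)) = Ex P \1_A * Ex P (fun w => Phi (sel iota' w)).
Proof.
move=> inj inj' av mB mPhi iPhi A.
have mA : measurable A by exact: rect_event_meas.
have iPhi1 := law_intg inj inj' mPhi iPhi.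
pose Pp x := Num.max (Phi x) 0; pose Pn x : R := Num.max (- Phi x) 0.
have mPp : measurable_fun setT Pp by exact: measurable_funrpos.
have mPn : measurable_fun setT Pn by exact: measurable_funrneg.
have Pp0 x : 0 <= Pp x by rewrite le_max lexx orbT.
have Pn0 x : 0 <= Pn x by rewrite le_max lexx orbT.
have Pe x : Phi x = Pp x - Pn x.
  rewrite /Pp /Pn; have [h|/ltW h] := leP (Phi x) 0.
    by rewrite max_l ?oppr_ge0// sub0r opprK.
  by rewrite max_r ?oppr_le0// subr0.
have le1 x : `|Pp x| <= `|Phi x|.
  by rewrite /Pp; have [h|h] := leP (Phi x) 0; rewrite ?normr0.
have le2 x : `|Pn x| <= `|Phi x|.
  by rewrite /Pn; have [h|h] := leP (- Phi x) 0; rewrite ?normr0// normrN.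
have msel io (Q : paths I0 -> R) : measurable_fun setT Q -> measurable_fun setT (fun w => Q (@sel I0 io w) : R).
  by move=> mQ; apply: measurableT_comp => //; exact: meas_sel.
have main (Q : paths I0 -> R) : measurable_fun setT Q -> (forall x, 0 <= Q x) -> (forall x, `|Q x| <= `|Phi x|) ->
    Ex P (fun w => \1_A w * Q (sel iota w)) = Ex P \1_A * Ex P (fun w => Q (sel iota' w)).
  move=> mQ Q0 QPhi.
  have iQ : intg P (fun w => Q (sel iota' w)).
    by apply: (intg_le _ iPhi) => //; exact: msel.
  rewrite /Ex /Rintegral -[RHS]fineM; last 2 first.
  - rewrite integral_indic// setIT; exact: fin_num_measure.
  - exact: (integrable_fin_num measurableT iQ).
  congr fine.
  rewrite [in RHS]integral_indic// setIT -(ge0_law_integral inj inj' av mB mQ Q0).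
  rewrite [RHS]integral_mkcond; apply: eq_integral => w _.
  by rewrite patchE indicE; case: ifP => wA; rewrite ?mul1r ?mul0r.
have iP io : intg P (fun w => Phi (sel io w)) -> intg P (fun w => Pp (sel io w)) /\ intg P (fun w => Pn (sel io w)).
  move=> h; split; apply: (intg_le _ h) => //; exact: msel.
have [i1 i2] := iP _ iPhi; have [i3 i4] := iP _ iPhi1.
have iA Q : intg P Q -> intg P (fun w => \1_A w * Q w).
  move=> iQ; apply: (intg_le _ iQ) => [|w].
    by apply: measurable_funM; [exact: measurable_indic|exact: intg_meas iQ].
  rewrite normrM -[leRHS]mul1r ler_wpM2r// indicE; case: (_ \in _); by rewrite ?normr1 ?normr0.
transitivity (Ex P (fun w => \1_A w * Pp (sel iota w) - \1_A w * Pn (sel iota w))).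
  by congr Ex; apply/funext => w; rewrite Pe mulrBr.
rewrite ExB ?main//; [|exact: iA|exact: iA].
rewrite -mulrBr -ExB//; congr (_ * Ex _ _); apply/funext => w.
by rewrite Pe.
Qed.

Lemma law_Ex (I0 : eqType) (iota iota' : I0 -> I) (Phi : paths I0 -> R) :
  injective iota -> injective iota' -> measurable_fun setT Phi ->
  intg P (fun w => Phi (sel iota' w)) ->
  Ex P (fun w => Phi (sel iota w)) = Ex P (fun w => Phi (sel iota' w)).
Proof.
move=> inj inj' mPhi iPhi.
have := @law_Ex_rect I0 iota iota' [::] (fun=> setT) Phi inj inj' _ _ mPhi iPhi.
rewrite (_ : [set w | _] = setT); last by apply/seteqP; split.
move=> /(_ (fun=> isT) (fun=> measurableT)) /=.
rewrite indicT Ex_cst mul1r => <-.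
by congr Ex; apply/funext => w; rewrite mul1r.
Qed.

End Law.

(** * Covariance of a past variable and a coupled functional *)

Section DCT.
Context {R : realType} {d0 : measure_display} {Omega : measurableType d0}.
Variable P : probability Omega R.

Lemma N2_dct (Yn : nat -> Omega -> R) (Y : Omega -> R) :
  (forall n, measurable_fun setT (Yn n)) -> L2 P Y ->
  (forall n w, `|Yn n w| <= `|Y w|) -> (forall w, Yn n w @[n --> \oo] --> 0) ->
  forall e : R, 0 < e -> exists n, N2 P (Yn n) <= e.
Proof.
move=> mYn LY YnY Yn0 e e0.
have cv : (\int[P]_w (Yn n w ^+ 2)%:E)%E @[n --> \oo] --> (\int[P]_w (cst 0 w))%E.
  apply: (@dominated_cvg _ _ _ P setT measurableT _ _ (fun w => (Y w ^+ 2)%:E)) => //.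
  - by move=> n; apply/measurable_EFinP; exact: measX.
  - move=> w _; apply: cvg_EFin; first by near=> n.
    rewrite /comp /=; have := cvgM (Yn0 w) (Yn0 w); rewrite mulr0.
    exact.
  - exact: LY.2.
  - move=> n w _; rewrite lee_fin ger0_norm ?sqr_ge0//.
    by rewrite -[leLHS]real_normK ?num_real// -[leRHS]real_normK ?num_real// lerXn2r ?nnegrE.
rewrite integral0 in cv.
have e20 : 0 < e ^+ 2 by rewrite exprn_gt0.
have /fine_cvgP[_ /cvgrPdist_le /(_ _ e20)] := cv.
move=> [n _ /(_ n (leqnn n))] /=; rewrite sub0r normrN => h.
exists n; rewrite -ler_sqr ?nnegrE ?N2_ge0 ?(ltW e0)// N2_sqr.
exact: le_trans (ler_norm _) h.
Unshelve. all: by end_near. Qed.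

Lemma L2_indic (D : set Omega) : measurable D -> L2 P \1_D.
Proof.
move=> mD; have mi : measurable_fun setT (\1_D : Omega -> R) by exact: measurable_indic.
split => //.
apply: (intg_le _ (intg_cst P 1)); first exact: measX.
by move=> w; rewrite indicE; case: (_ \in _); rewrite ?expr1n ?expr0n ?normr1 ?normr0.
Qed.

End DCT.

(** * Exact decorrelation from the past by resampling a window *)

Section Covariance.
Context {R : realType} {d0 : measure_display} {Omega : measurableType d0}.
Variable P : probability Omega R.
Variables eps epss : int -> Omega -> R.
Let xi := fun ib : bool * int => if ib.1 then epss ib.2 else eps ib.2.
Hypothesis meps : forall i, measurable_fun setT (eps i).
Hypothesis mepss : forall i, measurable_fun setT (epss i).
Hypothesis indep : mutual_indep P xi.
Hypothesis ident : ident_distr P xi.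

Lemma mxi i : measurable_fun setT (xi i).
Proof. by case: i => -[] i; [exact: mepss|exact: meps]. Qed.

Definition x0 (w : Omega) : paths int := fun i => eps i w.
(** The N + 1 innovations of times s - N to s come from the copy. Older ones are kept, so that the
    distance to the original path is a finite sum of single replacements. *)
Definition xs (s : int) (N : nat) (w : Omega) : paths int :=
  fun i => if (s - N%:Z <= i) && (i <= s) then epss i w else eps i w.

Let io0 (i : int) : bool * int := (false, i).
(** Keeping the time as second component makes the reindexing injective, hence the resampled path
    has the law of the original one. *)
Let ios (s : int) (N : nat) (i : int) : bool * int := ((s - N%:Z <= i) && (i <= s), i).

Let io0_inj : injective io0. Proof. by move=> i j []. Qed.
Let ios_inj s N : injective (ios s N). Proof. by move=> i j []. Qed.

Let xsE s N w : xs s N w = sel xi (ios s N) w.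
Proof. by apply/funext => i; rewrite /xs /sel /xi /ios /=; case: ifP. Qed.

Lemma meas_x0 : measurable_fun setT x0.
Proof. exact: (meas_sel mxi io0). Qed.

Lemma meas_xs s N : measurable_fun setT (xs s N).
Proof.
have := meas_sel mxi (ios s N); congr measurable_fun.
by apply/funext => w; rewrite xsE.
Qed.

Lemma Ex_xs s N (Phi : paths int -> R) : measurable_fun setT Phi ->
  intg P (fun w => Phi (x0 w)) ->
  intg P (fun w => Phi (xs s N w)) /\ Ex P (fun w => Phi (xs s N w)) = Ex P (fun w => Phi (x0 w)).
Proof.
move=> mPhi iPhi; have -> : (fun w => Phi (xs s N w)) = (fun w => Phi (sel xi (ios s N) w)).
  by apply/funext => w; rewrite xsE.
split; first exact: (law_intg mxi indep ident (ios_inj (N := N)) io0_inj mPhi iPhi).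
exact: (law_Ex mxi indep ident (ios_inj (N := N)) io0_inj mPhi iPhi).
Qed.

Lemma L2_xs s N (Phi : paths int -> R) : measurable_fun setT Phi ->
  L2 P (fun w => Phi (x0 w)) ->
  L2 P (fun w => Phi (xs s N w)) /\ N2 P (fun w => Phi (xs s N w)) = N2 P (fun w => Phi (x0 w)).
Proof.
move=> mPhi LPhi.
have mPhi2 : measurable_fun setT (fun x => Phi x ^+ 2) by exact: measurable_funX.
have [h1 h2] := Ex_xs s N mPhi2 LPhi.2.
split; last by rewrite /N2 h2.
by split => //; apply: measurableT_comp => //; exact: meas_xs.
Qed.

Lemma L4_xs s N (Phi : paths int -> R) : measurable_fun setT Phi ->
  L4 P (fun w => Phi (x0 w)) ->
  L4 P (fun w => Phi (xs s N w)) /\ N4 P (fun w => Phi (xs s N w)) = N4 P (fun w => Phi (x0 w)).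
Proof.
move=> mPhi LPhi.
have mPhi2 : measurable_fun setT (fun x => Phi x ^+ 2) by exact: measurable_funX.
have [h1 h2] := L2_xs s N mPhi2 (L4_sqr LPhi).
split; last by rewrite /N4 h2.
by apply: L4_sqrE => //; apply: measurableT_comp => //; exact: meas_xs.
Qed.

(** Variables that decorrelate exactly from every functional of the path resampled over a long
    enough window. Asking this for all N' beyond N makes the class stable under sums. *)
Definition Vdec (s : int) (a : Omega -> R) : Prop :=
  L2 P a /\ exists N, forall N', (N <= N')%N -> forall Phi : paths int -> R,
    measurable_fun setT Phi -> L2 P (fun w => Phi (x0 w)) ->
    Ex P (fun w => a w * Phi (xs s N' w)) = Ex P a * Ex P (fun w => Phi (x0 w)).

Lemma VdecZ s c a : Vdec s a -> Vdec s (fun w => c * a w).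
Proof.
move=> [La [N h]]; split; first exact: L2Z.
exists N => N' NN' Phi mPhi LPhi.
rewrite (ExZ c (L2_intg La)) -mulrA -(h N')// -ExZ; last first.
  exact: L2_intgM La (L2_xs s N' mPhi LPhi).1.
by congr Ex; apply/funext => w; rewrite mulrA.
Qed.

Lemma VdecD s a1 a2 : Vdec s a1 -> Vdec s a2 -> Vdec s (fun w => a1 w + a2 w).
Proof.
move=> [La1 [N1 h1]] [La2 [N2' h2]]; split; first exact: L2D.
exists (maxn N1 N2') => N'; rewrite geq_max => /andP[n1 n2] Phi mPhi LPhi.
rewrite (ExD (L2_intg La1) (L2_intg La2)) mulrDl -(h1 N')// -(h2 N')// -ExD.
- by congr Ex; apply/funext => w; rewrite mulrDl.
- exact: L2_intgM La1 (L2_xs s N' mPhi LPhi).1.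
- exact: L2_intgM La2 (L2_xs s N' mPhi LPhi).1.
Qed.

Lemma Vdec_rect (s : int) (J : seq int) (B : int -> set R) : (forall i, i \in J -> i <= s) ->
  (forall i, measurable (B i)) -> Vdec s \1_[set w | forall i, i \in J -> B i (eps i w)].
Proof.
move=> Js mB; set A := [set w | _].
pose J' := map io0 J; pose B' (ib : bool * int) := B ib.2.
have AE : A = [set w | forall i, i \in J' -> B' i (xi i w)].
  apply/seteqP; split => w h i.
    by move=> /mapP[j jJ ->]; exact: h.
  by move=> iJ; have := h (io0 i); apply; exact: map_f.
have mB' i : measurable (B' i) by exact: mB.
split; first by apply: L2_indic; rewrite AE; exact: (rect_event_meas mxi).
(* A window of this length reaches from s back to every time of J, so the resampled path shares no
   innovation with the event. *)
exists (\sum_(i <- J) absz (s - i))%N => N' NN' Phi mPhi LPhi.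
have av i : ios s N' i \notin J'.
  apply/mapP => -[j jJ [/negbT + ij]]; rewrite ij (Js _ jJ) andbT => /negP; apply.
  rewrite lerBlDr -lerBlDl; apply: le_trans (ler_norm _) _; rewrite -abszE lez_nat.
  by rewrite (leq_trans _ NN')// (big_rem j)//= leq_addr.
have := @law_Ex_rect _ _ _ P _ xi mxi indep ident _ (ios s N') io0 J' B' Phi
   (ios_inj (N := N')) io0_inj av mB' mPhi (L2_intg LPhi).
rewrite -AE => <-.
by congr Ex; apply/funext => w; rewrite xsE.
Qed.

(** The L2 closure of [Vdec s]. The window lengths may grow without bound along an approximation, so
    exact decorrelation is kept at the level of [Vdec]. *)
Definition Vbar (s : int) (Y : Omega -> R) : Prop :=
  L2 P Y /\ forall e : R, 0 < e -> exists2 a, Vdec s a & N2 P (fun w => Y w - a w) <= e.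

Lemma Vbar_Vdec s a : Vdec s a -> Vbar s a.
Proof.
move=> Va; split; first exact: Va.1.
move=> e e0; exists a => //; rewrite (_ : (fun w => _) = fun=> 0); last by apply/funext => w; rewrite subrr.
by rewrite N2_cst normr0 ltW.
Qed.

Lemma VbarZ s c Y : Vbar s Y -> Vbar s (fun w => c * Y w).
Proof.
move=> [LY h]; split; first exact: L2Z.
move=> e e0; have c0 : 0 < `|c| + 1 by rewrite ltr_wpDl.
have [a Va ha] := h (e / (`|c| + 1)) (divr_gt0 e0 c0).
exists (fun w => c * a w); first exact: VdecZ.
rewrite (_ : (fun w => _) = (fun w => c * (Y w - a w))); last by apply/funext => w; rewrite mulrBr.
rewrite N2Z; last exact: L2B LY Va.1.
rewrite (le_trans (ler_wpM2l _ ha))// mulrCA ger_pMr// ler_pdivrMr// mul1r.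
by rewrite lerDl.
Qed.

Lemma VbarD s Y1 Y2 : Vbar s Y1 -> Vbar s Y2 -> Vbar s (fun w => Y1 w + Y2 w).
Proof.
move=> [L1 h1] [L2' h2]; split; first exact: L2D.
move=> e e0; have e2 : 0 < e / 2 by rewrite divr_gt0.
have [a1 V1 H1] := h1 _ e2; have [a2 V2 H2] := h2 _ e2.
exists (fun w => a1 w + a2 w); first exact: VdecD.
rewrite (_ : (fun w => _) = (fun w => (Y1 w - a1 w) + (Y2 w - a2 w))); last by apply/funext => w; ring.
apply: (le_trans (N2D (L2B L1 V1.1) (L2B L2' V2.1))).
by rewrite [leRHS]splitr lerD.
Qed.

Lemma VbarB s Y1 Y2 : Vbar s Y1 -> Vbar s Y2 -> Vbar s (fun w => Y1 w - Y2 w).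
Proof.
move=> V1 V2; have := VbarD V1 (VbarZ (-1) V2); congr Vbar.
by apply/funext => w; ring.
Qed.

Lemma Vbar_sum s (I : Type) (r : seq I) (F : I -> Omega -> R) :
  (forall i, Vbar s (F i)) -> Vbar s (fun w => \sum_(i <- r) F i w).
Proof.
move=> iF; elim: r => [|i r IH].
  rewrite (_ : (fun _ => _) = fun w => 0 * \1_[set w | forall i : int, i \in [::] -> setT (eps i w)] w).
    by apply: VbarZ; apply: Vbar_Vdec; exact: (Vdec_rect (B := fun=> setT)).
  by apply/funext => w; rewrite big_nil mul0r.
rewrite (_ : (fun _ => _) = fun w => F i w + \sum_(i <- r) F i w).
  exact: VbarD.
by apply/funext => w; rewrite big_cons.
Qed.

Lemma Vbar_lim s Y : L2 P Y ->
  (forall e : R, 0 < e -> exists2 Y', Vbar s Y' & N2 P (fun w => Y w - Y' w) <= e) -> Vbar s Y.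
Proof.
move=> LY h; split => // e e0; have e2 : 0 < e / 2 by rewrite divr_gt0.
have [Y' [L' V'] H'] := h _ e2; have [a Va Ha] := V' _ e2.
exists a => //.
rewrite (_ : (fun w => _) = (fun w => (Y w - Y' w) + (Y' w - a w))); last by apply/funext => w; ring.
apply: (le_trans (N2D (L2B LY L') (L2B L' Va.1))).
by rewrite [leRHS]splitr lerD.
Qed.

Lemma past_meas s D : past_sigma eps s D -> measurable D.
Proof.
apply: smallest_sub; first exact: sigma_algebra_measurable.
move=> _ [i [B [_ [mB ->]]]]; rewrite -[X in measurable X]setTI; exact: meps.
Qed.

(** Monotone class argument from the rectangles in innovations up to s: proper differences by
    linearity, increasing unions by dominated convergence in L2. *)
Lemma Vbar_indic s D : past_sigma eps s D -> Vbar s \1_D.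
Proof.
pose G := [set A | exists (J : seq int) (B : int -> set R), (forall i, i \in J -> i <= s) /\
  (forall i, measurable (B i)) /\ A = [set w | forall i, i \in J -> B i (eps i w)]].
have GI : setI_closed G.
  move=> _ _ [J1 [B1 [l1 [mB1 ->]]]] [J2 [B2 [l2 [mB2 ->]]]].
  exists (J1 ++ J2), (fun i => (if i \in J1 then B1 i else setT) `&`
                               (if i \in J2 then B2 i else setT)); split.
    by move=> i; rewrite mem_cat => /orP[]; [exact: l1|exact: l2].
  split; first by move=> i; apply: measurableI; case: ifP.
  apply/seteqP; split => [w [h1 h2] i|w h].
    by rewrite mem_cat => iJ; split; case: ifP => // ?; [exact: h1|exact: h2].
  split => i iJ; have := h i; rewrite mem_cat iJ ?orbT => /(_ isT) [].
    by [].
  by move=> _.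
have mG : G `<=` measurable.
  move=> _ [J [B [_ [mB ->]]]].
  have := meas_x0 measurableT (rect_meas J mB); by rewrite setTI.
pose H := [set D | measurable D /\ Vbar s \1_D].
suff : past_sigma eps s `<=` H by move=> h /h [].
rewrite /past_sigma; apply: (@subset_trans _ <<s G >>).
  apply: smallest_sub; first exact: smallest_sigma_algebra.
  move=> _ [i [B [is_ [mB ->]]]]; apply: sub_sigma_algebra; exists [:: i], (fun=> B).
  split; first by move=> j; rewrite inE => /eqP->.
  split => //; apply/seteqP; split => w; first by move=> h j; rewrite inE => /eqP->.
  by move/(_ i (mem_head _ _)).
apply: (lambda_system_subset GI) => //; last first.
  move=> A GA; split; first exact: mG.
  by move: GA => [J [B [l [mB ->]]]]; apply: Vbar_Vdec; exact: Vdec_rect.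
split => //.
- split => //; have := @Vdec_rect s [::] (fun=> setT) (fun _ => ltac:(by [])) (fun=> measurableT).
  by rewrite (_ : [set w | _] = setT); [exact: Vbar_Vdec|apply/seteqP; split].
- move=> A B BA [mA VA] [mB VB]; split; first exact: measurableD.
  have := VbarB VA VB; congr Vbar; apply/funext => w.
  rewrite !indicE; rewrite in_setD; have : w \in B -> w \in A by rewrite !inE; exact: BA.
  by case: (w \in B); case: (w \in A) => // h; rewrite ?subrr ?subr0//; have := h isT.
- move=> F ndF HF; have mF n : measurable (F n) by have [] := HF n.
  have mU : measurable (\bigcup_n F n) by exact: bigcupT_measurable.
  split => //; apply: Vbar_lim; first exact: L2_indic.
  move=> e e0; have [||||n hn] := @N2_dct _ _ _ P (fun n w => \1_(\bigcup_n F n) w - \1_(F n) w) (fun=> 1) _ _ _ _ e e0.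
  + by move=> n; apply: measurable_funB; exact: measurable_indic.
  + exact: L2_cst.
  + move=> n w; rewrite !indicE normr1.
    by case: (_ \in _); case: (_ \in _); rewrite ?subrr ?subr0 ?sub0r ?normrN ?normr1 ?normr0.
  + move=> w; have [[k _ Fkw]|Fw] := pselect ((\bigcup_n F n) w); last first.
      apply: cvg_near_cst; apply: nearW => n; rewrite !indicE !memNset ?subrr//.
      by move=> ?; apply: Fw; exists n.
    apply: cvg_near_cst; exists k => // n /= kn; rewrite !indicE !mem_set ?subrr//.
      by have /subsetPset := ndF _ _ kn; exact.
    by exists k.
  by exists \1_(F n) => //; exact: (HF n).2.
Qed.

Lemma sum_ltn_minn (n t : nat) : (\sum_(i < n) (i < t)%N)%N = minn n t.
Proof.
elim: n => [|n IH]; first by rewrite big_ord0 min0n.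
by rewrite big_ord_recr /= IH; lia.
Qed.

Definition past_fun (s : int) (Y : Omega -> R) : Prop :=
  forall B : set R, measurable B -> past_sigma eps s (Y @^-1` B).

Lemma past_fun_meas s Y : past_fun s Y -> measurable_fun setT Y.
Proof. by move=> pY _ B mB; rewrite setTI; apply: (@past_meas s); exact: pY. Qed.

(** Y is approximated from below by its level on the grid of mesh 1/(k+1), capped at k+1. This is a
    layer-cake sum of indicators of the events Y >= (i+1)/(k+1), all of them in the past, and
    dominated convergence applies. *)
Lemma Vbar_ge0 s Y : past_fun s Y -> (forall w, 0 <= Y w) -> L2 P Y -> Vbar s Y.
Proof.
move=> pY Y0 LY; apply: Vbar_lim => // e e0.
pose D (k i : nat) := Y @^-1` [set x | i.+1%:R / k.+1%:R <= x].
pose A (k : nat) w : R := \sum_(i <- iota 0 (k.+1 ^ 2)) k.+1%:R^-1 * \1_(D k i) w.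
have pD k i : past_sigma eps s (D k i).
  by apply: pY; rewrite -set_itvcy; exact: measurable_itv.
have VA k : Vbar s (A k).
  by apply: Vbar_sum => i; apply: VbarZ; exact: Vbar_indic.
have AE k w : A k w = (minn (k.+1 ^ 2) (Num.truncn (k.+1%:R * Y w)))%:R / k.+1%:R.
  rewrite /A -mulr_sumr mulrC; congr (_ / _).
  rewrite -sum_ltn_minn natr_sum -{1}[(k.+1 ^ 2)%N]subn0 -/(index_iota _ _) big_mkord.
  apply: eq_bigr => i _; rewrite truncn_gt_nat indicE.
  have -> : (w \in D k i) = (i.+1%:R / k.+1%:R <= Y w) by apply/idP/idP; rewrite inE.
  by rewrite ler_pdivrMr ?ltr0n// [Y w * _]mulrC.
have k0 k : 0 < k.+1%:R :> R by rewrite ltr0n.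
have kY k w : 0 <= k.+1%:R * Y w by rewrite mulr_ge0.
have Ale k w : A k w <= Y w.
  rewrite AE ler_pdivrMr// [leRHS]mulrC.
  apply: (@le_trans _ _ (Num.truncn (k.+1%:R * Y w))%:R); first by rewrite ler_nat geq_minr.
  by rewrite truncn_le.
have A0 k w : 0 <= A k w by rewrite AE divr_ge0.
have Acl k w : Y w <= k.+1%:R -> `|Y w - A k w| <= k.+1%:R^-1.
  move=> Yk; rewrite ger0_norm ?subr_ge0// lerBlDl AE.
  have /minn_idPr -> : (Num.truncn (k.+1%:R * Y w) <= k.+1 ^ 2)%N.
    rewrite truncn_le_nat (@le_lt_trans _ _ (k.+1 ^ 2)%:R)//; last by rewrite ltr_nat.
    by rewrite natrX expr2 ler_pM2l.
  rewrite -[X in _ + X]mul1r -mulrDl ler_pdivlMr// mulrC natr1.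
  exact/ltW/truncnS_gt.
have [||||n hn] := @N2_dct _ _ _ P (fun k w => Y w - A k w) Y _ _ _ _ e e0.
- move=> k; apply: measurable_funB; first exact: LY.1.
  exact: (VA k).1.1.
- exact: LY.
- by move=> k w; rewrite !ger0_norm ?subr_ge0// lerBlDr lerDl.
- move=> w; apply/cvgrPdist_le => r r0; near=> k.
  rewrite sub0r normrN (le_trans (Acl _ _ _))//.
    near: k; exists (Num.truncn (Y w)) => // k /= kt.
    apply: (le_trans (ltW (truncnS_gt _))); by rewrite ler_nat.
  near: k; exists (Num.truncn r^-1) => // k /= kt.
  rewrite -[r]invrK lef_pV2 ?posrE ?invr_gt0//.
  apply: (le_trans (ltW (truncnS_gt _))); by rewrite ler_nat.
by exists (A n).
Unshelve. all: by end_near. Qed.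

Lemma Vbar_past s Y : past_fun s Y -> L2 P Y -> Vbar s Y.
Proof.
move=> pY LY.
pose Yp w := Num.max (Y w) 0; pose Yn w : R := Num.max (- Y w) 0.
have pp (g : R -> R) : measurable_fun setT g -> past_fun s (fun w => g (Y w)).
  by move=> mg B mB; apply: (pY (g @^-1` B)); rewrite -[X in measurable X]setTI; exact: mg.
have le1 w : `|Yp w| <= `|Y w|.
  by rewrite /Yp; have [h|h] := leP (Y w) 0; rewrite ?normr0.
have le2 w : `|Yn w| <= `|Y w|.
  by rewrite /Yn; have [h|h] := leP (- Y w) 0; rewrite ?normr0// normrN.
have LL (Z : Omega -> R) : measurable_fun setT Z -> (forall w, `|Z w| <= `|Y w|) -> L2 P Z.
  move=> mZ ZY; split => //; apply: (intg_le _ LY.2); first exact: measX.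
  by move=> w; rewrite !normrX lerXn2r ?nnegrE.
have p1 : past_fun s Yp by apply: (pp (fun x => Num.max x 0)); exact: measurable_funrpos.
have p2 : past_fun s Yn by apply: (pp (fun x => Num.max (- x) 0)); exact: measurable_funrneg.
have V1 : Vbar s Yp.
  apply: Vbar_ge0 => //; first by move=> w; rewrite le_max lexx orbT.
  by apply: LL => //; exact: past_fun_meas p1.
have V2 : Vbar s Yn.
  apply: Vbar_ge0 => //; first by move=> w; rewrite le_max lexx orbT.
  by apply: LL => //; exact: past_fun_meas p2.
have := VbarB V1 V2; congr Vbar; apply/funext => w.
rewrite /Yp /Yn; have [h|/ltW h] := leP (Y w) 0.
  by rewrite max_l ?oppr_ge0// sub0r opprK.
by rewrite max_r ?oppr_le0// subr0.
Qed.

(* Phi at [xs s N] no longer involves eps_{s-N}, ..., eps_s, so it decorrelates exactly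
   from the elements of [Vdec s]; the price is the L2 distance c. *)
Lemma cov_bound s A (Phi : paths int -> R) c : past_fun s A -> L2 P A ->
  measurable_fun setT Phi -> L2 P (fun w => Phi (x0 w)) ->
  (forall N, N2 P (fun w => Phi (x0 w) - Phi (xs s N w)) <= c) ->
  `|Ex P (fun w => A w * Phi (x0 w)) - Ex P A * Ex P (fun w => Phi (x0 w))| <= N2 P A * c.
Proof.
move=> pA LA mPhi LPhi hc.
have c0 : 0 <= c by exact: le_trans (N2_ge0 _ _) (hc 0%N).
set B := fun w => Phi (x0 w).
have main e : 0 < e -> `|Ex P (fun w => A w * B w) - Ex P A * Ex P B| <= N2 P A * c + e * (2 * N2 P B + c).
  move=> e0; have [_ /(_ e e0) [a Va ha]] := Vbar_past pA LA.
  have [La [N /(_ N (leqnn N) Phi mPhi LPhi) hN]] := Va.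
  have [LN _] := L2_xs s N mPhi LPhi.
  pose BN w := Phi (xs s N w).
  have LAa := L2B LA La.
  have -> : Ex P (fun w => A w * B w) - Ex P A * Ex P B =
     Ex P (fun w => (A w - a w) * B w) - Ex P (fun w => A w - a w) * Ex P B + Ex P (fun w => a w * (B w - BN w)).
    have -> : Ex P (fun w => (A w - a w) * B w) = Ex P (fun w => A w * B w) - Ex P (fun w => a w * B w).
      rewrite -ExB ?(L2_intgM LA LPhi) ?(L2_intgM La LPhi)//; last exact: L2_intgM La LPhi.
        by congr Ex; apply/funext => w; rewrite mulrBl.
      exact: L2_intgM LA LPhi.
    have -> : Ex P (fun w => a w * (B w - BN w)) = Ex P (fun w => a w * B w) - Ex P a * Ex P B.
      rewrite -hN -ExB; [|exact: L2_intgM La LPhi|exact: L2_intgM La LN].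
      by congr Ex; apply/funext => w; rewrite mulrBr.
    rewrite (ExB (L2_intg LA) (L2_intg La)); ring.
  have na : N2 P a <= N2 P A + e.
    have := N2B LA LAa; rewrite (_ : (fun w => _) = a); last by apply/funext => w; ring.
    by move=> h; apply: (le_trans h); rewrite lerD2l.
  have h1 := le_trans (CS LAa LPhi) (ler_wpM2r (N2_ge0 P B) ha).
  have h2 : `|Ex P (fun w => A w - a w) * Ex P B| <= e * N2 P B.
    rewrite normrM ler_pM//; [exact: le_trans (Ex_le_N2 LAa) ha|exact: Ex_le_N2].
  have h3 : `|Ex P (fun w => a w * (B w - BN w))| <= (N2 P A + e) * c.
    apply: (le_trans (CS La (L2B LPhi LN))).
    by apply: ler_pM => //; rewrite ?N2_ge0//; exact: hc.
  apply: (le_trans (ler_normD _ _)); apply: (le_trans (lerD (ler_normB _ _) h3)).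
  have := lerD h1 h2; set X := `|_|; set Y := `|_|; rewrite -/B; lra.
apply/ler_addgt0Pr => e e0.
have k0 : 0 < 2 * N2 P B + c + 1 by rewrite ltr_wpDl// addr_ge0// mulr_ge0// N2_ge0.
apply: (le_trans (main (e / (2 * N2 P B + c + 1)) (divr_gt0 e0 k0))).
rewrite lerD2l mulrAC ler_pdivrMr// ler_wpM2l ?ltW//.
by rewrite ltrDl.
Qed.

End Covariance.

(** * Moments and couplings of the kernels *)

Lemma geo_sum_le (R : realType) (rho : R) N : 0 < rho < 1 ->
  \sum_(0 <= i < N) rho ^+ i <= (1 - rho)^-1.
Proof.
move=> /andP[r0 r1]; have d0 : 0 < 1 - rho by rewrite subr_gt0.
rewrite -(ler_pM2l d0) mulfV ?gt_eqF//.
have -> : (1 - rho) * \sum_(0 <= i < N) rho ^+ i = 1 - rho ^+ N.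
  elim: N => [|N IH]; first by rewrite big_geq// mulr0 expr0 subrr.
  by rewrite big_nat_recr//= mulrDr IH exprS; ring.
by rewrite lerBlDr lerDl exprn_ge0// ltW.
Qed.

Section KernelMeasurability.
Context {R : realType} {n : nat}.
Variable K : R -> (nat -> R) -> 'rV[R]_n.
Hypothesis mK : kernel_measurable K.

(** [kernel_measurable] speaks of a generated sigma-algebra on pairs, so preimages are checked on
    its generators and extended by the good sets principle. *)
Lemma kernel_comp d (T : measurableType d) (h1 : T -> R) (h2 : T -> nat -> R) i :
  measurable_fun setT h1 -> (forall k, measurable_fun setT (fun x => h2 x k)) ->
  measurable_fun setT (fun x => K (h1 x) (h2 x) 0 i).
Proof.
move=> m1 m2 _ B mB; rewrite setTI.
pose H := [set A : set (R * (nat -> R)) | measurable [set x | A (h1 x, h2 x)]].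
suff : <<s cyl_sets >> `<=` H by move=> /(_ _ (mK i mB)).
apply: smallest_sub.
  split.
  - by rewrite /H/= (_ : [set x | _] = set0)//; apply/seteqP; split.
  - by move=> A HA; rewrite setTD; exact: measurableC.
  - move=> F HF; rewrite /H/= (_ : [set x | _] = \bigcup_k [set x | F k (h1 x, h2 x)]).
      by apply: bigcupT_measurable => k; exact: HF.
    by apply/seteqP; split => x [k _ h]; exists k.
move=> _ [U [k [V [mU [mV ->]]]]]; rewrite /H/=.
rewrite (_ : [set x | _] = (h1 @^-1` U) `&` ((fun x => h2 x k) @^-1` V)); last by [].
by apply: measurableI; rewrite -[X in measurable X]setTI; [exact: m1|exact: m2].
Qed.

End KernelMeasurability.

(** * From Lq bounds on vectors to fourth moments of coordinates *)

Section LqNorm.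
Context {R : realType} {d0 : measure_display} {Omega : measurableType d0}.
Variable P : probability Omega R.

Lemma enorm_ge0 n (x : 'rV[R]_n) : 0 <= enorm x.
Proof. exact: sqrtr_ge0. Qed.

Lemma coord_le_enorm n (x : 'rV[R]_n) i : `|x 0 i| <= enorm x.
Proof.
rewrite /enorm -sqrtr_sqr ler_sqrt ?sumr_ge0//; last by move=> j _; rewrite sqr_ge0.
by rewrite (bigD1 i)//= lerDl sumr_ge0// => j _; rewrite sqr_ge0.
Qed.

Lemma meas_enorm n (Y : Omega -> 'rV[R]_n) :
  (forall i, measurable_fun setT (fun w => Y w 0 i)) -> measurable_fun setT (fun w => enorm (Y w)).
Proof.
move=> mY; apply: (@measurableT_comp _ _ _ _ _ _ (@Num.sqrt R)).
  by apply: continuous_measurable_fun; exact: sqrt_continuous.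
by apply: measurable_sum => i; exact: measX.
Qed.

Lemma LqN_le_int n (q : R) (Y : Omega -> 'rV[R]_n) (c : R) : 0 < q -> 0 <= c ->
  (LqN P q Y <= c%:E)%E -> (\int[P]_w ((enorm (Y w)) `^ q)%:E <= (c `^ q)%:E)%E.
Proof.
move=> q0 c0 h.
have := powR_Lnorm P (fun w => (enorm (Y w))%:E) (lt0r_neq0 q0).
under eq_integral do rewrite /= ger0_norm ?enorm_ge0//.
move=> <-; rewrite -poweR_EFin; apply: gt0_ler_poweR => //; first exact: ltW.
- by rewrite in_itv/= Lnorm_ge0 leey.
- by rewrite in_itv/= lee_fin c0 leey.
Qed.

(** From |y|^4 <= c^4 (1 + (|y|/c)^q) the fourth moment is at most 2 c^4, and 2 <= 2^4. The crude
    factor 2 avoids comparing Lq norms of different orders. *)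
Lemma LqN_N4 n (q : R) (Y : Omega -> 'rV[R]_n) (c : R) k : 4 < q -> 0 <= c ->
  (forall i, measurable_fun setT (fun w => Y w 0 i)) ->
  (LqN P q Y <= c%:E)%E ->
  L4 P (fun w => Y w 0 k) /\ N4 P (fun w => Y w 0 k) <= 2 * c.
Proof.
move=> q4 c0 mY hY.
have q0 : 0 < q by lra.
(* The bound is proved for every positive c' above c, because c may be 0 and is a divisor; then c'
   tends to c. *)
have main c' : 0 < c' -> c <= c' -> L4 P (fun w => Y w 0 k) /\ N4 P (fun w => Y w 0 k) <= 2 * c'.
  move=> c'0 cc'.
  have hY' : (LqN P q Y <= c'%:E)%E by rewrite (le_trans hY)// lee_fin.
  have hi := LqN_le_int q0 (ltW c'0) hY'.
  have mpow : measurable_fun setT (fun w => enorm (Y w) `^ q).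
    apply: (@measurableT_comp _ _ _ _ _ _ (@powR R ^~ q)) => //.
    exact: meas_enorm.
  have ip : intg P (fun w => enorm (Y w) `^ q).
    apply/integrableP; split; first exact/measurable_EFinP.
    under eq_integral do rewrite /= ger0_norm ?powR_ge0//.
    by rewrite (le_lt_trans hi)// ltry.
  pose g w := c' ^+ 4 * (1 + (c' `^ q)^-1 * enorm (Y w) `^ q).
  have ig : intg P g by apply: intgZ; apply: intgD; [exact: intg_cst|exact: intgZ].
  have yg w : `|Y w 0 k| ^+ 4 <= g w.
    have y0 : 0 <= enorm (Y w) / c' by rewrite divr_ge0 ?enorm_ge0// ltW.
    have /(le_trans _) : (enorm (Y w) / c') ^+ 4 <= 1 + (enorm (Y w) / c') `^ q.
      have [y1|y1] := leP (enorm (Y w) / c') 1.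
        by rewrite (le_trans (exprn_ile1 _ _ _))// lerDl powR_ge0.
      rewrite -[X in X <= _]add0r lerD//.
      by rewrite -powR_mulrn// ler_powR// ltW.
    move=> h; rewrite /g (_ : (c' `^ q)^-1 * _ = (enorm (Y w) / c') `^ q); last first.
      have e : enorm (Y w) `^ q = (enorm (Y w) / c') `^ q * c' `^ q.
        by rewrite -powRM// ?(ltW c'0)// divfK// gt_eqF.
      by rewrite e mulrC mulfK// gt_eqF// powR_gt0.
    rewrite -ler_pdivrMl ?exprn_gt0//; apply: h.
    rewrite -exprVn mulrC -exprMn lerXn2r ?nnegrE ?mulr_ge0 ?enorm_ge0 ?invr_ge0 ?(ltW c'0)//.
    by rewrite ler_wpM2r ?invr_ge0 ?(ltW c'0)// coord_le_enorm.
  have L : L4 P (fun w => Y w 0 k).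
    split => //; apply: (intg_le _ ig); first exact: measX.
    move=> w; rewrite normrX (le_trans (yg w))//; exact: ler_norm.
  split => //.
  have h4 : Ex P (fun w => Y w 0 k ^+ 4) <= 2 * c' ^+ 4.
    apply: (@le_trans _ _ (Ex P g)).
      apply: le_Ex => //; first exact: L.2.
      by move=> w; rewrite (le_trans _ (yg w))// -normrX ler_norm.
    rewrite ExZ; last by apply: intgD; [exact: intg_cst|exact: intgZ].
    rewrite ExD; [|exact: intg_cst|exact: intgZ].
    rewrite Ex_cst ExZ// mulrC ler_wpM2r ?exprn_ge0 ?(ltW c'0)//.
    have : Ex P (fun w => enorm (Y w) `^ q) <= c' `^ q.
      rewrite /Ex /Rintegral -lee_fin fineK//; exact: (integrable_fin_num measurableT ip).
    by rewrite -[leRHS]mulr1 -(ler_pdivrMl _ _ (powR_gt0 _ c'0)); lra.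
  rewrite -ler_sqr ?nnegrE ?N4_ge0 ?mulr_ge0 ?(ltW c'0)// N4_sqr.
  rewrite -ler_sqr ?nnegrE ?N2_ge0 ?exprn_ge0 ?mulr_ge0 ?(ltW c'0)// N2_sqr.
  rewrite (_ : (fun w => _) = (fun w => Y w 0 k ^+ 4)); last by apply/funext => w; rewrite -exprM.
  apply: (le_trans h4); rewrite -exprM exprMn ler_wpM2r ?exprn_ge0 ?(ltW c'0)//.
  by rewrite -natrX ler_nat.
have [L _] := main (c + 1) (ltr_wpDl c0 ltr01) ltac:(by rewrite lerDl).
split => //; apply/ler_addgt0Pr => e e0.
have e2 : 0 < e / 2 by rewrite divr_gt0.
have [_] := main (c + e / 2) (ltr_wpDl c0 e2) ltac:(by rewrite lerDl ltW).
by move=> h; apply: (le_trans h); lra.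
Qed.

End LqNorm.

(** * Coupling error of a kernel when a whole window is resampled *)

Section Coupling.
Context {R : realType} {d0 : measure_display} {Omega : measurableType d0}.
Variable P : probability Omega R.
Variables eps epss : int -> Omega -> R.
Let xi := fun ib : bool * int => if ib.1 then epss ib.2 else eps ib.2.
Hypothesis meps : forall i, measurable_fun setT (eps i).
Hypothesis mepss : forall i, measurable_fun setT (epss i).
Hypothesis indep : mutual_indep P xi.
Hypothesis ident : ident_distr P xi.

Let mx0 : measurable_fun setT (x0 eps) := meas_x0 meps mepss.

Lemma law_L4 (I0 : eqType) (iota iota' : I0 -> bool * int) (Phi : paths I0 -> R) :
  injective iota -> injective iota' -> measurable_fun setT Phi ->
  L4 P (fun w => Phi (sel xi iota' w)) ->
  L4 P (fun w => Phi (sel xi iota w)) /\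
  N4 P (fun w => Phi (sel xi iota w)) = N4 P (fun w => Phi (sel xi iota' w)).
Proof.
move=> inj inj' mPhi [m' i'].
have mxi := mxi meps mepss.
have mPhi4 : measurable_fun setT (fun x => Phi x ^+ 4) by exact: measurable_funX.
split.
  split; first by apply: measurableT_comp => //; exact: meas_sel.
  exact: (law_intg (Phi := fun x => Phi x ^+ 4) mxi indep ident inj inj' mPhi4 i').
have := law_Ex (Phi := fun x => Phi x ^+ 4) mxi indep ident inj inj' mPhi4 i'.
rewrite /N4 /N2.
rewrite (_ : (fun w => (Phi (sel _ iota w) ^+ 2) ^+ 2) = (fun w => Phi (sel xi iota w) ^+ 4)).
  rewrite (_ : (fun w => (Phi (sel _ iota' w) ^+ 2) ^+ 2) = (fun w => Phi (sel xi iota' w) ^+ 4)).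
    by move=> ->.
  by apply/funext => w; rewrite -exprM.
by apply/funext => w; rewrite -exprM.
Qed.

Context {d : nat}.
Variable K : R -> (nat -> R) -> 'rV[R]_d.
Hypothesis mK : kernel_measurable K.
Variable u : R.

(** The kernel as a functional of a two-sided path, to be evaluated at the original, the resampled
    and the shifted path alike. *)
Definition kf (t : int) (k : 'I_d) (x : paths int) : R := K u (fun m => x (t - m%:Z)) 0 k.

Lemma meas_kf t k : measurable_fun setT (kf t k).
Proof.
by apply: kernel_comp => // m; exact: meas_coord.
Qed.

Lemma kf_x0 t k w : kf t k (x0 eps w) = K u (epsseq eps t w) 0 k.
Proof. by []. Qed.

(** Stationarity: a translation of time is an injective reindexing of an i.i.d. family. *)
Lemma shift_Ex (t : int) (Phi : paths int -> R) : measurable_fun setT Phi ->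
  intg P (fun w => Phi (x0 eps w)) ->
  intg P (fun w => Phi (fun i => eps (t + i) w)) /\
  Ex P (fun w => Phi (fun i => eps (t + i) w)) = Ex P (fun w => Phi (x0 eps w)).
Proof.
move=> mF i0.
pose io0 (i : int) := (false, i); pose iot (i : int) := (false, t + i).
have inj0 : injective io0 by move=> i j [].
have injt : injective iot by move=> i j [] /addrI.
have := law_intg (mxi meps mepss) indep ident injt inj0 mF i0.
by have := law_Ex (mxi meps mepss) indep ident injt inj0 mF i0.
Qed.

Lemma kf_shift t k (g : R -> R) : measurable_fun setT g ->
  intg P (fun w => g (kf 0 k (x0 eps w))) ->
  intg P (fun w => g (kf t k (x0 eps w))) /\
  Ex P (fun w => g (kf t k (x0 eps w))) = Ex P (fun w => g (kf 0 k (x0 eps w))).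
Proof.
move=> mg i0.
have mF : measurable_fun setT (fun x => g (kf 0 k x)).
  by apply: measurableT_comp => //; exact: meas_kf.
have := shift_Ex t mF i0.
rewrite (_ : (fun w => g (kf 0 k (fun i => eps (t + i) w))) = (fun w => g (kf t k (x0 eps w))))//.
apply/funext => w; rewrite /kf; congr (g (K u _ 0 k)); apply/funext => m.
by rewrite /x0 sub0r.
Qed.

Variables (q C rho : R).
Hypotheses (q4 : 4 < q) (C0 : 0 <= C) (rho01 : 0 < rho < 1).
Hypothesis A3 : forall (j : nat) (t : int),
  (LqN P q (fun w => (K u (epsseq eps t w) - K u (epstilde eps epss t j w))%R) <= (C * rho ^+ j)%:E)%E.
Hypothesis Kfin : exists M : R, (LqN P q (fun w => K u (epsseq eps 0 w)) <= M%:E)%E.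

Lemma kf_L4 t k : L4 P (fun w => kf t k (x0 eps w)).
Proof.
have [M hM] := Kfin.
have M0 : 0 <= M by rewrite -lee_fin (le_trans _ hM)// Lnorm_ge0.
have [[_ i4] _] := LqN_N4 k q4 M0 (fun i => measurableT_comp (meas_kf 0 i) mx0) hM.
have mX4 : measurable_fun setT (fun y : R => y ^+ 4) by exact: measurable_funX.
have [i4' _] := kf_shift t mX4 i4.
split => //; exact: (measurableT_comp (meas_kf t k) mx0).
Qed.

Let win (s : int) (N : nat) (i : int) := (s - N%:Z < i) && (i <= s).
Let xw (s : int) (N : nat) (w : Omega) : paths int := fun i => if win s N i then epss i w else eps i w.

(** Telescoping over windows that grow by one innovation into the past: the innovation at time s -
    N' is at lag m + N' from the time s + m of the kernel, and the errors sum to a geometric series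
    bounded independently of N. *)
Lemma coupling (s : int) (m N : nat) k :
  L4 P (fun w => kf (s + m%:Z) k (x0 eps w) - kf (s + m%:Z) k (xs eps epss s N w)) /\
  N4 P (fun w => kf (s + m%:Z) k (x0 eps w) - kf (s + m%:Z) k (xs eps epss s N w))
    <= 2 * C / (1 - rho) * rho ^+ m.
Proof.
case/andP: rho01 => rho0 rho1.
set t := s + m%:Z.
have step (N' : nat) :
  L4 P (fun w => kf t k (xw s N' w) - kf t k (xw s N'.+1 w)) /\
  N4 P (fun w => kf t k (xw s N' w) - kf t k (xw s N'.+1 w)) <= 2 * (C * rho ^+ (m + N')).
  pose j := (m + N')%N.
  pose Psi (x : paths (bool * int)%type) : R :=
    K u (fun l => x (false, t - l%:Z)) 0 k -
    K u (fun l => if l == j then x (true, t - j%:Z) else x (false, t - l%:Z)) 0 k.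
  have mPsi : measurable_fun setT Psi.
    apply: measurable_funB; apply: kernel_comp => // l; first exact: meas_coord.
    by case: (l == j); exact: meas_coord.
  (* The coupling assumption replaces one innovation in an otherwise original path. Exchanging the
     two copies inside the window already resampled preserves the joint law and turns that
     difference into the present one. *)
  pose sg (bi : bool * int) := (if win s N' bi.2 then ~~ bi.1 else bi.1, bi.2).
  have sg_inj : injective sg.
    move=> [b1 i1] [b2 i2] []/= + e; rewrite -e; case: ifP => _; last by move=> ->.
    by move=> /negb_inj ->.
  have id_inj : injective (@id (bool * int)%type) by [].
  have h0 : (fun w => Psi (sel xi id w)) =
     (fun w => (K u (epsseq eps t w) - K u (epstilde eps epss t j w)) 0 k).
    by apply/funext => w; rewrite !mxE.
  have cr0 : 0 <= C * rho ^+ j by rewrite mulr_ge0// exprn_ge0// ltW.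
  have [|L0 n0] := LqN_N4 k q4 cr0 _ (A3 j t).
    move=> i; have := measurable_funB (measurableT_comp (meas_kf t i) mx0)
       (kernel_comp mK (h1 := cst u) (h2 := epstilde eps epss t j) i _ _).
    have mtil l : measurable_fun setT (fun w => epstilde eps epss t j w l).
      by rewrite /epstilde; case: (l == j).
    move=> /(_ (measurable_cst _) mtil); congr measurable_fun.
    by apply/funext => w; rewrite !mxE.
  rewrite -h0 in L0 n0.
  have [L1 n1] := law_L4 sg_inj id_inj mPsi L0.
  have -> : (fun w => kf t k (xw s N' w) - kf t k (xw s N'.+1 w)) = (fun w => Psi (sel xi sg w)).
    apply/funext => w; rewrite /Psi /kf; congr (K u _ 0 k - K u _ 0 k).
      by apply/funext => l; rewrite /xw /sel /sg /xi /=; case: ifP.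
    apply/funext => l; rewrite /xw /sel /sg /xi /=.
    case: eqP => [->|lj].
      have -> : win s N'.+1 (t - j%:Z) by rewrite /win /t /j; lia.
      have -> : win s N' (t - j%:Z) = false by rewrite /win /t /j; lia.
      by [].
    have -> : win s N'.+1 (t - l%:Z) = win s N' (t - l%:Z) by move: lj; rewrite /win /t /j; lia.
    by case: ifP.
  by rewrite n1; split.
have xw0 w : xw s 0 w = x0 eps w.
  by apply/funext => i; rewrite /xw /x0 ifF//; rewrite /win; lia.
have xwS N' w : xw s N'.+1 w = xs eps epss s N' w.
  apply/funext => i; rewrite /xw /xs (_ : win _ _ _ = (s - N'%:Z <= i <= s))//.
  by rewrite /win; lia.
have main (N' : nat) : L4 P (fun w => kf t k (x0 eps w) - kf t k (xw s N' w)) /\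
  N4 P (fun w => kf t k (x0 eps w) - kf t k (xw s N' w)) <=
  2 * C * rho ^+ m * \sum_(0 <= i < N') rho ^+ i.
  elim: N' => [|N' [L n4]].
    rewrite (_ : (fun w => _) = fun=> 0); last by apply/funext => w; rewrite xw0 subrr.
    by rewrite N4_cst normr0 big_geq// mulr0; split => //; exact: L4_cst.
  have [L' n'] := step N'.
  rewrite (_ : (fun w => _) = fun w => (kf t k (x0 eps w) - kf t k (xw s N' w)) +
     (kf t k (xw s N' w) - kf t k (xw s N'.+1 w))); last by apply/funext => w; rewrite addrA subrK.
  split; first exact: L4D.
  rewrite (le_trans (N4D L L'))// big_nat_recr//= mulrDr lerD//.
  by rewrite (le_trans n')// exprD !mulrA.
(* [xs s N] resamples a closed window of N + 1 times, whereas [xw s N] resamples N times. *)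
have [L n] := main N.+1.
move: L n; rewrite (_ : (fun w => _) = (fun w => kf t k (x0 eps w) - kf t k (xs eps epss s N w))); last first.
  by apply/funext => w; rewrite xwS.
move=> L n; split => //; rewrite (le_trans n)//.
rewrite [leRHS]mulrAC ler_wpM2l ?mulr_ge0 ?exprn_ge0 ?(ltW rho0)//.
exact: geo_sum_le.
Qed.

End Coupling.

(** * The p-variation as a control *)

Section Control.
Context {R : realType}.
Variables (D : R -> R -> R) (p V : R).
Hypotheses (p1 : 1 <= p) (D0 : forall x y, 0 <= D y x) (Dxx : forall x, D x x = 0).

Fixpoint psum (x : R) (l : seq R) : R :=
  if l is y :: l' then D y x `^ p + psum y l' else 0.

Lemma psum_rcons x l y : psum x (rcons l y) = psum x l + D y (last x l) `^ p.
Proof.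
elim: l x => [|z l IH] x /=; first by rewrite addr0 add0r.
by rewrite IH addrA.
Qed.

Lemma psum_ge0 x l : 0 <= psum x l.
Proof. by elim: l x => [|z l IH] x //=; rewrite addr_ge0 ?powR_ge0. Qed.

Lemma psumE x l : psum x l =
  \sum_(i < size l) D (nth 0 (x :: l) i.+1) (nth 0 (x :: l) i) `^ p.
Proof.
elim: l x => [|z l IH] x /=; first by rewrite big_ord0.
by rewrite big_ord_recl /= IH.
Qed.

Hypothesis HV : forall (m : nat) (s : nat -> R), s 0%N = 0 -> s m = 1 ->
  (forall i, (i < m)%N -> s i < s i.+1) -> \sum_(i < m) D (s i.+1) (s i) `^ p <= V.

Lemma psum1_le l : path <%R 0 l -> last 0 l = 1 -> psum 0 l <= V.
Proof.
move=> pl l1; rewrite psumE.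
apply: (@HV (size l) (fun i => nth 0 (0 :: l) i)) => //.
  by rewrite -l1 (last_nth 0).
by move=> i il; exact: (pathP 0 pl).
Qed.

Lemma psum_le z l : z <= 1 -> path <%R 0 l -> last 0 l = z -> psum 0 l <= V.
Proof.
rewrite le_eqVlt => /orP[/eqP ->|z1] pl lz; first exact: psum1_le.
(* Only partitions that end at 1 have bounded sums by hypothesis, so 1 is appended. *)
have := @psum1_le (rcons l 1); rewrite rcons_path pl lz z1 last_rcons => /(_ isT erefl).
by apply: le_trans; rewrite psum_rcons lerDl powR_ge0.
Qed.

(** The control at z is the supremum of the p-sums over partitions of [0, z]; appending y to a
    partition of [0, x] gives the inequality. Its increments dominate [D y x] to the power p, and
    they telescope. *)
Lemma control : exists om : R -> R,
  (forall x, 0 <= x <= 1 -> 0 <= om x <= V) /\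
  (forall x y, 0 <= x -> x <= y -> y <= 1 -> om x + D y x `^ p <= om y).
Proof.
pose S z := [set r | exists l, [/\ path <%R 0 l, last 0 l = z & r = psum 0 l]].
have Sub z : z <= 1 -> ubound (S z) V.
  by move=> z1 _ [l [pl lz ->]]; exact: (psum_le z1).
have Sne z : 0 <= z -> S z !=set0.
  rewrite le_eqVlt => /orP[/eqP<-|z0]; first by exists (psum 0 [::]), [::].
  by exists (psum 0 [:: z]), [:: z]; split => //=; rewrite z0.
have Shs z : 0 <= z -> z <= 1 -> has_sup (S z).
  by move=> z0 z1; split; [exact: Sne|exists V; exact: Sub].
exists (fun z => sup (S z)); split.
  move=> x /andP[x0 x1]; have [l Sl] := Sne _ x0; apply/andP; split.
    have := sup_upper_bound (Shs _ x0 x1) Sl; apply: le_trans.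
    by case: Sl => l' [_ _ ->]; exact: psum_ge0.
  by apply: sup_le_ub; [exact: Sne|exact: Sub].
move=> x y x0; rewrite le_eqVlt => /orP[/eqP <-|xy] y1.
  by rewrite Dxx powR0 ?addr0// gt_eqF// (lt_le_trans ltr01).
have y0 : 0 <= y by rewrite (le_trans x0)// ltW.
rewrite -lerBrDr; apply: sup_le_ub; first exact: Sne.
move=> _ [l [pl lx ->]]; rewrite lerBrDr.
apply: sup_upper_bound; first exact: Shs.
exists (rcons l y); rewrite psum_rcons rcons_path last_rcons lx pl xy.
by split.
Qed.

End Control.

(** * Squared increments summed over sliding windows *)

Section Window.
Context {R : realType}.

(** A shift by l is l unit steps, and each step, summed over t, telescopes to a difference of two
    values in [0, V]. Overlapping windows thus cost a factor l and not N. *)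
Lemma shift_sum (a : nat -> R) (V : R) (n l N : nat) :
  (forall i, (i <= n)%N -> 0 <= a i <= V) -> (N + l <= n.+1)%N ->
  \sum_(0 <= t < N) (a (t + l)%N - a t) <= l%:R * V.
Proof.
move=> ha; elim: l => [|l IH] h.
  by rewrite mul0r big1// => i _; rewrite addn0 subrr.
rewrite (eq_bigr (fun t => (a (t + l)%N - a t) + (a (t + l).+1 - a (t + l)%N))); last first.
  by move=> i _; rewrite addnS; ring.
rewrite big_split/= -natr1 mulrDl mul1r lerD//; first by apply: IH; lia.
have -> : \sum_(0 <= t < N) (a (t + l).+1 - a (t + l)%N) = a (N + l)%N - a l.
  have := @telescope_sumr _ 0 N (fun t => a (t + l)%N) (leq0n _).
  by rewrite add0n.
have /andP[_ h1] := ha (N + l)%N ltac:(lia).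
have /andP[h2 _] := ha l ltac:(lia).
by rewrite lerBlDr (le_trans h1)// lerDl.
Qed.

(** Above the threshold lam, x^2 is the product of x^(2-p'), x^(p'-p) and x^p; the first exponent is
    nonpositive and the second nonnegative, so these factors are bounded by their values at lam and
    at M. *)
Lemma young_pvar (x M lam p : R) : let p' := Num.max p 2 in 0 <= x -> x <= M -> 1 <= p -> 0 < lam ->
  x ^+ 2 <= lam ^+ 2 + lam `^ (2 - p') * M `^ (p' - p) * x `^ p.
Proof.
move=> p' x0 xM p1 l0.
have [xl|lx] := leP x lam.
  rewrite (le_trans (_ : _ <= lam ^+ 2)) ?lerXn2r ?nnegrE ?(ltW l0)//.
  by rewrite lerDl !mulr_ge0 ?powR_ge0.
have xp : 0 < x by exact: lt_trans lx.
have p2 : 2 <= p' by rewrite /p' le_max lexx orbT.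
have pp : p <= p' by rewrite /p' le_max lexx.
have x20 : 0 <= lam ^+ 2 by rewrite sqr_ge0.
rewrite -[leLHS]add0r lerD// -mulrA.
have -> : x ^+ 2 = x `^ (2 - p') * (x `^ (p' - p) * x `^ p).
  rewrite -[LHS]powR_mulrn// -!powRD; try by rewrite (gt_eqF xp) implybT.
  by congr (_ `^ _); ring.
apply: ler_pM; rewrite ?mulr_ge0 ?powR_ge0//.
  rewrite -[2 - p']opprK opprB !powRN lef_pV2 ?posrE ?powR_gt0//.
  by rewrite ge0_ler_powR ?nnegrE ?subr_ge0 ?(ltW l0)// ltW.
by rewrite ler_wpM2r ?powR_ge0// ge0_ler_powR ?nnegrE ?subr_ge0// (le_trans x0).
Qed.

Variables (D : R -> R -> R) (p V : R) (om : R -> R).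
Hypotheses (p1 : 1 <= p) (D0 : forall x y, 0 <= D y x) (Dxx : forall x, D x x = 0).
Hypothesis om01 : forall x, 0 <= x <= 1 -> 0 <= om x <= V.
Hypothesis omD : forall x y, 0 <= x -> x <= y -> y <= 1 -> om x + D y x `^ p <= om y.
Let p' := Num.max p 2.

Lemma V_ge0 : 0 <= V.
Proof. by have /andP[h1 h2] := @om01 0 ltac:(by rewrite lexx ler01); exact: le_trans h2. Qed.

Lemma D_le x y : 0 <= x -> x <= y -> y <= 1 -> D y x <= V `^ p^-1.
Proof.
move=> x0 xy y1; have pp : 0 < p by rewrite (lt_le_trans ltr01).
have h : D y x `^ p <= V.
  have := omD x0 xy y1; have /andP[+ _] := @om01 x ltac:(by rewrite x0 (le_trans xy)).
  have /andP[_ +] := @om01 y ltac:(by rewrite y1 (le_trans x0)); lra.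
have -> : D y x = (D y x `^ p) `^ p^-1 by rewrite -powRrM divff ?powRr1// gt_eqF.
by rewrite ge0_ler_powR ?nnegrE ?powR_ge0 ?V_ge0// invr_ge0 ltW.
Qed.

(** With lam = (l/n)^(1/p') both terms of [young_pvar], summed over the windows, are multiples of n
    (l/n)^(2/p'); this is the sum of the two factors. *)
Definition wconst : R := 1 + (V `^ p^-1) `^ (p' - p) * V.

Lemma wconst_ge0 : 0 <= wconst.
Proof. by rewrite /wconst addr_ge0// mulr_ge0 ?powR_ge0 ?V_ge0. Qed.

Lemma frac01 (n t : nat) : (t <= n)%N -> 0 <= (t%:R / n%:R : R) <= 1.
Proof.
case: n => [|n] tn; first by move: tn; rewrite leqn0 => /eqP->; rewrite mul0r lexx ler01.
by rewrite divr_ge0//= ler_pdivrMr ?ltr0n// mul1r ler_nat.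
Qed.

Lemma frac_le (n s t : nat) : (s <= t)%N -> s%:R / n%:R <= t%:R / n%:R :> R.
Proof. by move=> st; rewrite ler_wpM2r ?invr_ge0// ler_nat. Qed.

(** The right-hand side depends only on the enclosing interval [a, b], so one number bounds all
    increments inside a window. *)
Lemma D_sq_le n l x y a b : (0 < n)%N -> (0 < l)%N -> 0 <= a -> a <= x -> x <= y -> y <= b -> b <= 1 ->
  D y x ^+ 2 <= ((l%:R / n%:R) `^ (p'^-1)) ^+ 2 +
   ((l%:R / n%:R) `^ (p'^-1)) `^ (2 - p') * (V `^ p^-1) `^ (p' - p) * (om b - om a).
Proof.
move=> n0 l0 a0 ax xy yb b1.
have lam0 : 0 < (l%:R / n%:R) `^ (p'^-1) :> R by rewrite powR_gt0// divr_gt0 ?ltr0n.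
have x0 := le_trans a0 ax; have y1 := le_trans yb b1.
apply: (le_trans (young_pvar (D0 _ _) (D_le x0 xy y1) p1 lam0)).
rewrite lerD2l ler_wpM2l ?mulr_ge0 ?powR_ge0//.
have h1 := omD x0 xy y1.
have h2 := omD a0 ax (le_trans xy y1); have h3 := omD (le_trans x0 xy) yb b1.
have := powR_ge0 (D b y) p; have := powR_ge0 (D x a) p; lra.
Qed.

(* Sum of the bounds of [D_sq_le] over the windows [t/n, (t+l)/n]: the control om telescopes. *)
Lemma window_sum n l N : (0 < n)%N -> (0 < l)%N -> (N + l <= n.+1)%N ->
  \sum_(0 <= t < N) (((l%:R / n%:R) `^ (p'^-1)) ^+ 2 +
   ((l%:R / n%:R) `^ (p'^-1)) `^ (2 - p') * (V `^ p^-1) `^ (p' - p) * (om ((t + l)%:R / n%:R) - om (t%:R / n%:R)))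
  <= n%:R * (wconst * (l%:R / n%:R) `^ (2 / p')).
Proof.
move=> n0 l0 h; set lam := _ `^ _.
have p'0 : 0 < p' by rewrite /p' lt_max ltr0n orbT.
have x0 : 0 < l%:R / n%:R :> R by rewrite divr_gt0 ?ltr0n.
have lam0 : 0 < lam by rewrite powR_gt0.
have lam2 : lam ^+ 2 = (l%:R / n%:R) `^ (2 / p').
  by rewrite [2 / p']mulrC powRrM powR_mulrn// ltW.
have lamp : lam `^ p' = l%:R / n%:R.
  by rewrite -powRrM mulVf ?gt_eqF// powRr1// ltW.
(* As lam^p' = l/n, the factor l V of the telescoped control becomes n lam^2 V, the order of the
   first term. *)
have lam2p : lam `^ (2 - p') = lam ^+ 2 / (l%:R / n%:R).
  rewrite -lamp; apply: (canRL (mulfK _)); first by rewrite gt_eqF// powR_gt0.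
  rewrite -powRD; last by rewrite (gt_eqF lam0) implybT.
  by rewrite -powR_mulrn ?(ltW lam0)//; congr (_ `^ _); ring.
rewrite big_split/= -[X in _ + X]mulr_sumr.
have hs := @shift_sum (fun t => om (t%:R / n%:R)) V n l N (fun i hi => om01 (frac01 hi)) h.
apply: (@le_trans _ _ (n%:R * lam ^+ 2 + lam `^ (2 - p') * (V `^ p^-1) `^ (p' - p) * (l%:R * V))).
  rewrite lerD//; last by rewrite ler_wpM2l ?mulr_ge0 ?powR_ge0.
  rewrite big_const_nat subn0 iter_addr_0 -[leLHS]mulr_natl ler_wpM2r ?sqr_ge0// ler_nat; lia.
rewrite lam2p /wconst -lam2 le_eqVlt; apply/orP; left; apply/eqP; field.
by rewrite !pnatr_eq0 -!lt0n n0 l0.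
Qed.

Lemma window_sq n l N : (0 < n)%N -> (N + l <= n.+1)%N ->
  \sum_(0 <= t < N) D ((t + l)%:R / n%:R) (t%:R / n%:R) ^+ 2
  <= n%:R * (wconst * (l%:R / n%:R) `^ (2 / p')).
Proof.
move=> n0; case: l => [|l] h.
  rewrite big1 ?mulr_ge0 ?wconst_ge0 ?powR_ge0// => t _.
  by rewrite addn0 Dxx expr0n.
apply: le_trans (window_sum n0 (ltn0Sn l) h); rewrite !big_nat; apply: ler_sum => t /andP[_ tN].
have h1 : (t + l.+1 <= n)%N by lia.
have /andP[b0 b1] := frac01 h1; have /andP[a0 a1] := frac01 (leq_trans (leq_addr l.+1 t) h1).
by apply: D_sq_le => //; apply: frac_le; exact: leq_addr.
Qed.

End Window.

(** * Lq increments of a kernel and their control *)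

Section PVariation.
Context {R : realType} {d0 : measure_display} {Omega : measurableType d0}.
Variable P : probability Omega R.
Variables (eps : int -> Omega -> R) (q p C : R).
Context {d : nat}.
Variable K : R -> (nat -> R) -> 'rV[R]_d.
Hypotheses (q0 : 0 < q) (p1 : 1 <= p).
Hypothesis hpv : (pvariation P eps q p K <= C%:E)%E.

(* [fine] sends an infinite norm to 0; [LD_fin] excludes this for 0 <= x <= y <= 1. *)
Definition LD (y x : R) : R := fine (LqN P q (fun w => (K y (epsseq eps 0 w) - K x (epsseq eps 0 w))%R)).

Lemma LD_ge0 y x : 0 <= LD y x.
Proof. by rewrite fine_ge0// Lnorm_ge0. Qed.

Lemma LDxx x : LD x x = 0.
Proof.
rewrite /LD /LqN (_ : (fun w => _) = cst 0%E) ?Lnorm0 ?gt_eqF//.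
apply/funext => w; rewrite subrr /enorm big1 ?sqrtr0// => i _.
by rewrite mxE expr0n.
Qed.

Lemma pvar_sum (m : nat) (s : nat -> R) : s 0%N = 0 -> s m = 1 ->
  (forall i, (i < m)%N -> s i < s i.+1) ->
  \sum_(i < m) LD (s i.+1) (s i) `^ p <= C `^ p /\
  forall i, (i < m)%N -> LqN P q (fun w => (K (s i.+1) (epsseq eps 0 w) - K (s i) (epsseq eps 0 w))%R) = (LD (s i.+1) (s i))%:E.
Proof.
move=> s0 sm si; set N := fun i => LqN P q (fun w => (K (s i.+1) (epsseq eps 0 w) - K (s i) (epsseq eps 0 w))%R).
have pp : 0 < p by rewrite (lt_le_trans ltr01).
have N0 i : (0 <= N i)%E by exact: Lnorm_ge0.
have hsum : ((\sum_(i < m) (N i `^ p)%E)%E `^ p^-1 <= C%:E)%E.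
  apply: le_trans hpv; apply: ereal_sup_ubound; exists m, s; split => //.
have S0 : (0 <= \sum_(i < m) (N i `^ p)%E)%E by apply: sume_ge0 => i _; exact: poweR_ge0.
have C0 : 0 <= C by rewrite -lee_fin (le_trans _ hsum)// poweR_ge0.
have hsum2 : (\sum_(i < m) (N i `^ p)%E <= (C `^ p)%:E)%E.
  have -> : (\sum_(i < m) (N i `^ p)%E = ((\sum_(i < m) (N i `^ p)%E)%E `^ p^-1) `^ p)%E.
    by rewrite -poweRrM mulVf ?gt_eqF// poweRe1.
  rewrite -poweR_EFin; apply: gt0_ler_poweR => //; first exact: ltW.
  - by rewrite in_itv/= poweR_ge0 leey.
  - by rewrite in_itv/= lee_fin C0 leey.
have fin (i : 'I_m) : N i \is a fin_num.
  rewrite ge0_fin_numE// (lty_poweRy (r := p)) ?gt_eqF//.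
  rewrite (@le_lt_trans _ _ (C `^ p)%:E)// ?ltry//; apply: le_trans hsum2.
  rewrite (bigD1 i)//= leeDl//; apply: sume_ge0 => j _; exact: poweR_ge0.
split; last by move=> i im; rewrite /LD -/(N i) fineK//; exact: (fin (Ordinal im)).
rewrite -lee_fin; apply: le_trans hsum2; rewrite -sumEFin le_eqVlt; apply/orP; left; apply/eqP.
by apply: eq_bigr => i _; rewrite -poweR_EFin /LD -/(N i) fineK// fin.
Qed.

(** Two points of [0, 1] belong to a common partition, and a finite p-variation forces every norm
    along it to be finite. *)
Lemma LD_fin x y : 0 <= x -> x <= y -> y <= 1 ->
  LqN P q (fun w => (K y (epsseq eps 0 w) - K x (epsseq eps 0 w))%R) = (LD y x)%:E.
Proof.
move=> x0; rewrite le_eqVlt => /orP[/eqP <- _|xy y1].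
  rewrite LDxx /LqN (_ : (fun w => _) = cst 0%E) ?Lnorm0 ?gt_eqF//.
  apply/funext => w; rewrite subrr /enorm big1 ?sqrtr0// => i _.
  by rewrite mxE expr0n.
(* The partition 0, x, y, 1 without repeated end points, since partitions increase strictly. *)
pose l := (if x == 0 then [::] else [:: x]) ++ y :: (if y == 1 then [::] else [:: 1]).
pose s i := nth 0 (0 :: l) i.
have pl : path <%R 0 l.
  rewrite /l; case: (eqVneq x 0) => [xe|xn]; case: (eqVneq y 1) => [ye|yn] /=.
  - by rewrite -xe xy.
  - by rewrite -xe xy /= lt_neqAle yn y1.
  - by rewrite lt_neqAle eq_sym xn x0 xy.
  - by rewrite lt_neqAle eq_sym xn x0 xy /= lt_neqAle yn y1.
have l1 : last 0 l = 1.
  by rewrite /l last_cat /=; case: (eqVneq y 1).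
have sm : s (size l) = 1 by rewrite /s -l1 (last_nth 0).
have sl i : (i < size l)%N -> s i < s i.+1 by move=> il; exact: (pathP 0 pl).
have [_ /(_ (if x == 0 then 0%N else 1%N))] := pvar_sum (erefl : s 0%N = 0) sm sl.
rewrite /s /l; case: (eqVneq x 0) => [xe|xn] /=.
  by rewrite xe; apply.
by apply; rewrite /=; lia.
Qed.

Lemma LD_control : exists om : R -> R,
  (forall x, 0 <= x <= 1 -> 0 <= om x <= C `^ p) /\
  (forall x y, 0 <= x -> x <= y -> y <= 1 -> om x + LD y x `^ p <= om y).
Proof.
apply: control => //.
- exact: LDxx.
- by move=> m s s0 sm si; have [] := pvar_sum s0 sm si.
Qed.

End PVariation.

(** * Gradients near the curve of means *)

Section MeasurableRow.
Context {R : realType} {dT : measure_display} {T : measurableType dT} {d : nat}.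
Variable Y : T -> 'rV[R]_d.
Hypothesis mY : forall i, measurable_fun setT (fun w => Y w 0 i).

(** An open set is a countable union of the grid boxes of mesh 1/(k+1) contained in it, and a box is
    described by the integer parts of the scaled coordinates, which are measurable. *)
Lemma meas_open_row (U : set 'rV[R]_d) : open U -> measurable (Y @^-1` U).
Proof.
move=> oU.
pose box (kz : nat * 'rV[int]_d) : set T :=
  \bigcap_(i in [set: 'I_d]) [set w | Num.floor (kz.1.+1%:R * Y w 0 i) = kz.2 0 i].
pose good (kz : nat * 'rV[int]_d) : Prop :=
  forall x : 'rV[R]_d, (forall i, Num.floor (kz.1.+1%:R * x 0 i) = kz.2 0 i) -> U x.
have -> : Y @^-1` U = \bigcup_(kz in good) box kz.
  apply/seteqP; split; last by move=> w [kz gk hw]; apply: gk => i; exact: (hw i).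
  move=> w Uw; have /nbhs_ballP[e /= e0 eU] : nbhs (Y w) U by exact: open_nbhs_nbhs.
  pose k := Num.truncn e^-1.
  exists (k, \row_i Num.floor (k.+1%:R * Y w 0 i)); last by move=> i _ /=; rewrite mxE.
  move=> x /= hx; apply: eU; split => // i j; rewrite (ord1 i).
  have kk : 0 < k.+1%:R :> R by rewrite ltr0n.
  have := hx j; rewrite mxE => hj.
  have /andP[a1 a2] := floor_itv (k.+1%:R * x 0 j).
  have /andP[b1 b2] := floor_itv (k.+1%:R * Y w 0 j).
  rewrite hj intrD in a1 a2; rewrite intrD in b2.
  have ek : k.+1%:R^-1 < e by rewrite -[e]invrK ltf_pV2 ?posrE ?invr_gt0//; exact: truncnS_gt.
  rewrite /ball/= (lt_trans _ ek)// -(ltr_pM2l kk) mulfV ?gt_eqF//.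
  rewrite -[X in X * _]gtr0_norm// -normrM ltr_norml mulrBr; apply/andP; split; lra.
rewrite bigcup_mkcond; apply: countable_bigcupT_measurable => // kz.
case: ifP => // _; apply: fin_bigcap_measurable => // i _.
rewrite (_ : [set w | _] = (fun w => kz.1.+1%:R * Y w 0 i) @^-1` `[(kz.2 0 i)%:~R, (kz.2 0 i + 1)%:~R[); last first.
  apply/seteqP; split => w /=; rewrite in_itv/=.
    by move=> <-; exact: floor_itv.
  exact: floor_def.
rewrite -[X in measurable X]setTI; apply: measurable_funM => //; exact: measurable_cst.
Qed.

Lemma meas_comp_continuous (g : 'rV[R]_d -> R) : continuous g ->
  measurable_fun setT (fun w => g (Y w)).
Proof.
move=> /continuousP cg; apply: (measurability _ (RGenOpens.measurableE R)).
move=> _ [_ [x [y ->]] <-]; rewrite setTI (_ : _ @^-1` _ = Y @^-1` (g @^-1` `]x, y[))//.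
by apply: meas_open_row; apply: cg; exact: interval_open.
Qed.

End MeasurableRow.

Lemma cvg_sumr (R : realType) (T : Type) (F : set_system T) {FF : Filter F} (I : Type) (r : seq I)
    (u : I -> T -> R) (l : I -> R) : (forall i, u i x @[x --> F] --> l i) ->
  (\sum_(i <- r) u i x) @[x --> F] --> \sum_(i <- r) l i.
Proof.
move=> h; elim: r => [|i r IH].
  by rewrite big_nil; under eq_fun do rewrite big_nil; exact: cvg_cst.
by rewrite big_cons; under eq_fun do rewrite big_cons; exact: cvgD.
Qed.

(** * Convexity of the neighbourhood and Lipschitz bounds for the gradient *)

Section Neighborhood.
Context {R : realType} {d : nat}.
Implicit Types x y : 'rV[R]_d.

Lemma enormZ (c : R) x : enorm (c *: x) = `|c| * enorm x.
Proof.
rewrite /enorm -sqrtr_sqr -sqrtrM ?sqr_ge0// mulr_sumr; congr Num.sqrt.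
by apply: eq_bigr => i _; rewrite mxE exprMn.
Qed.

Lemma enorm_le_sum x : enorm x <= \sum_i `|x 0 i|.
Proof.
have s0 : 0 <= \sum_i `|x 0 i| by exact: sumr_ge0.
rewrite -ler_sqr ?nnegrE ?enorm_ge0// sqr_sqrtr; last by apply: sumr_ge0 => i _; exact: sqr_ge0.
rewrite expr2 mulr_suml; apply: ler_sum => i _.
rewrite -[x 0 i ^+ 2]real_normK ?num_real// expr2 ler_wpM2l//.
by rewrite (bigD1 i)//= lerDl sumr_ge0.
Qed.

Lemma enorm_coord_le x (c : R) : 0 <= c -> (forall i, `|x 0 i| <= c) -> enorm x <= d%:R * c.
Proof.
move=> c0 h; apply: (le_trans (enorm_le_sum x)).
apply: (@le_trans _ _ (\sum_(i < d) c)); first by apply: ler_sum.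
by rewrite sumr_const card_ord mulr_natl.
Qed.

Lemma continuous_enormB y : continuous (fun x : 'rV[R]_d => enorm (x - y)).
Proof.
move=> x; apply: (@continuous_comp _ _ _ (fun x : 'rV[R]_d => \sum_i (x - y) 0 i ^+ 2) Num.sqrt); last exact: sqrt_continuous.
apply: (@cvg_sumr _ _ (nbhs x)) => i.
rewrite (_ : (fun x => (x - y) 0 i ^+ 2) = (fun x : 'rV[R]_d => (x 0 i - y 0 i) * (x 0 i - y 0 i))); last first.
  by apply/funext => z; rewrite !mxE expr2.
have h : (fun z : 'rV[R]_d => z 0 i - y 0 i) z @[z --> nbhs x] --> x 0 i - y 0 i.
  by apply: cvgB; [exact: coord_continuous|exact: cvg_cst].
by rewrite !mxE expr2; exact: cvgM.
Qed.

Lemma open_nbhd_set (M : set 'rV[R]_d) (delta : \bar R) : open (nbhd_set M delta).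
Proof.
rewrite (_ : nbhd_set M delta = \bigcup_(y in M) [set x | ((enorm (x - y))%:E < delta)%E]); last first.
  by apply/seteqP; split => x [y]; [move=> [My h]; exists y|move=> My h; exists y].
apply: bigcup_open => y My; case: delta => [r| |].
- rewrite (_ : [set x | _] = (fun x => enorm (x - y)) @^-1` `]-oo, r[).
    by apply: open_comp => // x _; exact: continuous_enormB.
  by apply/seteqP; split => x /=; rewrite lte_fin in_itv.
- rewrite (_ : [set x | _] = setT); first exact: openT.
  by apply/seteqP; split => x //= _; exact: ltry.
- rewrite (_ : [set x | _] = set0); first exact: open0.
  by apply/seteqP; split => x.
Qed.

Lemma conv_curve_segment (mu : R -> 'rV[R]_d) x y (s : R) : 0 <= s <= 1 ->
  conv_curve mu x -> conv_curve mu y -> conv_curve mu (s *: x + (1 - s) *: y).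
Proof.
move=> /andP[s0 s1] [m1 [w1 [u1 [w10 [sw1 [u1i ->]]]]]] [m2 [w2 [u2 [w20 [sw2 [u2i ->]]]]]].
have t0 : 0 <= 1 - s by rewrite subr_ge0.
exists (m1 + m2)%N, (fun i => match fintype.split i with inl j => s * w1 j | inr j => (1 - s) * w2 j end),
  (fun i => match fintype.split i with inl j => u1 j | inr j => u2 j end).
have sl (j : 'I_m1) : fintype.split (lshift m2 j) = inl j by exact: (unsplitK (inl j)).
have sr (j : 'I_m2) : fintype.split (rshift m1 j) = inr j by exact: (unsplitK (inr j)).
split; first by move=> i; case: fintype.split => j; rewrite mulr_ge0.
split.
  rewrite big_split_ord/=; under eq_bigr do rewrite sl.
  under [X in _ + X]eq_bigr do rewrite sr.
  by rewrite -!mulr_sumr sw1 sw2; ring.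
split; first by move=> i; case: fintype.split => j.
rewrite big_split_ord/=; under [X in _ = X + _]eq_bigr do rewrite sl.
under [X in _ = _ + X]eq_bigr do rewrite sr.
by rewrite !scaler_sumr; congr (_ + _); apply: eq_bigr => i _; rewrite scalerA.
Qed.

Lemma conv_curve_point (mu : R -> 'rV[R]_d) u : 0 <= u <= 1 -> conv_curve mu (mu u).
Proof.
move=> u01; exists 1%N, (fun=> 1), (fun=> u).
by rewrite !big_ord1 scale1r; do !split.
Qed.

Lemma nbhd_point (mu : R -> 'rV[R]_d) (delta : \bar R) u : (0 < delta)%E -> 0 <= u <= 1 ->
  nbhd_set (conv_curve mu) delta (mu u).
Proof.
move=> d0 u01; exists (mu u); split; first exact: conv_curve_point.
by rewrite subrr /enorm big1 ?sqrtr0// => i _; rewrite mxE expr0n.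
Qed.

(** If m in the hull is close to x, then s m + (1-s) mu(u) is in the hull too, at s times that
    distance from the new point. So the segments of the mean value theorem stay where f is
    controlled. *)
Lemma nbhd_segment (mu : R -> 'rV[R]_d) (delta : \bar R) x u (s : R) : 0 <= s <= 1 -> 0 <= u <= 1 ->
  nbhd_set (conv_curve mu) delta x ->
  nbhd_set (conv_curve mu) delta (mu u + s *: (x - mu u)).
Proof.
move=> s01 u01 [m [cm hm]]; exists (s *: m + (1 - s) *: mu u); split.
  by apply: conv_curve_segment => //; exact: conv_curve_point.
have -> : mu u + s *: (x - mu u) - (s *: m + (1 - s) *: mu u) = s *: (x - m).
  by rewrite !scalerBr scalerBl scale1r; apply/matrixP => i j; rewrite !mxE; ring.
rewrite enormZ; apply: le_lt_trans hm; rewrite lee_fin ler_piMl ?enorm_ge0//.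
by case/andP: s01 => s0 s1; rewrite ger0_norm.
Qed.

Lemma row_sum_delta x : x = \sum_j x 0 j *: delta_mx 0 j.
Proof.
apply/rowP => i; rewrite summxE (bigD1 i)//= !mxE !eqxx mulr1 big1 ?addr0// => j ji.
by rewrite !mxE eq_sym (negPf ji) andbF mulr0.
Qed.

Lemma deriv_along (g : 'rV[R]_d -> R) (y v : 'rV[R]_d) (s : R) : (forall z, differentiable g z) ->
  is_derive s 1 (fun s => g (y + s *: v)) (derive g (y + s *: v) v).
Proof.
move=> dg; set z := y + s *: v.
have E : (fun h : R => h^-1 *: (((fun s => g (y + s *: v)) \o shift s) (h *: 1) - g (y + s *: v)))
   = (fun h => h^-1 *: ((g \o shift z) (h *: v) - g z)).
  apply/funext => h /=; congr (_ *: (g _ - _)).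
  by rewrite /z [h *: 1]mulr1 scalerDl addrCA.
have dv : derivable g z v by exact: diff_derivable.
by apply: DeriveDef; rewrite /derivable /derive E.
Qed.

(** Mean value theorem along the segment from [mu u] to x: the derivative in the direction of x - mu
    u combines d Hessian entries, each at most C, with coefficients at most the norm of the
    direction. *)
Lemma grad_lip (f : 'rV[R]_d -> R) (mu : R -> 'rV[R]_d) (delta : \bar R) (C : R) x u i :
  twice_differentiable f -> 0 <= u <= 1 ->
  (forall x, nbhd_set (conv_curve mu) delta x ->
     `|f x| + enorm (grad f x) + fnorm (hessian f x) <= C) ->
  nbhd_set (conv_curve mu) delta x ->
  `|grad f x 0 i - grad f (mu u) 0 i| <= d%:R * C * enorm (x - mu u).
Proof.
move=> [_ dgf] u01 hC nx.
pose gi := fun y => grad f y 0 i.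
have dgi z : differentiable gi z.
  apply: (@differentiable_comp _ _ _ _ (grad f) (fun y : 'rV[R]_d => y 0 i)); first exact: dgf.
  exact: differentiable_coord.
pose y := mu u; pose v := x - y.
have h1 (c : R) : c \in `]0, 1[ -> is_derive c 1 (fun s => gi (y + s *: v)) (derive gi (y + c *: v) v).
  by move=> _; exact: deriv_along.
have h2 : {within `[0, 1], continuous (fun s : R => gi (y + s *: v))}.
  apply: continuous_subspaceT => s; apply: differentiable_continuous.
  by apply/derivable1_diffP; have [] := deriv_along y v s dgi.
have [c c01 E] := MVT ltr01 h1 h2.
have -> : grad f x 0 i - grad f (mu u) 0 i = derive gi (y + c *: v) v.
  by move: E; rewrite subr0 mulr1 scale1r scale0r addr0 /v subrKC.
have c01' : 0 <= c <= 1 by move: c01; rewrite in_itv/= => /andP[/ltW -> /ltW ->].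
have nz : nbhd_set (conv_curve mu) delta (y + c *: v) by exact: nbhd_segment.
set z := y + c *: v in nz *.
have hz := hC _ nz.
have hh j : `|hessian f z i j| <= C.
  apply: le_trans hz; apply: (@le_trans _ _ (fnorm (hessian f z))).
    rewrite /fnorm -sqrtr_sqr ler_sqrt; last by apply: sumr_ge0 => k _; apply: sumr_ge0 => l _; exact: sqr_ge0.
    rewrite (bigD1 i)//= (bigD1 j)//= -addrA lerDl addr_ge0// ?sumr_ge0// => k _; first exact: sqr_ge0.
    by apply: sumr_ge0 => l _; exact: sqr_ge0.
  by rewrite lerDr addr_ge0// enorm_ge0.
rewrite deriveE// (row_sum_delta v) linear_sum/=.
have C0 : 0 <= C by apply: le_trans hz; rewrite !addr_ge0// ?enorm_ge0// sqrtr_ge0.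
apply: (le_trans (ler_norm_sum _ _ _)).
apply: (@le_trans _ _ (\sum_(j < d) C * enorm v)); last first.
  by rewrite sumr_const card_ord -mulrA -[leLHS]mulr_natl lexx.
apply: ler_sum => j _; rewrite linearZ/= normrM mulrC ler_pM//; last exact: coord_le_enorm.
by have := hh j; rewrite /hessian mxE deriveE.
Qed.

Lemma grad_bound (f : 'rV[R]_d -> R) (mu : R -> 'rV[R]_d) (delta : \bar R) (C : R) x i :
  (forall x, nbhd_set (conv_curve mu) delta x ->
     `|f x| + enorm (grad f x) + fnorm (hessian f x) <= C) ->
  nbhd_set (conv_curve mu) delta x -> `|grad f x 0 i| <= C.
Proof.
move=> hC nx; apply: le_trans (hC _ nx); apply: (le_trans (coord_le_enorm _ i)).
by rewrite -addrA addrCA lerDl addr_ge0// sqrtr_ge0.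
Qed.

Lemma grad_continuous (f : 'rV[R]_d -> R) i : twice_differentiable f ->
  continuous (fun x => grad f x 0 i).
Proof.
move=> [_ dgf] z; apply: differentiable_continuous.
apply: (@differentiable_comp _ _ _ _ (grad f) (fun y : 'rV[R]_d => y 0 i)); first exact: dgf.
exact: differentiable_coord.
Qed.

End Neighborhood.

(** * Covariances and long-run covariances *)

Section Covariances.
Context {R : realType} {d0 : measure_display} {Omega : measurableType d0}.
Variable P : probability Omega R.
Implicit Types X Y : Omega -> R.

Definition cov X Y : R := Ex P (fun w => X w * Y w) - Ex P X * Ex P Y.

Lemma cov_centered X Y : L2 P X -> L2 P Y ->
  Ex P (fun w => (X w - Ex P X) * (Y w - Ex P Y)) = cov X Y.
Proof.
move=> LX LY; have iXY := L2_intgM LX LY.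
have i1 := intgZ (Ex P Y) (L2_intg LX); have i2 := intgZ (Ex P X) (L2_intg LY).
rewrite (_ : (fun w => _) = (fun w => X w * Y w - Ex P Y * X w - Ex P X * Y w + Ex P X * Ex P Y)); last first.
  by apply/funext => w; ring.
rewrite (ExD (intgB (intgB iXY i1) i2) (intg_cst P _)) Ex_cst (ExB (intgB iXY i1) i2) (ExB iXY i1).
by rewrite (ExZ _ (L2_intg LX)) (ExZ _ (L2_intg LY)) /cov; ring.
Qed.

Lemma covC X Y : cov X Y = cov Y X.
Proof. by rewrite /cov mulrC; congr (Ex P _ - _); apply/funext => w; rewrite mulrC. Qed.

Lemma cov_le X Y : L2 P X -> L2 P Y -> `|cov X Y| <= 2 * (N2 P X * N2 P Y).
Proof.
move=> LX LY; apply: (le_trans (ler_normB _ _)).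
rewrite mulr_natl mulr2n lerD ?CS// normrM ler_pM// Ex_le_N2//.
Qed.

Lemma covBl X X' Y : L2 P X -> L2 P X' -> L2 P Y ->
  cov X Y - cov X' Y = cov (fun w => X w - X' w) Y.
Proof.
move=> LX LX' LY; rewrite /cov (ExB (L2_intg LX) (L2_intg LX')).
rewrite (_ : (fun w => (X w - X' w) * Y w) = (fun w => X w * Y w - X' w * Y w)); last first.
  by apply/funext => w; ring.
by rewrite (ExB (L2_intgM LX LY) (L2_intgM LX' LY)); ring.
Qed.

Lemma cov_close X X' Y Y' : L2 P X -> L2 P X' -> L2 P Y -> L2 P Y' ->
  `|cov X Y - cov X' Y'| <=
  2 * (N2 P (fun w => X w - X' w) * N2 P Y + N2 P X' * N2 P (fun w => Y w - Y' w)).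
Proof.
move=> LX LX' LY LY'.
have -> : cov X Y - cov X' Y' = cov (fun w => X w - X' w) Y + cov X' (fun w => Y w - Y' w).
  rewrite -(covBl LX LX' LY) (covC X' (fun w => Y w - Y' w)) -(covBl LY LY' LX').
  by rewrite (covC Y X') (covC Y' X'); ring.
rewrite (le_trans (ler_normD _ _))// mulrDr lerD// cov_le//; exact: L2B.
Qed.

End Covariances.

(** * Series over all integers with geometric tails *)

Section GeometricSeries.
Context {R : realType}.
Variables (C rho : R).
Hypotheses (C0 : 0 <= C) (rho01 : 0 < rho < 1).

Lemma geo_shift_le (c : R) n m : 0 <= c -> \sum_(n <= i < m) c * rho ^+ i <= c / (1 - rho) * rho ^+ n.
Proof.
move=> c0; case/andP: (rho01) => r0 r1.
rewrite -mulr_sumr -[leRHS]mulrA ler_wpM2l// mulrC.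
have [mn|/ltnW nm] := leqP m n.
  by rewrite big_geq// mulr_ge0 ?exprn_ge0 ?(ltW r0)// invr_ge0 subr_ge0 ltW.
rewrite -{1}[n]add0n big_addn.
under eq_bigr do rewrite exprD mulrC.
by rewrite -mulr_sumr ler_wpM2l ?exprn_ge0 ?(ltW r0)// geo_sum_le.
Qed.

Lemma geo_series (b : nat -> R) : (forall i, `|b i| <= C * rho ^+ i) ->
  exists S, series b n @[n --> \oo] --> S /\
    forall n, `|S - series b n| <= C / (1 - rho) * rho ^+ n.
Proof.
move=> hb; case/andP: (rho01) => r0 r1.
have cv : cvgn (series b).
  apply: normed_cvg; apply: (@series_le_cvg _ _ (geometric C rho)) => //.
  - by move=> n; rewrite /=.
  - by move=> n; rewrite /geometric /= mulr_ge0// exprn_ge0// ltW.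
  - by apply: is_cvg_geometric_series; rewrite ger0_norm// ltW.
exists (limn (series b)); split => // n.
have hd m : (n <= m)%N -> `|series b m - series b n| <= C / (1 - rho) * rho ^+ n.
  move=> nm; rewrite sub_series nm; apply: (le_trans (ler_norm_sum _ _ _)).
  by apply: le_trans (geo_shift_le n m C0); apply: ler_sum => i _; exact: hb.
have cn : `|series b m - series b n| @[m --> \oo] --> `|limn (series b) - series b n|.
  by apply: cvg_norm; apply: cvgB => //; exact: cvg_cst.
have cn' : cvgn (fun m => `|series b m - series b n|) by apply/cvg_ex; exists `|limn (series b) - series b n|.
rewrite -(cvg_lim _ cn)//; apply: limr_le => //.
by exists n => // m /= nm; exact: hd.
Qed.

(** Nonnegative and negative lags are summed separately. The truncation may be asymmetric because
    row i of a block of length b sees only the lags from 1 - i to b - i. *)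
Lemma bilateral (a : int -> R) : (forall h, `|a h| <= C * rho ^+ absz h) ->
  exists S, (\sum_(0 <= i < (2 * H).+1) a (i%:Z - H%:Z)) @[H --> \oo] --> S /\
    forall A B : nat, `|S - \sum_(0 <= i < A + B.+1) a (i%:Z - A%:Z)| <= C / (1 - rho) * (rho ^+ A + rho ^+ B).
Proof.
move=> ha; case/andP: (rho01) => r0 r1.
pose bp (i : nat) := a i%:Z; pose bm (i : nat) := a (- (i.+1)%:Z).
have hp i : `|bp i| <= C * rho ^+ i by have := ha i%:Z.
have hm i : `|bm i| <= C * rho ^+ i.
  apply: (le_trans (ha _)); rewrite ler_wpM2l// abszN absz_nat exprS ler_piMl ?exprn_ge0 ?(ltW r0)//.
  exact: ltW.
have [Sp [cp tp]] := geo_series hp; have [Sm [cm tm]] := geo_series hm.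
have E (A B : nat) : \sum_(0 <= i < A + B.+1) a (i%:Z - A%:Z) = series bm A + series bp B.+1.
  rewrite (big_cat_nat (n := A)) ?leq_addr//=; congr (_ + _).
    rewrite /series /= big_nat_rev/= add0n !big_nat; apply: eq_bigr => i /andP[_ iA].
    by rewrite /bm; congr a; lia.
  rewrite /series /= -{1}[A]add0n big_addn addKn; apply: eq_bigr => i _.
  by rewrite /bp; congr a; lia.
exists (Sm + Sp); split.
  have -> : (fun H => \sum_(0 <= i < (2 * H).+1) a (i%:Z - H%:Z)) = (fun H => series bm H + series bp H.+1).
    by apply/funext => H; rewrite -E; congr (\sum_(0 <= i < _) _); lia.
  by apply: cvgD => //; rewrite (cvg_shiftS (series bp)).
move=> A B; rewrite E opprD addrACA (le_trans (ler_normD _ _))// mulrDr lerD//.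
apply: (le_trans (tp _)); rewrite ler_wpM2l ?divr_ge0// ?subr_ge0 ?(ltW r1)//.
by rewrite exprS ler_piMl ?exprn_ge0 ?(ltW r0)// ltW.
Qed.

End GeometricSeries.

(** * Measurable dependence of expectations on a parameter *)

Section ParametricExpectation.
Context {R : realType} {d0 : measure_display} {Omega : measurableType d0}.
Variable P : probability Omega R.

(** Tonelli applies to the positive and to the negative part, and [Rintegral] is by definition the
    [fine] of their difference, for every v. *)
Lemma meas_Ex_param (F : R * Omega -> R) : measurable_fun setT F ->
  measurable_fun setT (fun v : R => Ex P (fun w => F (v, w))).
Proof.
move=> mF.
have mF' : measurable_fun setT (EFin \o F) by exact/measurable_EFinP.
have mp : measurable_fun setT (fun v => \int[P]_w (((EFin \o F)^\+)%E (v, w)))%E.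
  apply: (@measurable_fun_fubini_tonelli_F _ _ R Omega R P ((EFin \o F)^\+)%E) => //.
  exact: measurable_funepos.
have mn : measurable_fun setT (fun v => \int[P]_w (((EFin \o F)^\-)%E (v, w)))%E.
  apply: (@measurable_fun_fubini_tonelli_F _ _ R Omega R P ((EFin \o F)^\-)%E) => //.
  exact: measurable_funeneg.
rewrite (_ : (fun v => _) = fine \o (fun v => (\int[P]_w (((EFin \o F)^\+)%E (v, w)) - \int[P]_w (((EFin \o F)^\-)%E (v, w)))%E)).
  apply: measurableT_comp; first exact: fine_measurable.
  exact: emeasurable_funB.
apply/funext => v; rewrite /Ex /Rintegral [in LHS]integralE /comp /=.
congr (fine (_ - _)%E); apply: eq_integral => w _.
  by rewrite !funeposE.
by rewrite !funenegE.
Qed.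

Variable eps : int -> Omega -> R.
Hypothesis meps : forall i, measurable_fun setT (eps i).
Context {d : nat}.
Variable K : R -> (nat -> R) -> 'rV[R]_d.
Hypothesis mK : kernel_measurable K.

Lemma meas_kernel_joint (h : int) k :
  measurable_fun setT (fun vw : R * Omega => K vw.1 (epsseq eps h vw.2) 0 k).
Proof.
apply: kernel_comp => // m; apply: measurableT_comp; first exact: meps.
exact: measurable_snd.
Qed.

Lemma meas_mean_param (h : int) k :
  measurable_fun setT (fun v : R => Ex P (fun w => K v (epsseq eps h w) 0 k)).
Proof. exact: (meas_Ex_param (meas_kernel_joint h k)). Qed.

Lemma meas_cov_param (h h' : int) k l : measurable_fun setT (fun v : R =>
  cov P (fun w => K v (epsseq eps h w) 0 k) (fun w => K v (epsseq eps h' w) 0 l)).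
Proof.
apply: measurable_funB; last by apply: measurable_funM; exact: meas_mean_param.
have := measurable_funM (meas_kernel_joint h k) (meas_kernel_joint h' l).
exact: meas_Ex_param.
Qed.

End ParametricExpectation.

Section LongRun.
Context {R : realType}.

Lemma cvg_mx_entry (d : nat) (M : nat -> 'M[R]_d) (A : 'M[R]_d) :
  (forall k l, M n k l @[n --> \oo] --> A k l) -> M n @[n --> \oo] --> A.
Proof.
move=> h; apply/cvg_ballP => e e0.
have hn : \forall n \near \oo, forall k l, ball (A k l) e (M n k l).
  apply: filter_forall => k; apply: filter_forall => l.
  by have /cvg_ballP := h k l; apply.
by apply: filterS hn => n hn; split.
Qed.

Lemma limn_mx_entry (d : nat) (M : nat -> 'M[R]_d) (A : 'M[R]_d) :
  (forall k l, M n k l @[n --> \oo] --> A k l) -> limn M = A.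
Proof. by move=> h; apply: cvg_lim; [exact: norm_hausdorff|exact: cvg_mx_entry]. Qed.

End LongRun.

(** * Block sums of one kernel *)

Section PastFun.
Context {R : realType} {d0 : measure_display} {Omega : measurableType d0}.
Variable eps : int -> Omega -> R.

Definition past_gen (s : int) : set (set Omega) :=
  [set A | exists r (B : set R), r <= s /\ measurable B /\ A = eps r @^-1` B].
(** The sample space with the past sigma-algebra as its measurable structure: [past_fun] becomes
    ordinary measurability and inherits its closure properties. *)
Definition Om (s : int) := g_sigma_algebraType (past_gen s).
HB.instance Definition _ (s : int) := Measurable.on (Om s).

Lemma past_funE s (Y : Omega -> R) : past_fun eps s Y <-> measurable_fun (setT : set (Om s)) Y.
Proof.
split; first by move=> h _ B mB; rewrite setTI; exact: h.
by move=> h B mB; have := h measurableT _ mB; rewrite setTI.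
Qed.

Lemma past_eps s r : r <= s -> measurable_fun (setT : set (Om s)) (eps r).
Proof.
by move=> rs _ B mB; rewrite setTI; apply: sub_sigma_algebra; exists r, B.
Qed.

Lemma past_kernel d (K : R -> (nat -> R) -> 'rV[R]_d) u s t k : kernel_measurable K -> t <= s ->
  measurable_fun (setT : set (Om s)) (fun w => K u (epsseq eps t w) 0 k).
Proof.
move=> mK ts; apply: (@kernel_comp _ _ K mK _ (Om s) (fun=> u) (fun w => epsseq eps t w)) => // m.
by apply: past_eps; apply: le_trans ts; rewrite lerBlDr lerDl.
Qed.

End PastFun.

Section Counting.

Lemma addS_le (t b n i : nat) : (t + b <= n)%N -> (i < b)%N -> (t + i.+1 <= n)%N.
Proof. by move=> tb ib; apply: leq_trans tb; rewrite leq_add2l. Qed.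

Lemma sum_interval (a c lo hi : nat) : (\sum_(a <= t < c) (lo <= t < hi) <= hi - lo)%N.
Proof.
have h : (\sum_(0 <= t < c) (lo <= t < hi) = minn c hi - lo)%N.
  elim: c => [|c IH]; first by rewrite big_geq//; lia.
  by rewrite big_nat_recr//= IH; case: (leqP lo c); case: (ltnP c hi); lia.
have [ac|ca] := leqP a c; last by rewrite big_geq// ltnW.
have : (\sum_(a <= t < c) (lo <= t < hi) <= \sum_(0 <= t < c) (lo <= t < hi))%N.
  by rewrite (big_cat_nat (n := a) (m := 0))//= leq_addl.
by move=> /leq_trans; apply; rewrite h; lia.
Qed.

Lemma sum_rho_absz (R : realType) (rho : R) (i b : nat) : 0 < rho < 1 ->
  \sum_(1 <= j < b.+1) rho ^+ absz (i%:Z - j%:Z) <= 2 / (1 - rho).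
Proof.
move=> rho01; case/andP: (rho01) => r0 r1.
(* The range is enlarged until it contains i, and then splits there into two geometric sums. *)
apply: (@le_trans _ _ (\sum_(0 <= j < b.+1) rho ^+ absz (i%:Z - j%:Z))).
  by rewrite [leRHS]big_nat_recl//= big_add1 lerDr exprn_ge0// ltW.
apply: (@le_trans _ _ (\sum_(0 <= j < i + b.+1) rho ^+ absz (i%:Z - j%:Z))).
  rewrite addnC (big_cat_nat (n := b.+1) (p := b.+1 + i))//= ?leq_addr// lerDl.
  by apply: sumr_ge0 => j _; rewrite exprn_ge0// ltW.
rewrite (big_cat_nat (n := i))//= ?leq_addr// mulrDl lerD//.
  rewrite mul1r -[leRHS]mul1r big_nat_rev/= add0n.
  apply: (@le_trans _ _ (\sum_(0 <= j < i) rho ^+ j)); last by rewrite mul1r geo_sum_le.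
  rewrite !big_nat; apply: ler_sum => j /andP[_ ji].
  by rewrite (_ : absz _ = j.+1); [rewrite exprS ler_piMl ?exprn_ge0 ?(ltW r0)// ltW|lia].
rewrite mul1r -{1}[i]add0n big_addn addKn; apply: le_trans (geo_sum_le b.+1 rho01).
by rewrite !big_nat; apply: ler_sum => j _; rewrite (_ : absz _ = j)//; lia.
Qed.

End Counting.

(** * Moments, couplings and variance of squared block sums *)

Section Blocks.
Context {R : realType} {d0 : measure_display} {Omega : measurableType d0}.
Variable P : probability Omega R.
Variables eps epss : int -> Omega -> R.
Let xi := fun ib : bool * int => if ib.1 then epss ib.2 else eps ib.2.
Hypothesis meps : forall i, measurable_fun setT (eps i).
Hypothesis mepss : forall i, measurable_fun setT (epss i).
Hypothesis indep : mutual_indep P xi.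
Hypothesis ident : ident_distr P xi.
Context {d : nat}.
Variable K : R -> (nat -> R) -> 'rV[R]_d.
Hypothesis mK : kernel_measurable K.
Variables (q C rho : R).
Hypotheses (q4 : 4 < q) (C0 : 0 <= C) (rho01 : 0 < rho < 1).
Hypothesis KC : forall u, 0 <= u <= 1 -> (LqN P q (fun w => K u (epsseq eps 0 w)) <= C%:E)%E.
Hypothesis A3 : forall (j : nat) (u : R) (t : int), 0 <= u <= 1 ->
  (LqN P q (fun w => (K u (epsseq eps t w) - K u (epstilde eps epss t j w))%R) <= (C * rho ^+ j)%:E)%E.

Variables (Cc Cs : R).
Hypotheses (Cc0 : 0 <= Cc) (Cs0 : 0 <= Cs) (Cc_le : 2 * C / (1 - rho) <= Cc) (Cs_le : Cc / (1 - rho) <= Cs).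

Let r0 : 0 < rho. Proof. by case/andP: rho01. Qed.
Let r1 : rho < 1. Proof. by case/andP: rho01. Qed.
Let r1' : 0 < 1 - rho. Proof. by rewrite subr_gt0. Qed.
Let mx0 : measurable_fun setT (x0 eps) := meas_x0 meps mepss.

Lemma X_L4 u t k : 0 <= u <= 1 ->
  L4 P (fun w => K u (epsseq eps t w) 0 k) /\ N4 P (fun w => K u (epsseq eps t w) 0 k) <= 2 * C.
Proof.
move=> u01.
have LL t' : L4 P (fun w => K u (epsseq eps t' w) 0 k).
  by apply: (kf_L4 meps mepss indep ident mK q4); exists C; exact: KC.
split; first exact: LL.
have [_ n0] := LqN_N4 k q4 C0 (fun i => measurableT_comp (meas_kf mK u 0 i) mx0) (KC u01).
suff -> : N4 P (fun w => K u (epsseq eps t w) 0 k) = N4 P (fun w => K u (epsseq eps 0 w) 0 k) by [].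
have m4 : measurable_fun setT (fun y : R => (y ^+ 2) ^+ 2).
  by do 2! apply: measurable_funX; exact: measurable_id.
have i0 : intg P (fun w => (kf K u 0 k (x0 eps w) ^+ 2) ^+ 2) by exact: (L4_sqr (LL 0)).2.
by have [_ e] := kf_shift meps mepss indep ident mK t m4 i0; rewrite /N4 /N2 e.
Qed.

Lemma X_mean_shift u t k : 0 <= u <= 1 ->
  Ex P (fun w => K u (epsseq eps t w) 0 k) = Ex P (fun w => K u (epsseq eps 0 w) 0 k).
Proof.
move=> u01; have i0 := L2_intg (L4_L2 (X_L4 0 k u01).1).
by have [_ ->] := kf_shift meps mepss indep ident mK t (@measurable_id _ _ _) i0.
Qed.

Lemma X_coupling u (s : int) (m N : nat) k : 0 <= u <= 1 ->
  L4 P (fun w => kf K u (s + m%:Z) k (x0 eps w) - kf K u (s + m%:Z) k (xs eps epss s N w)) /\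
  N4 P (fun w => kf K u (s + m%:Z) k (x0 eps w) - kf K u (s + m%:Z) k (xs eps epss s N w))
    <= Cc * rho ^+ m.
Proof.
move=> u01; have [|L h] := coupling meps mepss indep ident mK q4 C0 rho01 (u := u) _ s m N k.
  by move=> j t; exact: A3.
by split => //; apply: (le_trans h); rewrite ler_wpM2r ?exprn_ge0 ?(ltW r0).
Qed.

Lemma X_cov_shift u v (s t : int) k l : 0 <= u <= 1 -> 0 <= v <= 1 ->
  cov P (fun w => K u (epsseq eps s w) 0 k) (fun w => K v (epsseq eps t w) 0 l) =
  cov P (fun w => K u (epsseq eps 0 w) 0 k) (fun w => K v (epsseq eps (t - s) w) 0 l).
Proof.
move=> u01 v01; rewrite /cov !(X_mean_shift _ _ u01) !(X_mean_shift _ _ v01); congr (_ - _).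
have mF : measurable_fun setT (fun x => kf K u 0 k x * kf K v (t - s) l x).
  by apply: measurable_funM; exact: meas_kf.
have iF : intg P (fun w => kf K u 0 k (x0 eps w) * kf K v (t - s) l (x0 eps w)).
  by apply: L2_intgM; apply: L4_L2; apply: (X_L4 _ _ _).1.
have [_ <-] := shift_Ex meps mepss indep ident s mF iF.
congr Ex; apply/funext => w; congr (_ * _).
  rewrite /kf; congr (K u _ 0 k); apply/funext => m; rewrite /epsseq.
  by congr eps; ring.
rewrite /kf; congr (K v _ 0 l); apply/funext => m; rewrite /epsseq.
by congr eps; ring.
Qed.

(** For a lag m >= 0 the first variable belongs to the past up to 0, and the second has coupling
    error Cc rho^m when innovations up to time 0 are resampled. Negative lags reduce to this by
    symmetry and stationarity. *)
Lemma X_cov_decay u v (h : int) k l : 0 <= u <= 1 -> 0 <= v <= 1 ->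
  `|cov P (fun w => K u (epsseq eps 0 w) 0 k) (fun w => K v (epsseq eps h w) 0 l)|
   <= 2 * C * Cc * rho ^+ absz h.
Proof.
have main u' v' (m : nat) k' l' : 0 <= u' <= 1 -> 0 <= v' <= 1 ->
  `|cov P (fun w => K u' (epsseq eps 0 w) 0 k') (fun w => K v' (epsseq eps m%:Z w) 0 l')|
   <= 2 * C * Cc * rho ^+ m.
  move=> u01 v01; have LX := L4_L2 (X_L4 0 k' u01).1.
  have LY := L4_L2 (X_L4 m%:Z l' v01).1.
  have pA : past_fun eps 0 (fun w => K u' (epsseq eps 0 w) 0 k').
    by apply/past_funE; exact: past_kernel.
  have := @cov_bound _ _ _ P eps epss meps mepss indep ident 0 _ (kf K v' m%:Z l') (Cc * rho ^+ m)
     pA LX (meas_kf mK v' m%:Z l') LY.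
  move=> hh; apply: (le_trans (hh _)).
    move=> N; have [L n] := X_coupling 0 m N l' v01; rewrite add0r in L n.
    exact: le_trans (N2_le_N4 L) n.
  rewrite -mulrA ler_wpM2r ?mulr_ge0 ?exprn_ge0 ?(ltW r0)//.
  exact: le_trans (N2_le_N4 (X_L4 0 k' u01).1) (X_L4 0 k' u01).2.
move=> u01 v01; case: h => m; first exact: main.
rewrite NegzE covC X_cov_shift// opprK add0r abszN; exact: main.
Qed.

Variables (n b : nat).
Hypotheses (n0 : (0 < n)%N) (b0 : (0 < b)%N).

Definition Xm (t : nat) k : R := Ex P (fun w => K (t%:R / n%:R) (epsseq eps t%:Z w) 0 k).
(** The times summed are t + 1 to t + b. The centring is by constants, so that it cancels in
    coupling differences. *)
Definition sf (t : nat) k (x : paths int) : R :=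
  \sum_(1 <= i < b.+1) (kf K ((t + i)%:R / n%:R) (t + i)%:Z k x - Xm (t + i) k).

Lemma meas_sf t k : measurable_fun setT (sf t k).
Proof.
apply: measurable_sum => i; apply: measurable_funB; first exact: meas_kf.
exact: measurable_cst.
Qed.

Lemma Xm_le t k : (t <= n)%N -> `|Xm t k| <= 2 * C.
Proof.
move=> tn; have [L h] := X_L4 t%:Z k (frac01 tn).
apply: (le_trans (Ex_le_N2 (L4_L2 L))); exact: le_trans (N2_le_N4 L) h.
Qed.

Lemma Xc_L4 t k : (t <= n)%N ->
  L4 P (fun w => kf K (t%:R / n%:R) t%:Z k (x0 eps w) - Xm t k) /\
  N4 P (fun w => kf K (t%:R / n%:R) t%:Z k (x0 eps w) - Xm t k) <= 4 * C.
Proof.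
move=> tn; have [L h] := X_L4 t%:Z k (frac01 tn).
split; first exact: L4B L (L4_cst _ _).
apply: (le_trans (N4B L (L4_cst _ _))); rewrite N4_cst; have := Xm_le k tn.
by move: h; rewrite /kf -/(epsseq _ _ _); set a := N4 _ _; lra.
Qed.

Lemma sf_L4 t k : (t + b <= n)%N ->
  L4 P (fun w => sf t k (x0 eps w)) /\ N4 P (fun w => sf t k (x0 eps w)) <= b%:R * (4 * C).
Proof.
move=> tb.
have E : (fun w => sf t k (x0 eps w)) = (fun w => \sum_(i < b) (kf K ((t + i.+1)%:R / n%:R) (t + i.+1)%:Z k (x0 eps w) - Xm (t + i.+1) k)).
  by apply/funext => w; rewrite /sf big_add1 big_mkord.
have LL (i : 'I_b) : L4 P (fun w => kf K ((t + i.+1)%:R / n%:R) (t + i.+1)%:Z k (x0 eps w) - Xm (t + i.+1) k) /\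
   N4 P (fun w => kf K ((t + i.+1)%:R / n%:R) (t + i.+1)%:Z k (x0 eps w) - Xm (t + i.+1) k) <= 4 * C.
  exact: Xc_L4 (addS_le tb (ltn_ord i)).
rewrite E; split; first by apply: L4_sum => i _; exact: (LL i).1.
apply: (le_trans (N4_sum _ (fun i _ => (LL i).1))).
apply: (@le_trans _ _ (\sum_(i < b) 4 * C)); first by apply: ler_sum => i _; exact: (LL i).2.
by rewrite sumr_const card_ord -[leLHS]mulr_natl.
Qed.

(** Later terms of the block are farther from s, so their coupling errors form a geometric series:
    unlike the bound of [sf_L4], this one does not grow with b. *)
Lemma sf_coupling (s : int) (m N t : nat) k : (t + b <= n)%N -> t%:Z = s + m%:Z ->
  L4 P (fun w => sf t k (x0 eps w) - sf t k (xs eps epss s N w)) /\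
  N4 P (fun w => sf t k (x0 eps w) - sf t k (xs eps epss s N w)) <= Cs * rho ^+ m.
Proof.
move=> tb ts.
have E : (fun w => sf t k (x0 eps w) - sf t k (xs eps epss s N w)) =
  (fun w => \sum_(i < b) (kf K ((t + i.+1)%:R / n%:R) (t + i.+1)%:Z k (x0 eps w) -
                          kf K ((t + i.+1)%:R / n%:R) (t + i.+1)%:Z k (xs eps epss s N w))).
  apply/funext => w; rewrite /sf !big_add1 !big_mkord -sumrB.
  by apply: eq_bigr => i _; ring.
have LL (i : 'I_b) : L4 P (fun w => kf K ((t + i.+1)%:R / n%:R) (t + i.+1)%:Z k (x0 eps w) -
                          kf K ((t + i.+1)%:R / n%:R) (t + i.+1)%:Z k (xs eps epss s N w)) /\
  N4 P (fun w => kf K ((t + i.+1)%:R / n%:R) (t + i.+1)%:Z k (x0 eps w) -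
                          kf K ((t + i.+1)%:R / n%:R) (t + i.+1)%:Z k (xs eps epss s N w)) <= Cc * rho ^+ (m + i.+1).
  have -> : (t + i.+1)%:Z = s + (m + i.+1)%:Z by rewrite !PoszD ts addrA.
  exact: X_coupling (frac01 (addS_le tb (ltn_ord i))).
rewrite E; split; first by apply: L4_sum => i _; exact: (LL i).1.
apply: (le_trans (N4_sum _ (fun i _ => (LL i).1))).
apply: (@le_trans _ _ (\sum_(i < b) Cc * rho ^+ m * rho ^+ i)).
  apply: ler_sum => i _; apply: (le_trans (LL i).2).
  rewrite exprD mulrA ler_wpM2l ?mulr_ge0 ?exprn_ge0 ?(ltW r0)//.
  by rewrite exprS ler_piMl ?exprn_ge0 ?(ltW r0)// ltW.
apply: (@le_trans _ _ (Cc / (1 - rho) * rho ^+ m)); last by rewrite ler_wpM2r// exprn_ge0// ltW.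
rewrite -mulr_sumr [leRHS]mulrAC ler_wpM2l ?mulr_ge0 ?exprn_ge0 ?(ltW r0)//.
by rewrite -(big_mkord xpredT (fun i => rho ^+ i)) geo_sum_le.
Qed.

Definition C2 : R := 2 * C * Cc * (2 / (1 - rho)).

Lemma C2_ge0 : 0 <= C2.
Proof. by rewrite /C2 !mulr_ge0// invr_ge0 ltW. Qed.

Lemma Ex_Xc2 s t k l : (s <= n)%N -> (t <= n)%N ->
  Ex P (fun w => (kf K (s%:R / n%:R) s%:Z k (x0 eps w) - Xm s k) * (kf K (t%:R / n%:R) t%:Z l (x0 eps w) - Xm t l))
  = cov P (fun w => K (s%:R / n%:R) (epsseq eps 0 w) 0 k) (fun w => K (t%:R / n%:R) (epsseq eps (t%:Z - s%:Z) w) 0 l).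
Proof.
move=> sn tn; rewrite -X_cov_shift; [|exact: frac01|exact: frac01].
by rewrite -cov_centered//; apply: L4_L2; apply: (X_L4 _ _ _).1; exact: frac01.
Qed.

(** Rows of the covariance matrix of the block are summable, which gives the order b where [sf_L4]
    alone would give b^2. *)
Lemma sf_moment2 t k : (t + b <= n)%N -> Ex P (fun w => sf t k (x0 eps w) ^+ 2) <= C2 * b%:R.
Proof.
move=> tb; pose Y (i : nat) w := kf K ((t + i)%:R / n%:R) (t + i)%:Z k (x0 eps w) - Xm (t + i) k.
have tn (i : 'I_b) : (t + i.+1 <= n)%N by exact: addS_le tb (ltn_ord i).
have LY (i : 'I_b) : L2 P (Y i.+1).
  by apply: L4_L2; apply: (Xc_L4 _ (tn i)).1.
have E : (fun w => sf t k (x0 eps w) ^+ 2) = (fun w => \sum_(i < b) \sum_(j < b) Y i.+1 w * Y j.+1 w).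
  apply/funext => w; rewrite /sf big_add1 big_mkord expr2 mulr_suml.
  by apply: eq_bigr => i _; rewrite mulr_sumr.
rewrite E Ex_sum; last first.
  by move=> i _; apply: intg_sum => j _; apply: L2_intgM; exact: LY.
apply: (@le_trans _ _ (\sum_(i < b) C2)); last by rewrite sumr_const card_ord -[leLHS]mulr_natr.
apply: ler_sum => i _; rewrite Ex_sum; last by move=> j _; apply: L2_intgM; exact: LY.
rewrite /C2; apply: (@le_trans _ _ (\sum_(j < b) 2 * C * Cc * rho ^+ absz (i.+1%:Z - j.+1%:Z))).
  apply: ler_sum => j _; rewrite (Ex_Xc2 _ _ (tn i) (tn j)).
  apply: (le_trans (ler_norm _)); apply: le_trans (X_cov_decay _ _ _ _ _) _.
  - exact: frac01.
  - exact: frac01.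
  by rewrite (_ : absz _ = absz (i.+1%:Z - j.+1%:Z))//; clear; lia.
rewrite -mulr_sumr ler_wpM2l ?mulr_ge0//.
have := sum_rho_absz i.+1 b rho01.
by rewrite big_add1 big_mkord.
Qed.

Variables (g : nat -> 'I_d -> R) (Cf : R).
Hypotheses (Cf0 : 0 <= Cf) (gC : forall t k, `|g t k| <= Cf).

Definition tf (t : nat) (x : paths int) : R := \sum_k g t k * sf t k x.
Let MT := d%:R * (Cf * (4 * C)).
Let CT := d%:R * (Cf * Cs).
Let MT0 : 0 <= MT. Proof. by rewrite /MT !mulr_ge0. Qed.
Let CT0 : 0 <= CT. Proof. by rewrite /CT !mulr_ge0. Qed.

Lemma meas_tf t : measurable_fun setT (tf t).
Proof.
apply: measurable_sum => k; apply: measurable_funM; first exact: measurable_cst.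
exact: meas_sf.
Qed.

Lemma tf_L4 t : (t + b <= n)%N ->
  L4 P (fun w => tf t (x0 eps w)) /\ N4 P (fun w => tf t (x0 eps w)) <= MT * b%:R.
Proof.
move=> tb; have LS k := sf_L4 k tb.
split; first by apply: L4_sum => k _; exact: L4Z (LS k).1.
apply: (le_trans (N4_sum _ (fun k _ => L4Z (g t k) (LS k).1))).
apply: (@le_trans _ _ (\sum_(k < d) Cf * (b%:R * (4 * C)))).
  by apply: ler_sum => k _; rewrite (N4Z _ (LS k).1) ler_pM ?N4_ge0//; exact: (LS k).2.
rewrite sumr_const card_ord -[leLHS]mulr_natl /MT le_eqVlt; apply/orP; left; apply/eqP; ring.
Qed.

Lemma tf_coupling (s : int) (m N t : nat) : (t + b <= n)%N -> t%:Z = s + m%:Z ->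
  L4 P (fun w => tf t (x0 eps w) - tf t (xs eps epss s N w)) /\
  N4 P (fun w => tf t (x0 eps w) - tf t (xs eps epss s N w)) <= CT * rho ^+ m.
Proof.
move=> tb ts; have LS k := sf_coupling N k tb ts.
have E : (fun w => tf t (x0 eps w) - tf t (xs eps epss s N w)) =
   (fun w => \sum_k g t k * (sf t k (x0 eps w) - sf t k (xs eps epss s N w))).
  by apply/funext => w; rewrite /tf -sumrB; apply: eq_bigr => k _; rewrite mulrBr.
rewrite E; split; first by apply: L4_sum => k _; exact: L4Z (LS k).1.
apply: (le_trans (N4_sum _ (fun k _ => L4Z (g t k) (LS k).1))).
apply: (@le_trans _ _ (\sum_(k < d) Cf * (Cs * rho ^+ m))).
  by apply: ler_sum => k _; rewrite (N4Z _ (LS k).1) ler_pM ?N4_ge0//; exact: (LS k).2.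
by rewrite sumr_const card_ord -[leLHS]mulr_natl /CT -!mulrA.
Qed.

(* Squares of functionals inherit the coupling bound: x^2 - y^2 = (x - y)(x + y). *)
Lemma sqr_coupling (Phi : paths int -> R) s N (M c : R) : measurable_fun setT Phi ->
  L4 P (fun w => Phi (x0 eps w)) -> N4 P (fun w => Phi (x0 eps w)) <= M ->
  L4 P (fun w => Phi (x0 eps w) - Phi (xs eps epss s N w)) ->
  N4 P (fun w => Phi (x0 eps w) - Phi (xs eps epss s N w)) <= c ->
  N2 P (fun w => Phi (x0 eps w) ^+ 2 - Phi (xs eps epss s N w) ^+ 2) <= c * (2 * M).
Proof.
move=> mPhi L hM Ld hc.
have [Lx nx] := L4_xs meps mepss indep ident s N mPhi L.
rewrite (_ : (fun w => _) = (fun w => (Phi (x0 eps w) - Phi (xs eps epss s N w)) * (Phi (x0 eps w) + Phi (xs eps epss s N w)))); last first.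
  by apply/funext => w; ring.
apply: (le_trans (N2M Ld (L4D L Lx))); apply: ler_pM => //; try exact: N4_ge0.
apply: (le_trans (N4D L Lx)); rewrite nx; lra.
Qed.

(** W stands for a gradient error known at time s = t - m. Decorrelation bounds E (W S^2) by E W
    times E (S^2), of order b E W, plus a remainder that carries rho^m and the supremum B. *)
Lemma W_bound (W : Omega -> R) (B : R) (s : int) (m t : nat) k : (t + b <= n)%N -> t%:Z = s + m%:Z ->
  past_fun eps s W -> 0 <= B -> (forall w, 0 <= W w <= B) ->
  intg P (fun w => W w * sf t k (x0 eps w) ^+ 2) /\
  Ex P (fun w => W w * sf t k (x0 eps w) ^+ 2) <=
  C2 * b%:R * Ex P W + B * (Cs * rho ^+ m * (2 * (b%:R * (4 * C)))).
Proof.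
move=> tb ts pW B0 WB.
have mW : measurable_fun setT W by exact: (past_fun_meas meps pW).
have W2 w : `|W w ^+ 2| <= `|B ^+ 2|.
  by have /andP[w0 wB] := WB w; rewrite !ger0_norm ?sqr_ge0// lerXn2r ?nnegrE.
have LW : L2 P W by split => //; apply: (intg_le _ (intg_cst P (B ^+ 2))) => //; exact: measX.
have NW : N2 P W <= B.
  rewrite -[leRHS]ger0_norm// -(N2_cst P); apply: N2_le => //; first exact: L2_cst.
  by move=> w; have /andP[w0 wB] := WB w; rewrite !ger0_norm.
have [L4s n4s] := sf_L4 k tb; have LS := L4_sqr L4s.
have mPhi : measurable_fun setT (fun x => sf t k x ^+ 2).
  by apply: measurable_funX; exact: meas_sf.
split; first exact: L2_intgM.
have hc N : N2 P (fun w => sf t k (x0 eps w) ^+ 2 - sf t k (xs eps epss s N w) ^+ 2) <=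
    Cs * rho ^+ m * (2 * (b%:R * (4 * C))).
  have [Ld nd] := sf_coupling N k tb ts.
  exact: sqr_coupling (meas_sf t k) L4s n4s Ld nd.
have := cov_bound meps mepss indep ident pW LW mPhi LS hc.
set c := Cs * _ * _; move=> /(le_trans (ler_norm _)); rewrite lerBlDr => h.
apply: (le_trans h); rewrite addrC lerD//.
  rewrite mulrC ler_wpM2r ?sf_moment2//.
  by apply: Ex_ge0 => w; have /andP[] := WB w.
by rewrite ler_wpM2r// (le_trans (N2_ge0 _ _) (hc 0%N)).
Qed.

Definition Zf (t : nat) (x : paths int) : R := b%:R^-1 * tf t x ^+ 2.

Let bp : 0 < b%:R :> R. Proof. by rewrite ltr0n. Qed.

Lemma Zf_L2 t : (t + b <= n)%N ->
  L2 P (fun w => Zf t (x0 eps w)) /\ N2 P (fun w => Zf t (x0 eps w)) <= MT ^+ 2 * b%:R.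
Proof.
move=> tb; have [L h] := tf_L4 tb; split; first exact: L2Z (L4_sqr L).
rewrite (N2Z _ (L4_sqr L)) -N4_sqr ger0_norm ?invr_ge0 ?(ltW bp)// ler_pdivrMl//.
apply: (@le_trans _ _ ((MT * b%:R) ^+ 2)); first by rewrite lerXn2r ?nnegrE ?N4_ge0// mulr_ge0.
by rewrite exprMn le_eqVlt; apply/orP; left; apply/eqP; ring.
Qed.

Lemma Zf_past t (s : int) : (t + b)%:Z <= s -> past_fun eps s (fun w => Zf t (x0 eps w)).
Proof.
move=> ts; apply/past_funE.
apply: measurable_funM; first exact: measurable_cst.
apply: measurable_funX; apply: measurable_sum => k; apply: measurable_funM; first exact: measurable_cst.
rewrite (_ : (fun w => sf t k (x0 eps w)) = (fun w => \sum_(i < b) (kf K ((t + i.+1)%:R / n%:R) (t + i.+1)%:Z k (x0 eps w) - Xm (t + i.+1) k))); last first.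
  by apply/funext => w; rewrite /sf big_add1 big_mkord.
apply: (@measurable_sum _ (Om eps s)) => i; apply: measurable_funB; last exact: measurable_cst.
apply: (@past_kernel _ _ _ eps d K _ s (t + i.+1)%:Z k mK); apply: le_trans ts; rewrite lez_nat leq_add2l; exact: ltn_ord.
Qed.

(** From t = s + 2b on, at least b times separate the end s + b of the first block from t, and the
    coupling error of the second square is of order rho^b. Closer pairs are bounded by
    Cauchy-Schwarz. *)
Lemma Zf_cov s t : (s <= t)%N -> (t + b <= n)%N ->
  `|cov P (fun w => Zf s (x0 eps w)) (fun w => Zf t (x0 eps w))| <=
  2 * (MT ^+ 2 * b%:R) ^+ 2 * (t < s + 2 * b)%:R + MT ^+ 2 * b%:R * (2 * CT * MT * rho ^+ b).
Proof.
move=> st tb; have sb : (s + b <= n)%N by rewrite (leq_trans _ tb)// leq_add2r.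
have [Ls hs] := Zf_L2 sb; have [Lt ht] := Zf_L2 tb.
have MM : 0 <= MT ^+ 2 * b%:R by rewrite mulr_ge0 ?sqr_ge0.
case: ltnP => h.
  rewrite mulr1 -[leLHS]addr0 lerD//; last by rewrite !mulr_ge0// ?exprn_ge0// ltW.
  by apply: (le_trans (cov_le Ls Lt)); apply: ler_wpM2l => //; rewrite expr2; exact: ler_pM (N2_ge0 _ _) (N2_ge0 _ _) hs ht.
rewrite mulr0 add0r.
have pA := @Zf_past s (s + b)%:Z (lexx _).
have mPhi : measurable_fun setT (Zf t).
  by apply: measurable_funM; [exact: measurable_cst|apply: measurable_funX; exact: meas_tf].
have [L4t n4t] := tf_L4 tb.
have ts : t%:Z = (s + b)%:Z + (t - (s + b))%N%:Z by move: b0 h; clear; lia.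
have hc N : N2 P (fun w => Zf t (x0 eps w) - Zf t (xs eps epss (s + b)%:Z N w)) <= 2 * CT * MT * rho ^+ b.
  have [Ld nd] := tf_coupling N tb ts.
  have := sqr_coupling (meas_tf t) L4t n4t Ld nd => hq.
  rewrite (_ : (fun w => _) = (fun w => b%:R^-1 * (tf t (x0 eps w) ^+ 2 - tf t (xs eps epss (s + b)%:Z N w) ^+ 2))); last first.
    by apply/funext => w; rewrite /Zf mulrBr.
  have [Lx _] := L4_xs meps mepss indep ident (s + b)%:Z N (meas_tf t) L4t.
  rewrite N2Z; last exact: L2B (L4_sqr L4t) (L4_sqr Lx).
  rewrite ger0_norm ?invr_ge0 ?(ltW bp)// ler_pdivrMl//; apply: (le_trans hq).
  have rr : rho ^+ (t - (s + b)) <= rho ^+ b.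
    by apply: ler_wiXn2l; rewrite ?(ltW r0) ?(ltW r1)//; move: h; clear; lia.
  have -> : b%:R * (2 * CT * MT * rho ^+ b) = CT * rho ^+ b * (2 * (MT * b%:R)) by ring.
  by rewrite ler_wpM2r ?mulr_ge0// ler_wpM2l.
apply: (le_trans (cov_bound meps mepss indep ident pA Ls mPhi Lt hc)).
exact: (ler_wpM2r (le_trans (N2_ge0 _ _) (hc 0%N)) hs).
Qed.

(** Coefficients of the variance after division by n^2: 2 (MT^2 b)^2 for at most 4 b n close pairs,
    and MT^2 b times 2 CT MT rho^b for at most n^2 pairs. *)
Definition K1 : R := 8 * MT ^+ 4.
Definition K2 : R := 2 * CT * MT ^+ 3.

(* With b^3 = o(n) the crude bound N2(Z) = O(b) on the ~4b n correlated pairs is enough. *)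
Lemma var_avg (a c : nat) : (forall t, (a <= t < c)%N -> (t + b <= n)%N) ->
  L2 P (fun w => n%:R^-1 * \sum_(a <= t < c) Zf t (x0 eps w)) /\
  N2 P (fun w => n%:R^-1 * \sum_(a <= t < c) Zf t (x0 eps w) -
                 n%:R^-1 * \sum_(a <= t < c) Ex P (fun w => Zf t (x0 eps w))) ^+ 2
  <= K1 * (b%:R ^+ 3 / n%:R) + K2 * (b%:R * rho ^+ b).
Proof.
move=> hac; pose e t := Ex P (fun w => Zf t (x0 eps w)); pose Y (t : nat) w := Zf t (x0 eps w) - e t.
have MM : 0 <= MT ^+ 2 * b%:R by rewrite mulr_ge0 ?sqr_ge0.
pose I := index_iota a c.
have IE t : t \in I = (a <= t < c)%N by rewrite mem_index_iota.
pose good t := (a <= t < c)%N.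
have SE (f : nat -> R) : \sum_(a <= t < c) f t = \sum_(t <- I | good t) f t.
  by rewrite big_nat.
have LZ t : good t -> L2 P (fun w => Zf t (x0 eps w)) by move=> /hac /Zf_L2 [].
have LY t : good t -> L2 P (Y t) by move=> gt; apply: L2B; [exact: LZ|exact: L2_cst].
split.
  apply: L2Z; rewrite (_ : (fun w => _) = (fun w => \sum_(t <- I | good t) Zf t (x0 eps w))).
    exact: L2_sum.
  by apply/funext => w; rewrite SE.
have E : (fun w => n%:R^-1 * \sum_(a <= t < c) Zf t (x0 eps w) - n%:R^-1 * \sum_(a <= t < c) e t) =
   (fun w => n%:R^-1 * \sum_(t <- I | good t) Y t w).
  by apply/funext => w; rewrite -mulrBr -sumrB SE.
rewrite E N2_sqr.
rewrite (_ : (fun w => _) = (fun w => n%:R^-1 ^+ 2 * \sum_(s <- I | good s) \sum_(t <- I | good t) Y s w * Y t w)); last first.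
  apply/funext => w; rewrite exprMn; congr (_ * _); rewrite expr2 mulr_suml.
  by apply: eq_bigr => s _; rewrite mulr_sumr.
have iYY s t : good s -> good t -> intg P (fun w => Y s w * Y t w).
  by move=> gs gt; apply: L2_intgM; exact: LY.
rewrite ExZ; last by apply: intg_sum => s gs; apply: intg_sum => t gt; exact: iYY.
rewrite Ex_sum; last by move=> s gs; apply: intg_sum => t gt; exact: iYY.
pose k2 := MT ^+ 2 * b%:R * (2 * CT * MT * rho ^+ b).
have k20 : 0 <= k2 by rewrite /k2 !mulr_ge0// exprn_ge0// ltW.
(* The indicator is symmetric enough to serve both orders of s and t, and holds at fewer than 4b
   indices t. *)
have pair s t : good s -> good t -> Ex P (fun w => Y s w * Y t w) <=
    2 * (MT ^+ 2 * b%:R) ^+ 2 * (s.+1 - 2 * b <= t < s + 2 * b)%N%:R + k2.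
  move=> gs gt; rewrite cov_centered; [|exact: LZ|exact: LZ].
  apply: (le_trans (ler_norm _)).
  have [st|/ltnW ts] := leqP s t.
    apply: (le_trans (Zf_cov st (hac _ gt))); rewrite lerD2r ler_wpM2l ?mulr_ge0//.
    by rewrite ler_nat (_ : (s.+1 - 2 * b <= t)%N)//; move: b0 st; clear; lia.
  rewrite covC; apply: (le_trans (Zf_cov ts (hac _ gs))); rewrite lerD2r ler_wpM2l ?mulr_ge0//.
  rewrite ler_nat leq_subLR addnC; case: ltnP => // h.
  by rewrite (_ : (t < s + 2 * b)%N)//; move: b0 ts; clear; lia.
have can : (c - a <= n)%N.
  have [ca|ac] := leqP c a; first by move: ca; clear; lia.
  have := hac c.-1; move: b0 ac; clear; lia.
have inner s : good s -> \sum_(t <- I | good t) Ex P (fun w => Y s w * Y t w) <=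
    2 * (MT ^+ 2 * b%:R) ^+ 2 * (4 * b)%:R + n%:R * k2.
  move=> gs.
  apply: (@le_trans _ _ (\sum_(t <- I | good t) (2 * (MT ^+ 2 * b%:R) ^+ 2 * (s.+1 - 2 * b <= t < s + 2 * b)%:R + k2))).
    by apply: ler_sum => t gt; exact: pair.
  rewrite big_split/= -mulr_sumr lerD//.
    rewrite ler_wpM2l ?mulr_ge0// -SE -natr_sum ler_nat.
    by apply: leq_trans (sum_interval _ _ _ _) _; clear; lia.
  rewrite -SE big_const_nat iter_addr_0 -[leLHS]mulr_natl ler_wpM2r// ler_nat//.
have outer : \sum_(s <- I | good s) \sum_(t <- I | good t) Ex P (fun w => Y s w * Y t w) <=
    n%:R * (2 * (MT ^+ 2 * b%:R) ^+ 2 * (4 * b)%:R + n%:R * k2).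
  apply: (@le_trans _ _ (\sum_(s <- I | good s) (2 * (MT ^+ 2 * b%:R) ^+ 2 * (4 * b)%:R + n%:R * k2))).
    by apply: ler_sum => s gs; exact: inner.
  rewrite -SE big_const_nat iter_addr_0 -[leLHS]mulr_natl ler_wpM2r ?ler_nat//.
  apply: addr_ge0; last exact: mulr_ge0.
  by apply: mulr_ge0 => //; apply: mulr_ge0 => //; exact: sqr_ge0.
have -> : \sum_(s <- I | good s) Ex P (fun w => \sum_(t <- I | good t) Y s w * Y t w) =
  \sum_(s <- I | good s) \sum_(t <- I | good t) Ex P (fun w => Y s w * Y t w).
  by apply: eq_bigr => s gs; rewrite Ex_sum// => t gt; exact: iYY.
apply: (le_trans (ler_wpM2l (sqr_ge0 _) outer)).
rewrite /K1 /K2 /k2 natrM le_eqVlt; apply/orP; left; apply/eqP; field.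
by rewrite pnatr_eq0 -lt0n.
Qed.

End Blocks.

(** * Averages of covariances, Riemann sums, gaps between kernels *)

Section BlockAverage.
Context {R : realType}.
Variables (kap rho : R).
Hypotheses (kap0 : 0 <= kap) (rho01 : 0 < rho < 1).

Lemma sqrt_rho01 : 0 < Num.sqrt rho < 1.
Proof.
case/andP: rho01 => r0 r1; rewrite sqrtr_gt0 r0/= -sqrtr1 ltr_sqrt//.
Qed.

Definition avg_cst1 : R := Num.sqrt (2 * kap) * (2 / (1 - Num.sqrt rho)).
Definition avg_cst2 : R := 2 * (kap / (1 - rho) / (1 - rho)).

Lemma avg_cst1_ge0 : 0 <= avg_cst1.
Proof.
have /andP[_ s1] := sqrt_rho01.
by rewrite /avg_cst1 mulr_ge0 ?sqrtr_ge0// divr_ge0// subr_ge0 ltW.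
Qed.

Lemma avg_cst2_ge0 : 0 <= avg_cst2.
Proof.
case/andP: rho01 => r0 r1.
by rewrite /avg_cst2 mulr_ge0// !divr_ge0// subr_ge0 ltW.
Qed.

(* The bound min(x, y) <= sqrt (x y) replaces a truncation of the lags. *)
Lemma block_avg (gam : nat -> nat -> R) (a : int -> R) (S th : R) (b : nat) : (0 < b)%N -> 0 <= th ->
  (forall i j, (1 <= i < b.+1)%N -> (1 <= j < b.+1)%N -> `|gam i j| <= kap * rho ^+ absz (i%:Z - j%:Z)) ->
  (forall h, `|a h| <= kap * rho ^+ absz h) ->
  (forall i j, (1 <= i < b.+1)%N -> (1 <= j < b.+1)%N -> `|gam i j - a (j%:Z - i%:Z)| <= th) ->
  (forall A B : nat, `|S - \sum_(0 <= i < A + B.+1) a (i%:Z - A%:Z)| <= kap / (1 - rho) * (rho ^+ A + rho ^+ B)) ->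
  `|b%:R^-1 * (\sum_(1 <= i < b.+1) \sum_(1 <= j < b.+1) gam i j) - S| <=
  avg_cst1 * Num.sqrt th + avg_cst2 / b%:R.
Proof.
move=> b0 th0 hg ha hga hS; case/andP: (rho01) => r0 r1.
have bp : 0 < b%:R :> R by rewrite ltr0n.
(* Row i misses the lags below 1 - i and above b - i. The sum of these tails over i stays bounded,
   hence an error of order 1/b after division. *)
pose err i := kap / (1 - rho) * (rho ^+ i.-1 + rho ^+ (b - i)).
have key i : (1 <= i < b.+1)%N ->
    `|\sum_(1 <= j < b.+1) gam i j - S| <= avg_cst1 * Num.sqrt th + err i.
  move=> hi.
  have -> : \sum_(1 <= j < b.+1) gam i j - S =
     \sum_(1 <= j < b.+1) (gam i j - a (j%:Z - i%:Z)) - (S - \sum_(1 <= j < b.+1) a (j%:Z - i%:Z)).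
    by rewrite sumrB; ring.
  apply: (le_trans (ler_normB _ _)); apply: lerD; last first.
    have := hS i.-1 (b - i)%N; rewrite (_ : (i.-1 + (b - i).+1 = b)%N); last by move: hi; clear; lia.
    rewrite big_add1 /= /err (eq_bigr (fun j => a (j.+1%:Z - i%:Z)))// => j _.
    by congr a; move: hi; clear; lia.
  apply: (le_trans (ler_norm_sum _ _ _)).
  apply: (@le_trans _ _ (\sum_(1 <= j < b.+1) (Num.sqrt (2 * kap) * Num.sqrt th) * Num.sqrt rho ^+ absz (i%:Z - j%:Z))).
    rewrite !big_nat; apply: ler_sum => j hj.
    set x := `|_ - _|; have x0 : 0 <= x by exact: normr_ge0.
    have h1 : x <= th by exact: hga.
    have h2 : x <= 2 * kap * rho ^+ absz (i%:Z - j%:Z).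
      apply: (le_trans (ler_normB _ _)); rewrite -mulrA mulr_natl mulr2n; apply: lerD; first exact: hg.
      by apply: (le_trans (ha _)); rewrite -abszN opprB.
    have E : Num.sqrt rho ^+ absz (i%:Z - j%:Z) = Num.sqrt (rho ^+ absz (i%:Z - j%:Z)).
      elim: (absz _) => [|m IH]; first by rewrite !expr0 sqrtr1.
      by rewrite !exprS sqrtrM ?(ltW r0)// IH.
    rewrite E mulrAC -sqrtrM; last by rewrite mulr_ge0.
    rewrite -[leLHS](ger0_norm x0) -sqrtr_sqr -sqrtrM; last by rewrite !mulr_ge0 ?exprn_ge0 ?(ltW r0).
    rewrite ler_sqrt; last by rewrite !mulr_ge0 ?exprn_ge0 ?(ltW r0).
    by rewrite expr2; apply: ler_pM.
  have -> : avg_cst1 * Num.sqrt th = (Num.sqrt (2 * kap) * Num.sqrt th) * (2 / (1 - Num.sqrt rho)).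
    by rewrite /avg_cst1 mulrAC.
  rewrite -mulr_sumr ler_wpM2l ?mulr_ge0 ?sqrtr_ge0//.
  exact: sum_rho_absz sqrt_rho01.
have -> : b%:R^-1 * (\sum_(1 <= i < b.+1) \sum_(1 <= j < b.+1) gam i j) - S =
   b%:R^-1 * \sum_(1 <= i < b.+1) (\sum_(1 <= j < b.+1) gam i j - S).
  rewrite sumrB big_const_nat subSS subn0 iter_addr_0 -mulr_natl; field; exact: lt0r_neq0.
rewrite normrM ger0_norm ?invr_ge0 ?(ltW bp)// ler_pdivrMl//.
apply: (le_trans (ler_norm_sum _ _ _)).
apply: (@le_trans _ _ (\sum_(1 <= i < b.+1) (avg_cst1 * Num.sqrt th + err i))).
  by rewrite !big_nat; apply: ler_sum => i hi; exact: key.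
rewrite big_split/= big_const_nat subSS subn0 iter_addr_0 -[X in X + _ <= _]mulr_natl mulrDr lerD2l.
rewrite mulrC divfK ?gt_eqF// /err -mulr_sumr.
have -> : avg_cst2 = kap / (1 - rho) * (2 * (1 - rho)^-1) by rewrite /avg_cst2; ring.
apply: ler_wpM2l; first by rewrite divr_ge0// subr_ge0 ltW.
rewrite big_split/= mulr_natl mulr2n; apply: lerD.
  rewrite big_add1 /=; exact: geo_sum_le.
rewrite big_nat_rev big_add1 /=; apply: le_trans (geo_sum_le b rho01).
rewrite !big_nat; apply: ler_sum => i hi; rewrite (_ : (b - _ = i)%N)//; move: hi; clear; lia.
Qed.

End BlockAverage.

(** * Primitives of bounded functions and their Riemann sums *)

Section Primitive.
Context {R : realType}.
Variables (F : R -> R) (M : R).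
Hypothesis mF : measurable_fun (`[0%R, 1%R]%classic : set R) F.
Hypothesis FM : forall v, 0 <= v <= 1 -> `|F v| <= M.

Let leb := @lebesgue_measure R.
Definition prim (u : R) : R := \int[leb]_(v in `[0%R, u]) F v.

Let M0 : 0 <= M.
Proof. by apply: le_trans (FM (v := 0) _); rewrite ?normr_ge0// lexx ler01. Qed.

Lemma itv_finite_measure (i : interval R) : [set` i] `<=` `[0%R, 1%R]%classic -> (leb [set` i] < +oo)%E.
Proof.
move=> h; apply: (@le_lt_trans _ _ (leb `[0%R, 1%R]%classic)).
  by apply: le_measure => //; rewrite inE; exact: measurable_itv.
rewrite /leb lebesgue_measure_itv /= lte01 -EFinB; exact: ltry.
Qed.

Lemma itv_intg (i : interval R) : [set` i] `<=` `[0%R, 1%R]%classic ->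
  leb.-integrable [set` i] (EFin \o F).
Proof.
move=> h; apply: measurable_bounded_integrable => //.
- exact: itv_finite_measure.
- exact: measurable_funS mF.
- exists M; split; first exact: num_real.
  move=> x Mx v /= iv; apply: le_trans (FM _) (ltW Mx).
  by have /= := h v iv; rewrite in_itv.
Qed.

Lemma sub_itv01 (u : R) : u <= 1 -> [set` `[0%R, u]] `<=` `[0%R, 1%R]%classic.
Proof.
move=> u1 v /=; rewrite !in_itv/= => /andP[-> vu]; exact: le_trans u1.
Qed.

Lemma prim_EFin u : u <= 1 -> (\int[leb]_(v in `[0%R, u]) (F v)%:E)%E = (prim u)%:E.
Proof.
move=> u1; rewrite /prim /Rintegral fineK//.
by apply: integrable_fin_num => //; exact: itv_intg (sub_itv01 u1).
Qed.

Lemma prim_cell (x y c B : R) : 0 <= x -> x <= y -> y <= 1 ->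
  (forall v, x <= v <= y -> `|F v - c| <= B) ->
  `|prim y - prim x - (y - x) * c| <= (y - x) * B.
Proof.
move=> x0 xy y1 h.
have sub : [set` `]x, y]] `<=` `[0%R, 1%R]%classic.
  move=> v /=; rewrite !in_itv/= => /andP[xv vy].
  by rewrite (le_trans x0 (ltW xv)) (le_trans vy).
have E : prim y - prim x = \int[leb]_(v in `]x, y]) F v.
  rewrite /prim Rintegral_itvB//.
  exact: itv_intg (sub_itv01 y1).
have me : measurable ([set` `]x, y]] : set (measurableTypeR R)) by exact: measurable_itv.
have ic (r : R) : leb.-integrable [set` `]x, y]] (EFin \o (fun=> r)).
  apply: measurable_bounded_integrable => //; first exact: itv_finite_measure.
  by exists `|r|; split; [exact: num_real|move=> z /ltW rz v _].
have mu : fine (leb [set` `]x, y]]) = y - x.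
  rewrite /leb lebesgue_measure_itv /= lte_fin; case: ltP => // yx.
  by rewrite (le_anti (introT andP (conj yx xy))) subrr.
have -> : (y - x) * c = \int[leb]_(v in `]x, y]) c by rewrite Rintegral_cst// mu mulrC.
have -> : (y - x) * B = \int[leb]_(v in `]x, y]) B by rewrite Rintegral_cst// mu mulrC.
rewrite E -RintegralB//; last exact: itv_intg.
have iB : leb.-integrable [set` `]x, y]] (EFin \o (fun v => F v - c)).
  have := integrableB me (itv_intg sub) (ic c); apply: eq_integrable => //.
apply: (le_trans (le_normr_Rintegral me iB)).
apply: le_Rintegral => //.
  by have := integrable_norm iB; apply: eq_integrable => // v _.
by move=> v /=; rewrite in_itv/= => /andP[xv vy]; apply: h; rewrite ltW.
Qed.

Lemma prim_lip (x y : R) : 0 <= x -> x <= y -> y <= 1 -> `|prim y - prim x| <= (y - x) * M.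
Proof.
move=> x0 xy y1; have := @prim_cell x y 0 M x0 xy y1; rewrite mulr0 subr0; apply.
move=> v /andP[xv vy]; rewrite subr0; apply: FM.
by rewrite (le_trans x0 xv) (le_trans vy).
Qed.

Lemma prim0 : prim 0 = 0.
Proof. by rewrite /prim set_itv1 Rintegral_set1. Qed.

(** The increment of the primitive telescopes over cells of length 1/n, and on each cell F is within
    B t of the constant c t. *)
Lemma riemann (c B : nat -> R) n a m : (0 < n)%N -> (a <= m)%N -> (m <= n)%N ->
  (forall t v, (a <= t < m)%N -> t%:R / n%:R <= v <= t.+1%:R / n%:R -> `|F v - c t| <= B t) ->
  `|n%:R^-1 * (\sum_(a <= t < m) c t) - (prim (m%:R / n%:R) - prim (a%:R / n%:R))| <=
  n%:R^-1 * \sum_(a <= t < m) B t.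
Proof.
move=> n0 am mn h.
rewrite -(telescope_sumr (fun t => prim (t%:R / n%:R)) am) mulr_sumr -sumrB mulr_sumr.
apply: (le_trans (ler_norm_sum _ _ _)); rewrite !big_nat; apply: ler_sum => t /andP[at_ tm].
have E : t.+1%:R / n%:R - t%:R / n%:R = n%:R^-1 :> R by rewrite -mulrBl -natrB// subSnn mul1r.
rewrite distrC /= -[X in `|_ - X * _|]E -[X in _ <= X * _]E; apply: prim_cell.
- by rewrite divr_ge0.
- exact: frac_le.
- have /andP[_ ->] // := @frac01 R n t.+1 (leq_trans tm mn).
- by move=> v; apply: h; rewrite at_ tm.
Qed.

End Primitive.

(** * Gaps between two kernels at an arbitrary time *)

Section Bias.
Context {R : realType} {d0 : measure_display} {Omega : measurableType d0}.
Variable P : probability Omega R.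
Variables eps epss : int -> Omega -> R.
Let xi := fun ib : bool * int => if ib.1 then epss ib.2 else eps ib.2.
Hypothesis meps : forall i, measurable_fun setT (eps i).
Hypothesis mepss : forall i, measurable_fun setT (epss i).
Hypothesis indep : mutual_indep P xi.
Hypothesis ident : ident_distr P xi.
Context {d : nat}.
Variables (q C rho : R).
Hypotheses (q4 : 4 < q) (C0 : 0 <= C) (rho01 : 0 < rho < 1).

Let mx0 : measurable_fun setT (x0 eps) := meas_x0 meps mepss.

Lemma L4_shift (Psi : paths int -> R) (t : int) : measurable_fun setT Psi ->
  L4 P (fun w => Psi (x0 eps w)) ->
  L4 P (fun w => Psi (fun i => eps (t + i) w)) /\
  N4 P (fun w => Psi (fun i => eps (t + i) w)) = N4 P (fun w => Psi (x0 eps w)).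
Proof.
move=> mPsi L.
have i4 : intg P (fun w => (Psi (x0 eps w) ^+ 2) ^+ 2) by exact: (L4_sqr L).2.
have m4 : measurable_fun setT (fun x => (Psi x ^+ 2) ^+ 2) by do 2! apply: measX.
have [i e] := shift_Ex meps mepss indep ident t m4 i4.
split; last by rewrite /N4 /N2 e.
have mt : measurable_fun setT (fun w => Psi (fun i => eps (t + i) w)).
  apply: measurableT_comp mPsi _; apply: meas_paths => j; exact: meps.
by split => //; move: i; congr intg; apply/funext => w; rewrite -exprM.
Qed.

Lemma kernel_gap (K K' : R -> (nat -> R) -> 'rV[R]_d) u u' c t k :
  kernel_measurable K -> kernel_measurable K' -> 0 <= c ->
  (LqN P q (fun w => (K u (epsseq eps 0 w) - K' u' (epsseq eps 0 w))%R) <= c%:E)%E ->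
  L4 P (fun w => K u (epsseq eps t w) 0 k - K' u' (epsseq eps t w) 0 k) /\
  N4 P (fun w => K u (epsseq eps t w) 0 k - K' u' (epsseq eps t w) 0 k) <= 2 * c.
Proof.
move=> mK mK' c0 hc.
pose Psi x := kf K u 0 k x - kf K' u' 0 k x.
have mPsi : measurable_fun setT Psi by apply: measurable_funB; exact: meas_kf.
have [|L0 n0] := @LqN_N4 _ _ _ P d q _ c k q4 c0 _ hc.
  move=> i; rewrite (_ : (fun w => _) = (fun w => kf K u 0 i (x0 eps w) - kf K' u' 0 i (x0 eps w))).
    by apply: measurable_funB; apply: measurableT_comp => //; exact: meas_kf.
  by apply/funext => w; rewrite !mxE.
have E0 : (fun w => (K u (epsseq eps 0 w) - K' u' (epsseq eps 0 w)) 0 k) = (fun w => Psi (x0 eps w)).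
  by apply/funext => w; rewrite !mxE.
rewrite E0 in L0 n0; have [L n] := L4_shift t mPsi L0.
have E : (fun w => K u (epsseq eps t w) 0 k - K' u' (epsseq eps t w) 0 k) = (fun w => Psi (fun i => eps (t + i) w)).
  apply/funext => w; rewrite /Psi /kf; congr (K u _ 0 k - K' u' _ 0 k); apply/funext => m.
    by rewrite /epsseq; congr eps; ring.
  by rewrite /epsseq; congr eps; ring.
by rewrite E n.
Qed.

End Bias.

(** * Rates *)

Section Rates.
Context {R : realType}.
Implicit Types u v : nat -> R.

Lemma cvg0_le u v : v n @[n --> \oo] --> 0 -> (\forall n \near \oo, 0 <= u n <= v n) ->
  u n @[n --> \oo] --> 0.
Proof. by move=> hv h; apply: (squeeze_cvgr h) => //; exact: cvg_cst. Qed.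

Lemma cvg0_lt1 u : u n @[n --> \oo] --> 0 -> \forall n \near \oo, u n <= 1.
Proof.
move=> h; have : \forall n \near \oo, `|u n| < 1 by apply: cvgr0_norm_lt.
apply: filterS => n /ltW; apply: le_trans; exact: ler_norm.
Qed.

Lemma cvg0M (c : R) u : u n @[n --> \oo] --> 0 -> (c * u n) @[n --> \oo] --> 0.
Proof. by move=> h; rewrite -(mulr0 c); apply: cvgM h; exact: cvg_cst. Qed.

Lemma cvg0D u v : u n @[n --> \oo] --> 0 -> v n @[n --> \oo] --> 0 -> (u n + v n) @[n --> \oo] --> 0.
Proof. by move=> hu hv; rewrite -(addr0 0); exact: cvgD. Qed.

Lemma cvg0_sqrt u : u n @[n --> \oo] --> 0 -> Num.sqrt (u n) @[n --> \oo] --> 0.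
Proof. by move=> h; rewrite -sqrtr0; apply: continuous_cvg h; exact: sqrt_continuous. Qed.

Lemma cvg0_inv_pow (c : R) : 0 < c -> ((n%:R : R) `^ (- c)) @[n --> \oo] --> 0.
Proof.
move=> c0; apply/cvgr0Pnorm_lt => e e0.
have : \forall n \near \oo, e^-1 `^ c^-1 < n%:R :> R by exact: nbhs_infty_gtr.
apply: filterS => n hn; have n0 : 0 < n%:R :> R by apply: le_lt_trans hn; exact: powR_ge0.
rewrite ger0_norm ?powR_ge0// powRN invf_plt ?posrE ?powR_gt0//.
rewrite -[ltLHS](_ : (e^-1 `^ c^-1) `^ c = _).
  by apply: gt0_ltr_powR; rewrite ?nnegrE ?powR_ge0 ?(ltW n0).
by rewrite -powRrM mulVf ?gt_eqF// powRr1// invr_ge0 ltW.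
Qed.

Lemma near_infty_pos : \forall n \near \oo, (0 < n)%N.
Proof. exact: nbhs_infty_gt. Qed.

Variables (tau L b : nat -> nat) (p kappa q rho : R).
Hypotheses (p1 : 1 <= p) (kappa0 : 0 < kappa) (q4 : 4 < q) (rho01 : 0 < rho < 1).
Hypothesis L_infty : (fun n => (L n)%:R : R) @ \oo --> (+oo : set_system R).
Hypothesis tau_n : (fun n => (tau n)%:R / n%:R : R) @ \oo --> 0.
Hypothesis L_n : (fun n => (L n)%:R / n%:R `^ ((2 * p)^-1) : R) @ \oo --> 0.
Hypothesis b_infty : (fun n => (b n)%:R : R) @ \oo --> (+oo : set_system R).
Hypothesis b_n : (fun n => (b n)%:R / n%:R `^ (2 / (3 * Num.max p 2)) : R) @ \oo --> 0.
Hypothesis b_k : (fun n => (b n)%:R / n%:R `^ ((kappa * q - 2) / (q + 2)) : R) @ \oo --> 0.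
Let p' := Num.max p 2.
Let p'2 : 2 <= p'. Proof. by rewrite /p' le_max lexx orbT. Qed.
Let p'0 : 0 < p'. Proof. by apply: lt_le_trans p'2. Qed.

Lemma pow_le (n : nat) (x y : R) : (0 < n)%N -> x <= y -> n%:R `^ x <= n%:R `^ y.
Proof. by move=> n0 xy; apply: ler_powR => //; rewrite ler1n. Qed.

Lemma b_pos : \forall n \near \oo, (0 < b n)%N.
Proof.
have /cvgryPgt /(_ 0) := b_infty; apply: filterS => n; by rewrite ltr0n.
Qed.

(** The cube of the rate hypothesis gives b^3 = o(n^(2/p')), and 2/p' <= 1. *)
Lemma cvg_b3 : ((b n)%:R ^+ 3 / n%:R) @[n --> \oo] --> (0 : R).
Proof.
pose v n := (b n)%:R / n%:R `^ (2 / (3 * p')) : R.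
have hv : (v n * v n * v n) @[n --> \oo] --> 0.
  by rewrite -(mulr0 (0 * 0)); apply: cvgM; [apply: cvgM|].
apply: (cvg0_le hv); near=> n.
have n0 : (0 < n)%N by near: n; exact: near_infty_pos.
have np : 0 < n%:R :> R by rewrite ltr0n.
rewrite divr_ge0 ?exprn_ge0//=; rewrite /v.
set w := _ `^ _; have w0 : 0 < w by rewrite powR_gt0.
have -> : (b n)%:R / w * ((b n)%:R / w) * ((b n)%:R / w) = (b n)%:R ^+ 3 / w ^+ 3.
  by field; exact: lt0r_neq0.
rewrite ler_wpM2l ?exprn_ge0// lef_pV2 ?posrE ?exprn_gt0// /w -powR_mulrn ?powR_ge0// -powRrM.
rewrite -[leRHS]powRr1//; apply: pow_le => //.
have -> : 2 / (3 * p') * 3 = 2 / p' by field; exact: lt0r_neq0.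
by rewrite ler_pdivrMr// mul1r.
Unshelve. all: by end_near.
Qed.

Lemma cvg_b1 : ((b n)%:R / n%:R) @[n --> \oo] --> (0 : R).
Proof.
apply: (cvg0_le cvg_b3); near=> n.
rewrite divr_ge0//= ler_wpM2r ?invr_ge0//; have [->|b0] := posnP (b n); first by rewrite expr0n.
by rewrite exprS ler_peMr// exprn_ege1// ler1n.
Unshelve. all: by end_near.
Qed.

Lemma cvg_L1 : ((L n)%:R / n%:R) @[n --> \oo] --> (0 : R).
Proof.
apply: (cvg0_le L_n); near=> n.
have n0 : (0 < n)%N by near: n; exact: near_infty_pos.
have np : 0 < n%:R :> R by rewrite ltr0n.
rewrite divr_ge0//= ler_wpM2l// lef_pV2 ?posrE ?powR_gt0// -[leRHS]powRr1//.
by apply: pow_le => //; rewrite invf_le1; move: p1; lra.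
Unshelve. all: by end_near.
Qed.

Lemma cvg_abn : ((tau n + L n + b n)%N%:R / n%:R) @[n --> \oo] --> (0 : R).
Proof.
under eq_cvg do rewrite !natrD !mulrDl.
by apply: cvg0D; [apply: cvg0D|] => //; [exact: cvg_L1|exact: cvg_b1].
Qed.

Lemma cvg_rho (u : nat -> nat) : (fun n => (u n)%:R : R) @ \oo --> (+oo : set_system R) ->
  rho ^+ (u n) @[n --> \oo] --> 0.
Proof.
move=> /cvgrnyP hu; case/andP: rho01 => r0 r1.
have h : rho ^+ n @[n --> \oo] --> 0 by apply: cvg_expr; rewrite ger0_norm// ltW.
exact: cvg_comp hu h.
Qed.

Lemma cvg_rhoL : rho ^+ (L n) @[n --> \oo] --> 0. Proof. exact: cvg_rho. Qed.

(** With rho = r^2, n r^n is below a geometric sum in r, hence bounded, and a factor r^n is left. *)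
Lemma cvg_brho : ((b n)%:R * rho ^+ (b n)) @[n --> \oo] --> 0.
Proof.
case/andP: (rho01) => r0 r1; pose r := Num.sqrt rho.
have r01 : 0 < r < 1 by rewrite /r sqrtr_gt0 r0/= -sqrtr1 ltr_sqrt.
have rr : rho = r * r by rewrite -expr2 sqr_sqrtr// ltW.
case/andP: (r01) => s0 s1.
have h : (n%:R * rho ^+ n : R) @[n --> \oo] --> 0.
  have g : ((1 - r)^-1 * r ^+ n) @[n --> \oo] --> 0.
    by apply: cvg0M; apply: cvg_expr; rewrite ger0_norm// ltW.
  apply: (cvg0_le g); near=> n.
  rewrite mulr_ge0 ?exprn_ge0 ?(ltW r0)//= rr exprMn mulrA ler_wpM2r ?exprn_ge0 ?(ltW s0)//.
  apply: le_trans (geo_sum_le n r01).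
  rewrite mulr_natl -[leLHS]iter_addr_0 -[X in iter X](subn0 n) -big_const_nat !big_nat.
  by apply: ler_sum => i /andP[_ /ltnW ni]; apply: ler_wiXn2l; rewrite ?ltW.
have /cvgrnyP hb := b_infty; exact: cvg_comp hb h.
Unshelve. all: by end_near.
Qed.

(** L and b are eventually at most n^(1/2), so the power of (L+b)/n is at most 2 n^(-1/p'), itself
    below 2 n^(-2/(3p')), the rate that the hypothesis compares with b. *)
Lemma cvg_win : ((b n)%:R * ((L n + b n)%N%:R / n%:R) `^ (2 / p')) @[n --> \oo] --> (0 : R).
Proof.
apply: (cvg0_le (cvg0M 2 b_n)); near=> n.
have n0 : (0 < n)%N by near: n; exact: near_infty_pos.
have np : 0 < n%:R :> R by rewrite ltr0n.
rewrite mulr_ge0 ?powR_ge0//= mulrCA ler_wpM2l//.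
have hL : (L n)%:R <= n%:R `^ 2^-1 :> R.
  have : (L n)%:R / n%:R `^ ((2 * p)^-1) <= 1 :> R by near: n; exact: cvg0_lt1.
  rewrite ler_pdivrMr ?powR_gt0// mul1r => /le_trans; apply; apply: pow_le => //.
  by rewrite lef_pV2 ?posrE; move: p1; lra.
have hb : (b n)%:R <= n%:R `^ 2^-1 :> R.
  have : (b n)%:R / n%:R `^ (2 / (3 * p')) <= 1 :> R by near: n; exact: cvg0_lt1.
  rewrite ler_pdivrMr ?powR_gt0// mul1r => /le_trans; apply; apply: pow_le => //.
  rewrite ler_pdivrMr ?mulr_gt0//; move: p'2; lra.
have h1 : (L n + b n)%N%:R / n%:R <= 2 * n%:R `^ (- 2^-1) :> R.
  rewrite ler_pdivrMr// -mulrA -[X in _ * (_ * X)]powRr1// -powRD; last by rewrite (gt_eqF np) implybT.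
  have -> : - 2^-1 + 1 = 2^-1 :> R by field.
  by rewrite natrD mulr_natl mulr2n lerD.
apply: (@le_trans _ _ ((2 * n%:R `^ (- 2^-1)) `^ (2 / p'))).
  by apply: ge0_ler_powR => //; rewrite ?nnegrE ?divr_ge0 ?mulr_ge0 ?powR_ge0 ?(ltW p'0).
rewrite powRM ?powR_ge0//; apply: ler_pM; rewrite ?powR_ge0//.
  rewrite -[leRHS]powRr1//; apply: ler_powR; first by rewrite ler1n.
  by rewrite ler_pdivrMr// mul1r.
rewrite -powRrM -powRN; apply: pow_le => //.
have -> : - 2^-1 * (2 / p') = - p'^-1 by field; exact: lt0r_neq0.
have -> : 2 / (3 * p') = 2 / 3 * p'^-1 by field; exact: lt0r_neq0.
have : 0 < p'^-1 by rewrite invr_gt0.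
lra.
Unshelve. all: by end_near.
Qed.

Lemma cvg_win0 : (((L n + b n)%N%:R / n%:R) `^ (2 / p')) @[n --> \oo] --> (0 : R).
Proof.
apply: (cvg0_le cvg_win); near=> n.
have b0 : (0 < b n)%N by near: n; exact: b_pos.
by rewrite powR_ge0/= ler_peMl ?powR_ge0// ler1n.
Unshelve. all: by end_near.
Qed.

(** The exponent (kappa q - 2)/(q + 2) is at most kappa. *)
Lemma cvg_bk : ((b n)%:R * n%:R `^ (- kappa)) @[n --> \oo] --> (0 : R).
Proof.
apply: (cvg0_le b_k); near=> n.
have n0 : (0 < n)%N by near: n; exact: near_infty_pos.
rewrite mulr_ge0 ?powR_ge0//= ler_wpM2l// -powRN; apply: pow_le => //.
rewrite lerN2 ler_pdivrMr; last by move: q4; lra.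
by move: kappa0; lra.
Unshelve. all: by end_near.
Qed.

End Rates.

(** * Elementary inequalities for averages and squares *)

Lemma sum_ord_cst (R : realType) (d : nat) (c : R) : \sum_(k < d) c = d%:R * c.
Proof. by rewrite sumr_const card_ord mulr_natl. Qed.

Lemma dist_chain (R : realDomainType) (A y z Y c k1 k2 k3 : R) : `|A - (y - z)| <= c ->
  `|Y - y| <= k1 -> `|z| <= k2 -> k1 <= k3 -> `|A - Y| <= c + (k2 + k3).
Proof. by rewrite !ler_norml; lra. Qed.

(** The square root lies below its tangent at s^2, which is s/2 + x/(2s); averaging with s near sqrt
    X gives Jensen's inequality, also when fewer than n terms are divided by n. *)
Lemma jensen_sqrt (R : realType) (x : nat -> R) (a c n : nat) (X : R) : (0 < n)%N -> (c - a <= n)%N ->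
  (forall t, 0 <= x t) -> n%:R^-1 * (\sum_(a <= t < c) x t) <= X ->
  n%:R^-1 * \sum_(a <= t < c) Num.sqrt (x t) <= Num.sqrt X.
Proof.
move=> n0 can x0 hX; have np : 0 < n%:R :> R by rewrite ltr0n.
have X0 : 0 <= X.
  by apply: le_trans hX; rewrite mulr_ge0 ?invr_ge0//; apply: sumr_ge0.
apply/ler_addgt0Pr => e e0.
(* Slightly more than sqrt X, because X may vanish and s is a divisor. *)
have [s [s0 Xs sle]] : exists s : R, [/\ 0 < s, X <= s ^+ 2 & s <= Num.sqrt X + e].
  exists (Num.sqrt X + e); split => //; first by rewrite ltr_wpDl// sqrtr_ge0.
  by rewrite -[leLHS](sqr_sqrtr X0) lerXn2r ?nnegrE ?addr_ge0 ?sqrtr_ge0 ?(ltW e0)// lerDl ltW.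
apply: le_trans sle.
have h t : Num.sqrt (x t) <= 2^-1 * s + (2 * s)^-1 * x t.
  have := sqr_ge0 (Num.sqrt (x t) - s); rewrite sqrrB sqr_sqrtr// => h.
  rewrite -(ler_pM2l (_ : 0 < 2 * s)); last by rewrite mulr_gt0.
  rewrite mulrDr (mulrA _ _ (x t)) mulfV ?mul1r; last by rewrite gt_eqF// mulr_gt0.
  move: h; lra.
apply: (@le_trans _ _ (n%:R^-1 * \sum_(a <= t < c) (2^-1 * s + (2 * s)^-1 * x t))).
  by rewrite ler_wpM2l ?invr_ge0//; apply: ler_sum.
rewrite big_split/= big_const_nat iter_addr_0 -[X in _ * (X + _)]mulr_natl -mulr_sumr mulrDr.
have h1 : n%:R^-1 * ((c - a)%:R * (2^-1 * s)) <= 2^-1 * s.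
  by rewrite mulrA ler_piMl ?mulr_ge0 ?(ltW s0)// mulrC ler_pdivrMr// mul1r ler_nat.
have h2 : n%:R^-1 * ((2 * s)^-1 * \sum_(a <= t < c) x t) <= 2^-1 * s.
  rewrite mulrCA; apply: (@le_trans _ _ ((2 * s)^-1 * s ^+ 2)).
    by rewrite ler_wpM2l ?invr_ge0 ?mulr_ge0 ?(ltW s0)//; exact: le_trans Xs.
  by rewrite le_eqVlt; apply/orP; left; apply/eqP; field; exact: lt0r_neq0.
by apply: (le_trans (lerD h1 h2)); lra.
Qed.

Lemma sqr_sum_le (R : realType) (I : Type) (r : seq I) (x : I -> R) :
  (\sum_(i <- r) x i) ^+ 2 <= (size r)%:R * \sum_(i <- r) x i ^+ 2.
Proof.
rewrite expr2 mulr_suml.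
apply: (@le_trans _ _ (\sum_(i <- r) \sum_(j <- r) (2^-1 * x i ^+ 2 + 2^-1 * x j ^+ 2))).
  apply: ler_sum => i _; rewrite mulr_sumr; apply: ler_sum => j _.
  by have := sqr_ge0 (x i - x j); rewrite sqrrB; lra.
under eq_bigr do rewrite big_split/= big_const_seq count_predT iter_addr_0 -[_ *+ size r]mulr_natl -mulr_sumr.
rewrite big_split/= -!mulr_sumr big_const_seq count_predT iter_addr_0 -[_ *+ size r]mulr_natl.
set S := \sum_(i <- r) _; set m := _%:R; by rewrite le_eqVlt; apply/orP; left; apply/eqP; field.
Qed.

Lemma sum_lin (R : realType) (r : seq nat) (a1 a2 a3 a4 : nat -> R) (x y z e : R) :
  \sum_(t <- r) (x * (y * a1 t + z * (a2 t + a3 t)) + e * a4 t) =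
  x * (y * (\sum_(t <- r) a1 t) + z * (\sum_(t <- r) a2 t + \sum_(t <- r) a3 t)) + e * \sum_(t <- r) a4 t.
Proof. by rewrite big_split/= -!mulr_sumr big_split/= -!mulr_sumr big_split. Qed.

Lemma sqr_sum_ord (R : realType) (d : nat) (x : 'I_d -> R) :
  (\sum_k x k) ^+ 2 <= d%:R * \sum_k x k ^+ 2.
Proof. by have := sqr_sum_le (enum 'I_d) x; rewrite size_enum_ord !big_enum. Qed.

(* With U = A - B one has |A^2 - B^2| <= U^2 + 2 |U| |B| <= (1 + 1/e) U^2 + e B^2, and U collects
   the error of the estimated gradient, paired with the block sums, and that of the centering. *)
Lemma summand_diff (R : realType) (d : nat) (Gd g S D E : 'I_d -> R) (b Cf e : R) : 0 < b -> 0 < e -> 0 <= Cf ->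
  (forall k, `|Gd k| <= Cf) -> (forall k, `|g k| <= Cf) ->
  `|b^-1 * (\sum_k Gd k * (S k + D k - b * E k)) ^+ 2 - b^-1 * (\sum_k g k * S k) ^+ 2| <=
  (1 + e^-1) * (4 * d%:R * Cf * (\sum_k Num.min (2 * Cf) `|Gd k - g k| * (b^-1 * S k ^+ 2)) +
     4 * d%:R * Cf ^+ 2 * \sum_k (b^-1 * D k ^+ 2 + b * E k ^+ 2)) +
  e * (b^-1 * (\sum_k g k * S k) ^+ 2).
Proof.
move=> b0 e0 Cf0 hG hg.
pose A := \sum_k Gd k * (S k + D k - b * E k); pose B := \sum_k g k * S k.
pose U1 := \sum_k (Gd k - g k) * S k; pose U2 := \sum_k Gd k * (D k - b * E k).
have EA : A = B + (U1 + U2).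
  by rewrite /A /B /U1 /U2 -!big_split; apply: eq_bigr => k _ /=; ring.
have hW k : `|Gd k - g k| <= 2 * Cf.
  by apply: (le_trans (ler_normB _ _)); rewrite mulr_natl mulr2n lerD.
pose W k := Num.min (2 * Cf) `|Gd k - g k|.
have WE k : W k = `|Gd k - g k| by rewrite /W min_r.
(* One of the two factors [|Gd k - g k|] is spent on the bound 2 Cf, so that the gradient error
   enters linearly, through its first moment. *)
have h1 : U1 ^+ 2 <= 2 * d%:R * Cf * \sum_k W k * S k ^+ 2.
  apply: (le_trans (sqr_sum_ord _)).
  rewrite (_ : 2 * d%:R * Cf = d%:R * (2 * Cf)); last by ring.
  rewrite -mulrA ler_wpM2l// mulr_sumr; apply: ler_sum => k _.
  rewrite exprMn [leRHS]mulrA; apply: ler_wpM2r; first exact: sqr_ge0.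
  by rewrite -[leLHS]real_normK ?num_real// WE expr2; apply: ler_wpM2r.
have h2 : U2 ^+ 2 <= 2 * d%:R * Cf ^+ 2 * \sum_k (D k ^+ 2 + b ^+ 2 * E k ^+ 2).
  apply: (le_trans (sqr_sum_ord _)).
  rewrite (_ : 2 * d%:R * Cf ^+ 2 = d%:R * (2 * Cf ^+ 2)); last by ring.
  rewrite -mulrA ler_wpM2l// mulr_sumr; apply: ler_sum => k _.
  have a1 : Gd k ^+ 2 <= Cf ^+ 2 by rewrite -[leLHS]real_normK ?num_real// lerXn2r ?nnegrE.
  have a2 : (D k - b * E k) ^+ 2 <= 2 * (D k ^+ 2 + b ^+ 2 * E k ^+ 2).
    by have := sqr_ge0 (D k + b * E k); rewrite sqrrD sqrrB exprMn; lra.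
  rewrite exprMn; apply: (le_trans (ler_pM (sqr_ge0 _) (sqr_ge0 _) a1 a2)).
  by rewrite le_eqVlt; apply/orP; left; apply/eqP; ring.
have hU : (U1 + U2) ^+ 2 <= 2 * U1 ^+ 2 + 2 * U2 ^+ 2.
  by have := sqr_ge0 (U1 - U2); rewrite sqrrB sqrrD; lra.
have key : `|A ^+ 2 - B ^+ 2| <= (1 + e^-1) * (U1 + U2) ^+ 2 + e * B ^+ 2.
  rewrite EA; set U := U1 + U2.
  have -> : (B + U) ^+ 2 - B ^+ 2 = U ^+ 2 + 2 * (U * B) by ring.
  have y1 : 0 <= e^-1 * (U + e * B) ^+ 2 by rewrite mulr_ge0 ?sqr_ge0// invr_ge0 ltW.
  have y2 : 0 <= e^-1 * (U - e * B) ^+ 2 by rewrite mulr_ge0 ?sqr_ge0// invr_ge0 ltW.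
  have e1 : e^-1 * (U + e * B) ^+ 2 = e^-1 * U ^+ 2 + 2 * (U * B) + e * B ^+ 2 by field; exact: lt0r_neq0.
  have e2 : e^-1 * (U - e * B) ^+ 2 = e^-1 * U ^+ 2 - 2 * (U * B) + e * B ^+ 2 by field; exact: lt0r_neq0.
  rewrite e1 in y1; rewrite e2 in y2; have u0 := sqr_ge0 U.
  rewrite ler_norml mulrDl mul1r; apply/andP; split; move: y1 y2 u0; lra.
rewrite -mulrBr normrM ger0_norm ?invr_ge0 ?(ltW b0)// -/A -/B.
have ei : 0 <= 1 + e^-1 by rewrite addr_ge0// invr_ge0 ltW.
have key2 : `|A ^+ 2 - B ^+ 2| <= (1 + e^-1) * (4 * d%:R * Cf * (\sum_k W k * S k ^+ 2) +
   4 * d%:R * Cf ^+ 2 * \sum_k (D k ^+ 2 + b ^+ 2 * E k ^+ 2)) + e * B ^+ 2.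
  apply: (le_trans key); rewrite lerD2r ler_wpM2l//; apply: (le_trans hU); move: h1 h2; lra.
apply: (le_trans (ler_wpM2l _ key2)); first by rewrite invr_ge0 ltW.
have s1 : \sum_k W k * (b^-1 * S k ^+ 2) = b^-1 * \sum_k W k * S k ^+ 2.
  by rewrite mulr_sumr; apply: eq_bigr => k _; ring.
have s2 : \sum_k (b^-1 * D k ^+ 2 + b * E k ^+ 2) = b^-1 * \sum_k (D k ^+ 2 + b ^+ 2 * E k ^+ 2).
  by rewrite mulr_sumr; apply: eq_bigr => k _; field; exact: lt0r_neq0.
rewrite s1 s2 -/W; set T1 := \sum_k _; set T2 := \sum_k _.
by rewrite le_eqVlt; apply/orP; left; apply/eqP; ring.
Qed.

(** * Bias *)

Section LimitKernel.
Context {R : realType} {d0 : measure_display} {Omega : measurableType d0}.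
Variable P : probability Omega R.
Variables eps epss : int -> Omega -> R.
Let xi := fun ib : bool * int => if ib.1 then epss ib.2 else eps ib.2.
Hypothesis meps : forall i, measurable_fun setT (eps i).
Hypothesis mepss : forall i, measurable_fun setT (epss i).
Hypothesis indep : mutual_indep P xi.
Hypothesis ident : ident_distr P xi.
Context {d : nat}.
Variables (Gn : nat -> R -> (nat -> R) -> 'rV[R]_d) (G : R -> (nat -> R) -> 'rV[R]_d).
Hypotheses (mGn : forall n, kernel_measurable (Gn n)) (mG : kernel_measurable G).
Variables (q p C rho : R).
Hypotheses (q4 : 4 < q) (p1 : 1 <= p) (C0 : 0 <= C) (rho01 : 0 < rho < 1).
Hypothesis KC : forall n u, 0 <= u <= 1 -> (LqN P q (fun w => Gn n u (epsseq eps 0 w)) <= C%:E)%E.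
Hypothesis A3 : forall (j n : nat) (u : R) (t : int), 0 <= u <= 1 ->
  (LqN P q (fun w => (Gn n u (epsseq eps t w) - Gn n u (epstilde eps epss t j w))%R) <= (C * rho ^+ j)%:E)%E.
Hypothesis pvC : forall n, (pvariation P eps q p (Gn n) <= C%:E)%E.
Variable eta : nat -> R.
Hypothesis eta_ge0 : forall n, 0 <= eta n.
Hypothesis eta_cvg : eta @ \oo --> 0.
Hypothesis GnG : forall n u, 0 <= u <= 1 ->
  (LqN P q (fun w => (Gn n u (epsseq eps 0 w) - G u (epsseq eps 0 w))%R) <= (eta n)%:E)%E.
Variables (Cc Cs : R).
Hypotheses (Cc0 : 0 <= Cc) (Cs0 : 0 <= Cs) (Cc_le : 2 * C / (1 - rho) <= Cc) (Cs_le : Cc / (1 - rho) <= Cs).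

Let r0 : 0 < rho. Proof. by case/andP: rho01. Qed.
Let r1 : rho < 1. Proof. by case/andP: rho01. Qed.
Let r1' : 0 < 1 - rho. Proof. by rewrite subr_gt0. Qed.
Let q0 : 0 < q. Proof. by apply: lt_trans q4. Qed.

(** Moments and couplings are assumed of the [Gn n]. A bound for G holds with an error of order eta
    n for each n, and n is then sent to infinity. *)
Lemma le_eta_lim (x y c : R) : 0 <= c -> (forall n, x <= y + c * eta n) -> x <= y.
Proof.
move=> c0 h; apply/ler_addgt0Pr => e e0.
have : \forall n \near \oo, `|c * eta n| < e.
  apply: cvgr0_norm_lt => //; rewrite -(mulr0 c); apply: cvgM eta_cvg; exact: cvg_cst.
case=> N _ /(_ N (leqnn N)) /= hN; apply: (le_trans (h N)); rewrite lerD2l.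
exact: le_trans (ler_norm _) (ltW hN).
Qed.

Let XL n u t k (u01 : 0 <= u <= 1) :=
  X_L4 meps mepss indep ident (mGn n) q4 C0 (KC n) t k u01.

Lemma Gn_G n u t k : 0 <= u <= 1 ->
  L4 P (fun w => Gn n u (epsseq eps t w) 0 k - G u (epsseq eps t w) 0 k) /\
  N4 P (fun w => Gn n u (epsseq eps t w) 0 k - G u (epsseq eps t w) 0 k) <= 2 * eta n.
Proof. by move=> u01; apply: (kernel_gap meps mepss indep ident q4 _ _ (mGn n) mG); [|exact: GnG]. Qed.

Lemma G_L4 u t k : 0 <= u <= 1 -> L4 P (fun w => G u (epsseq eps t w) 0 k).
Proof.
move=> u01; have := L4B (XL 0 t k u01).1 (Gn_G 0 t k u01).1.
by congr L4; apply/funext => w; ring.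
Qed.

Lemma G_N2 u t k : 0 <= u <= 1 -> N2 P (fun w => G u (epsseq eps t w) 0 k) <= 2 * C.
Proof.
move=> u01; apply: (@le_eta_lim _ _ 2) => // n.
have [LX nX] := XL n t k u01; have [Ld nd] := Gn_G n t k u01.
rewrite (_ : (fun w => _) = (fun w => Gn n u (epsseq eps t w) 0 k -
   (Gn n u (epsseq eps t w) 0 k - G u (epsseq eps t w) 0 k))); last by apply/funext => w; ring.
apply: (le_trans (N2B (L4_L2 LX) (L4_L2 Ld))); apply: lerD.
  exact: le_trans (N2_le_N4 LX) nX.
exact: le_trans (N2_le_N4 Ld) nd.
Qed.

Notation Dn n := (LD P eps q (Gn n)).

Lemma GnB n x v t k : 0 <= v -> v <= x -> x <= 1 ->
  L4 P (fun w => Gn n x (epsseq eps t w) 0 k - Gn n v (epsseq eps t w) 0 k) /\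
  N4 P (fun w => Gn n x (epsseq eps t w) 0 k - Gn n v (epsseq eps t w) 0 k) <= 2 * Dn n x v.
Proof.
move=> v0 vx x1; apply: (kernel_gap meps mepss indep ident q4 _ _ (mGn n) (mGn n)); first exact: LD_ge0.
by rewrite (LD_fin q0 p1 (pvC n) v0 vx x1).
Qed.

Lemma Gn_GB n x v t k : 0 <= v -> v <= x -> x <= 1 ->
  L4 P (fun w => Gn n x (epsseq eps t w) 0 k - G v (epsseq eps t w) 0 k) /\
  N4 P (fun w => Gn n x (epsseq eps t w) 0 k - G v (epsseq eps t w) 0 k) <= 2 * (Dn n x v + eta n).
Proof.
move=> v0 vx x1; have [L1 n1] := GnB n t k v0 vx x1.
have v01 : 0 <= v <= 1 by rewrite v0 (le_trans vx).
have [L2 n2] := Gn_G n t k v01.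
rewrite (_ : (fun w => _) = (fun w => (Gn n x (epsseq eps t w) 0 k - Gn n v (epsseq eps t w) 0 k) +
   (Gn n v (epsseq eps t w) 0 k - G v (epsseq eps t w) 0 k))); last by apply/funext => w; ring.
split; first exact: L4D.
apply: (le_trans (N4D L1 L2)); rewrite mulrDr; exact: lerD.
Qed.

Definition mean u k : R := Ex P (fun w => G u (epsseq eps 0 w) 0 k).

Lemma Gn_mean_gap n u k : 0 <= u <= 1 ->
  `|Ex P (fun w => Gn n u (epsseq eps 0 w) 0 k) - mean u k| <= 2 * eta n.
Proof.
move=> u01; have [L h] := Gn_G n 0 k u01.
rewrite /mean -(ExB (L2_intg (L4_L2 (XL n 0 k u01).1)) (L2_intg (L4_L2 (G_L4 0 k u01)))).
apply: (le_trans (Ex_le_N2 (L4_L2 L))); exact: le_trans (N2_le_N4 L) h.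
Qed.

(** The p-variation is that of [Gn n], so an increment of the limit mean is compared with one of
    [Gn n], at the price 2 eta n at each end. *)
Lemma mean_gap n x v k : 0 <= v -> v <= x -> x <= 1 -> `|mean x k - mean v k| <= 2 * Dn n x v + 4 * eta n.
Proof.
move=> v0 vx x1; have [L h] := GnB n 0 k v0 vx x1.
have v01 : 0 <= v <= 1 by rewrite v0 (le_trans vx).
have x01 : 0 <= x <= 1 by rewrite x1 (le_trans v0).
have h1 := Gn_mean_gap n k v01; have h2 := Gn_mean_gap n k x01.
have h3 : `|Ex P (fun w => Gn n x (epsseq eps 0 w) 0 k) - Ex P (fun w => Gn n v (epsseq eps 0 w) 0 k)| <= 2 * Dn n x v.
  rewrite -(ExB (L2_intg (L4_L2 (XL n 0 k x01).1)) (L2_intg (L4_L2 (XL n 0 k v01).1))).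
  apply: (le_trans (Ex_le_N2 (L4_L2 L))); exact: le_trans (N2_le_N4 L) h.
move: h1 h2 h3; rewrite !ler_norml; lra.
Qed.

Definition cG v k l (h : int) : R := cov P (fun w => G v (epsseq eps 0 w) 0 k) (fun w => G v (epsseq eps h w) 0 l).

(** The points x and y lie to the right of v because [LD] controls ordered increments. The constant
    16 C comes from two products of a norm at most 2C and a gap at most 2 (th + eta n), doubled by
    [cov_close]. *)
Lemma cG_close n x y v k l (h : int) (th : R) : 0 <= v -> v <= x -> x <= 1 -> v <= y -> y <= 1 ->
  Dn n x v <= th -> Dn n y v <= th ->
  `|cov P (fun w => Gn n x (epsseq eps 0 w) 0 k) (fun w => Gn n y (epsseq eps h w) 0 l) - cG v k l h|
  <= 16 * C * (th + eta n).
Proof.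
move=> v0 vx x1 vy y1 hx hy.
have v01 : 0 <= v <= 1 by rewrite v0 (le_trans vx).
have x01 : 0 <= x <= 1 by rewrite x1 (le_trans v0).
have y01 : 0 <= y <= 1 by rewrite y1 (le_trans v0).
have [LX nX] := XL n 0 k x01; have [LY nY] := XL n h l y01.
apply: (le_trans (cov_close (L4_L2 LX) (L4_L2 (G_L4 0 k v01)) (L4_L2 LY) (L4_L2 (G_L4 h l v01)))).
have [L1 n1] := Gn_GB n 0 k v0 vx x1; have [L2 n2] := Gn_GB n h l v0 vy y1.
have m1 : N2 P (fun w => Gn n x (epsseq eps 0 w) 0 k - G v (epsseq eps 0 w) 0 k) <= 2 * (th + eta n).
  apply: (le_trans (N2_le_N4 L1)); apply: (le_trans n1); lra.
have m2 : N2 P (fun w => Gn n y (epsseq eps h w) 0 l - G v (epsseq eps h w) 0 l) <= 2 * (th + eta n).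
  apply: (le_trans (N2_le_N4 L2)); apply: (le_trans n2); lra.
have m3 := le_trans (N2_le_N4 LY) nY.
have e1 := ler_pM (N2_ge0 _ _) (N2_ge0 _ _) m1 m3.
have e2 := ler_pM (N2_ge0 _ _) (N2_ge0 _ _) (G_N2 0 k v01) m2.
have := lerD e1 e2; lra.
Qed.

Lemma cG_decay v k l h : 0 <= v <= 1 -> `|cG v k l h| <= 2 * C * Cc * rho ^+ absz h.
Proof.
move=> v01; apply: (@le_eta_lim _ _ (16 * C)); first by rewrite mulr_ge0.
move=> n; case/andP: (v01) => v0 v1.
have h1 := @cG_close n v v v k l h 0 v0 (lexx _) v1 (lexx _) v1.
have D0 : Dn n v v <= 0 by rewrite LDxx.
have := h1 D0 D0; rewrite add0r => h2.
have h3 := X_cov_decay meps mepss indep ident (mGn n) q4 C0 rho01 (KC n) (fun j => A3 j n) Cc0 Cc_le h k l v01 v01.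
rewrite -[cG v k l h](subKr (cov P (fun w => Gn n v (epsseq eps 0 w) 0 k) (fun w => Gn n v (epsseq eps h w) 0 l))).
exact: le_trans (ler_normB _ _) (lerD h3 h2).
Qed.

Definition kap : R := 2 * C * Cc.
Lemma kap_ge0 : 0 <= kap. Proof. by rewrite /kap !mulr_ge0. Qed.

(** [long_run_cov] is a limit of matrices; it is identified with the matrix of entrywise bilateral
    sums, whose tail bounds it inherits. *)
Lemma lrc_entry v k l : 0 <= v <= 1 ->
  (\sum_(0 <= i < (2 * H).+1) cG v k l (i%:Z - H%:Z)) @[H --> \oo] --> long_run_cov P eps G v k l /\
  forall A B : nat, `|long_run_cov P eps G v k l - \sum_(0 <= i < A + B.+1) cG v k l (i%:Z - A%:Z)|
   <= kap / (1 - rho) * (rho ^+ A + rho ^+ B).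
Proof.
move=> v01.
pose S k l := sval (cid (bilateral kap_ge0 rho01 (cG_decay k l ^~ v01))).
have SP k' l' := svalP (cid (bilateral kap_ge0 rho01 (cG_decay k' l' ^~ v01))).
suff -> : long_run_cov P eps G v = \matrix_(k, l) S k l by rewrite mxE; exact: SP.
apply: limn_mx_entry => k' l'; rewrite mxE; have [h _] := SP k' l'; apply: cvg_trans h.
rewrite (_ : (fun H : nat => _) = (fun H : nat => \sum_(0 <= i < (2 * H).+1) cG v k' l' (i%:Z - H%:Z)))//.
apply/funext => H; rewrite summxE; apply: eq_bigr => i _; rewrite !mxE.
have m0 := G_L4 0 k' v01.
rewrite /cG -cov_centered; [by []|exact: L4_L2|exact: L4_L2 (G_L4 _ _ v01)].
Qed.

Variables (f : 'rV[R]_d -> R) (delta : \bar R) (Cf : R).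
Let mu := fun u => vexp P (fun w => G u (epsseq eps 0 w)).
Hypotheses (tdf : twice_differentiable f) (delta_gt0 : (0 < delta)%E).
Hypothesis A4 : forall x, nbhd_set (conv_curve mu) delta x ->
  `|f x| + enorm (grad f x) + fnorm (hessian f x) <= Cf.

Lemma muE u k : mu u 0 k = mean u k.
Proof. by rewrite mxE. Qed.

Definition gr u k : R := grad f (mu u) 0 k.

Lemma Cf_ge0 : 0 <= Cf.
Proof.
have h : nbhd_set (conv_curve mu) delta (mu 0) by apply: nbhd_point => //; rewrite lexx ler01.
by apply: le_trans (A4 h); rewrite !addr_ge0// ?enorm_ge0// sqrtr_ge0.
Qed.

Lemma gr_bound u k : 0 <= u <= 1 -> `|gr u k| <= Cf.
Proof. by move=> u01; apply: (grad_bound k A4); exact: nbhd_point. Qed.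

Lemma gr_gap n x v k (th : R) : 0 <= v -> v <= x -> x <= 1 -> Dn n x v <= th ->
  `|gr x k - gr v k| <= d%:R * Cf * (d%:R * (4 * (th + eta n))).
Proof.
move=> v0 vx x1 hD; have v01 : 0 <= v <= 1 by rewrite v0 (le_trans vx).
have x01 : 0 <= x <= 1 by rewrite x1 (le_trans v0).
have th0 : 0 <= th by exact: le_trans (LD_ge0 _ _ _ _ _ _) hD.
apply: (le_trans (grad_lip k tdf v01 A4 (nbhd_point _ delta_gt0 x01))).
rewrite ler_wpM2l ?mulr_ge0 ?Cf_ge0//; apply: enorm_coord_le.
  by rewrite mulr_ge0// addr_ge0.
move=> i; rewrite !mxE -/(mean x i) -/(mean v i); apply: (le_trans (mean_gap n i v0 vx x1)); lra.
Qed.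

Definition avar (v : R) : R := (grad f (mu v) *m long_run_cov P eps G v *m (grad f (mu v))^T) 0 0.

Lemma avarE v : avar v = \sum_k \sum_l gr v k * gr v l * long_run_cov P eps G v k l.
Proof.
rewrite /avar mxE exchange_big /=; apply: eq_bigr => l _.
rewrite [_^T l 0]mxE [(grad f (mu v) *m _) 0 l]mxE mulr_suml; apply: eq_bigr => k _.
by rewrite /gr; ring.
Qed.

Definition Smax : R := kap + 2 * (kap / (1 - rho)).

Lemma Smax_ge0 : 0 <= Smax.
Proof. by rewrite /Smax addr_ge0 ?kap_ge0// mulr_ge0// divr_ge0 ?kap_ge0// ltW. Qed.

Lemma lrc_bound v k l : 0 <= v <= 1 -> `|long_run_cov P eps G v k l| <= Smax.
Proof.
move=> v01; have [_ /(_ 0%N 0%N)] := lrc_entry k l v01.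
rewrite big_nat1 subrr expr0 => h; have := cG_decay k l 0 v01; rewrite expr0 mulr1 -/kap => h0.
rewrite -[long_run_cov _ _ _ _ _ _](subrK (cG v k l 0)) (le_trans (ler_normD _ _))// /Smax.
move: h h0; lra.
Qed.

Definition avar_max : R := d%:R * (d%:R * (Cf * Cf * Smax)).

Lemma avar_bound v : 0 <= v <= 1 -> `|avar v| <= avar_max.
Proof.
move=> v01; rewrite avarE /avar_max; apply: (le_trans (ler_norm_sum _ _ _)).
apply: (@le_trans _ _ (\sum_(k < d) d%:R * (Cf * Cf * Smax))); last by rewrite sum_ord_cst.
apply: ler_sum => k _; apply: (le_trans (ler_norm_sum _ _ _)).
apply: (@le_trans _ _ (\sum_(l < d) (Cf * Cf * Smax))); last by rewrite sum_ord_cst.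
apply: ler_sum => l _; rewrite !normrM; apply: ler_pM => //; last exact: lrc_bound.
by apply: ler_pM => //; exact: gr_bound.
Qed.

(** The gradient along the curve is a continuous function of measurable means, and each long-run
    covariance is a pointwise limit of measurable partial sums. *)
Lemma avar_meas : measurable_fun (`[0%R, 1%R]%classic : set R) avar.
Proof.
rewrite (_ : avar = fun v => \sum_k \sum_l gr v k * gr v l * long_run_cov P eps G v k l); last first.
  by apply/funext => v; exact: avarE.
have mgr k : measurable_fun setT (gr ^~ k).
  have mm i : measurable_fun setT (fun v => mu v 0 i).
    rewrite (_ : (fun w => _) = (mean ^~ i)); first exact: meas_mean_param.
    by apply/funext => w; rewrite muE.
  exact: (@meas_comp_continuous _ _ _ _ mu mm (fun x => grad f x 0 k) (grad_continuous tdf)).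
apply: measurable_sum => k; apply: measurable_sum => l; apply: measurable_funM.
  by apply: measurable_funTS; apply: measurable_funM.
apply: (@measurable_fun_cvg _ _ _ _ (fun H v => \sum_(0 <= i < (2 * H).+1) cG v k l (i%:Z - H%:Z))).
  move=> H; apply: measurable_funTS; apply: measurable_sum => i.
  exact: meas_cov_param.
move=> v /=; rewrite in_itv/= => v01; exact: (lrc_entry k l v01).1.
Qed.

(** Over d^2 entries, the error of a block average at covariance gap 16 C x, plus twice the gradient
    gap times bounds of the other factors. The argument x stands for th + eta n. *)
Definition cellB (x : R) (b : nat) : R := d%:R * (d%:R *
  (Cf * Cf * (avg_cst1 kap rho * Num.sqrt (16 * C * x) + avg_cst2 kap rho / b%:R)
   + 2 * (Cf * (d%:R * Cf * (d%:R * (4 * x))) * Smax))).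

(* The value 0 beyond the sample makes [gL_le] hold for every t. *)
Definition gL (n L t : nat) k : R := if (t <= n)%N then gr ((t - L)%N%:R / n%:R) k else 0.

Lemma gL_le n L t k : `|gL n L t k| <= Cf.
Proof.
rewrite /gL; case: ifP => tn; last by rewrite normr0 Cf_ge0.
by apply: gr_bound; apply: frac01; exact: leq_trans (leq_subr _ _) tn.
Qed.

(** The gradient point (t-L)/n, the block times and v all lie in one window of length (L+b)/n,
    inside which th bounds every increment. *)
Lemma cell (n b L t : nat) v (th : R) : (0 < n)%N -> (0 < b)%N -> (L <= t)%N -> (t + b <= n)%N ->
  t%:R / n%:R <= v <= t.+1%:R / n%:R ->
  (forall x y, (t - L)%N%:R / n%:R <= x -> x <= y -> y <= (t + b)%N%:R / n%:R -> Dn n y x <= th) ->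
  `|avar v - Ex P (fun w => Zf P eps (Gn n) n b (gL n L) t (x0 eps w))| <= cellB (th + eta n) b.
Proof.
move=> n0 b0 Lt tb /andP[v1 v2] hth.
have tn : (t <= n)%N by exact: leq_trans (leq_addr _ _) tb.
have tsn : (t.+1 <= n)%N by rewrite -addn1; apply: leq_trans tb; rewrite leq_add2l.
have tL0 := @frac_le R n (t - L) t (leq_subr _ _).
have ts1 := @frac_le R n t.+1 (t + b) (ltac:(by rewrite -addn1 leq_add2l)).
have /andP[tL00 _] := @frac01 R n (t - L) (leq_trans (leq_subr _ _) tn).
have /andP[_ tb1] := @frac01 R n (t + b) tb.
have v01 : 0 <= v <= 1.
  by rewrite (le_trans tL00 (le_trans tL0 v1)) (le_trans v2 (le_trans ts1 tb1)).
have th0 : 0 <= th.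
  apply: le_trans (hth v v _ (lexx _) _); [exact: LD_ge0|exact: le_trans v1|exact: le_trans v2 ts1].
pose g k := gL n L t k; pose gm k l i j := cov P (fun w => Gn n ((t + i)%:R / n%:R) (epsseq eps 0 w) 0 k)
  (fun w => Gn n ((t + j)%:R / n%:R) (epsseq eps ((t + j)%N%:Z - (t + i)%N%:Z) w) 0 l).
pose A k l := b%:R^-1 * \sum_(1 <= i < b.+1) \sum_(1 <= j < b.+1) gm k l i j.
have hi i : (1 <= i < b.+1)%N -> (t + i <= n)%N by move: tb; clear; lia.
have LX i k : (1 <= i < b.+1)%N -> L2 P (fun w => kf (Gn n) ((t + i)%:R / n%:R) (t + i)%N%:Z k (x0 eps w) - Xm P eps (Gn n) n (t + i) k).
  move=> h; apply: L2B; last exact: L2_cst.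
  by apply: L4_L2; have [] := XL n (t + i)%N%:Z k (frac01 (R:=R) (hi i h)).
have EZ : Ex P (fun w => Zf P eps (Gn n) n b (gL n L) t (x0 eps w)) = \sum_k \sum_l g k * g l * A k l.
  pose Y k i w := kf (Gn n) ((t + i)%:R / n%:R) (t + i)%N%:Z k (x0 eps w) - Xm P eps (Gn n) n (t + i) k.
  pose pr i := (1 <= i < b.+1)%N.
  have E : (fun w => Zf P eps (Gn n) n b (gL n L) t (x0 eps w)) = (fun w => \sum_k \sum_l
     g k * g l * b%:R^-1 * (\sum_(1 <= i < b.+1 | pr i) \sum_(1 <= j < b.+1 | pr j) Y k i w * Y l j w)).
    apply/funext => w; rewrite /Zf /tf expr2 mulr_suml mulr_sumr; apply: eq_bigr => k _.
    rewrite mulr_sumr mulr_sumr; apply: eq_bigr => l _.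
    have -> : \sum_(1 <= i < b.+1 | pr i) \sum_(1 <= j < b.+1 | pr j) Y k i w * Y l j w =
       sf P eps (Gn n) n b t k (x0 eps w) * sf P eps (Gn n) n b t l (x0 eps w).
      rewrite /sf big_nat mulr_suml; apply: eq_bigr => i _.
      by rewrite [in RHS]big_nat mulr_sumr.
    by rewrite /g; ring.
  have iY k l i j : pr i -> pr j -> intg P (fun w => Y k i w * Y l j w).
    by move=> pi pj; apply: L2_intgM; exact: LX.
  have iS k l : intg P (fun w => \sum_(1 <= i < b.+1 | pr i) \sum_(1 <= j < b.+1 | pr j) Y k i w * Y l j w).
    by apply: intg_sum => i pi; apply: intg_sum => j pj; exact: iY.
  rewrite E Ex_sum; last by move=> k _; apply: intg_sum => l _; exact: intgZ.
  apply: eq_bigr => k _; rewrite Ex_sum; last by move=> l _; exact: intgZ.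
  apply: eq_bigr => l _; rewrite (ExZ _ (iS k l)) -mulrA; congr (_ * (_ * _)).
  rewrite Ex_sum; last by move=> i pi; apply: intg_sum => j pj; exact: iY.
  rewrite [in RHS]big_nat; apply: eq_bigr => i pi.
  rewrite Ex_sum; last by move=> j pj; exact: iY.
  rewrite [in RHS]big_nat; apply: eq_bigr => j pj.
  exact: (Ex_Xc2 meps mepss indep ident (mGn n) q4 C0 (KC n) k l (hi i pi) (hi j pj)).
pose e1 := avg_cst1 kap rho * Num.sqrt (16 * C * (th + eta n)) + avg_cst2 kap rho / b%:R.
pose e2 := d%:R * Cf * (d%:R * (4 * (th + eta n))).
(* The block starts at t + 1, so its times lie to the right of v, and the gradient point lies to the
   left: increments are always taken in increasing order. *)
have x01 i : (1 <= i < b.+1)%N -> v <= (t + i)%N%:R / n%:R /\ (t + i)%N%:R / n%:R <= (t + b)%N%:R / n%:R :> R.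
  move=> h; split; last by apply: frac_le; move: h; clear; lia.
  by apply: le_trans v2 _; apply: frac_le; move: h; clear; lia.
have HA k l : `|A k l - long_run_cov P eps G v k l| <= e1.
  apply: (block_avg kap_ge0 rho01 (a := cG v k l)) => //.
  - by rewrite mulr_ge0 ?mulr_ge0// addr_ge0.
  - move=> i j h h'; have := X_cov_decay meps mepss indep ident (mGn n) q4 C0 rho01 (KC n) (fun j => A3 j n) Cc0 Cc_le
      ((t + j)%N%:Z - (t + i)%N%:Z) k l (frac01 (R:=R) (hi i h)) (frac01 (R:=R) (hi j h')).
    by rewrite (_ : absz _ = absz (i%:Z - j%:Z))//; clear; lia.
  - by move=> h; exact: cG_decay.
  - move=> i j h h'; rewrite /gm (_ : (t + j)%N%:Z - (t + i)%N%:Z = j%:Z - i%:Z); last by clear; lia.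
    have [a1 a2] := x01 i h; have [a3 a4] := x01 j h'.
    apply: cG_close => //; try (by apply: le_trans tb1); try (by case/andP: v01).
    + by apply: hth => //; exact: le_trans v1.
    + by apply: hth => //; exact: le_trans v1.
  - by move=> A' B'; have [_] := lrc_entry k l v01.
have Hg k : `|g k - gr v k| <= e2.
  rewrite /g /gL tn distrC; apply: gr_gap => //; first exact: le_trans v1.
    by case/andP: v01.
  by apply: hth => //; [exact: le_trans v1|exact: le_trans v2 ts1].
have gC k : `|g k| <= Cf by exact: gL_le.
rewrite EZ avarE -sumrB /cellB -/e1 -/e2; apply: (le_trans (ler_norm_sum _ _ _)).
set bnd := (X in _ <= _ * (_ * X)).
apply: (@le_trans _ _ (\sum_(k < d) d%:R * bnd)); last by rewrite sum_ord_cst.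
apply: ler_sum => k _; rewrite -sumrB; apply: (le_trans (ler_norm_sum _ _ _)).
apply: (@le_trans _ _ (\sum_(l < d) bnd)); last by rewrite sum_ord_cst.
apply: ler_sum => l _; rewrite /bnd; set S := long_run_cov _ _ _ _ _ _.
have -> : gr v k * gr v l * S - g k * g l * A k l = - (g k * g l * (A k l - S)) -
   ((g k - gr v k) * g l * S + gr v k * (g l - gr v l) * S) by ring.
apply: (le_trans (ler_normB _ _)); rewrite normrN; apply: lerD.
  by rewrite !normrM; apply: ler_pM => //; apply: ler_pM.
apply: (le_trans (ler_normD _ _)); rewrite mulr_natl mulr2n; apply: lerD; rewrite !normrM.
  by rewrite [Cf * e2]mulrC; apply: ler_pM => //; [apply: ler_pM|exact: lrc_bound].
by apply: ler_pM => //; [apply: ler_pM => //; exact: gr_bound|exact: lrc_bound].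
Qed.

(** [cellB] is affine in x and sqrt x with nonnegative coefficients, so averages pass inside by
    Jensen's inequality. *)
Lemma cellB_avg (x : nat -> R) (a c n b : nat) (X : R) : (0 < n)%N -> (c - a <= n)%N ->
  (forall t, 0 <= x t) -> n%:R^-1 * (\sum_(a <= t < c) x t) <= X ->
  n%:R^-1 * \sum_(a <= t < c) cellB (x t) b <= cellB X b.
Proof.
move=> n0 can x0 hX; have np : 0 < n%:R :> R by rewrite ltr0n.
have Cf0 := Cf_ge0; have S0 := Smax_ge0.
have s1 : n%:R^-1 * \sum_(a <= t < c) Num.sqrt (16 * C * x t) <= Num.sqrt (16 * C * X).
  apply: jensen_sqrt => // [t|]; first by rewrite mulr_ge0 ?mulr_ge0.
  by rewrite -mulr_sumr mulrCA ler_wpM2l// mulr_ge0.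
have s3 : n%:R^-1 * \sum_(a <= t < c) (1 : R) <= 1.
  by rewrite big_const_nat iter_addr_0 -[X in _ * X]mulr_natl mulr1 mulrC ler_pdivrMr// mul1r ler_nat.
have a1 := avg_cst1_ge0 kap rho01; have a2 := avg_cst2_ge0 kap_ge0 rho01.
pose k1 := d%:R * (d%:R * (Cf * Cf * avg_cst1 kap rho)).
pose k2 := d%:R * (d%:R * (2 * (Cf * (d%:R * Cf * (d%:R * 4)) * Smax))).
pose k3 := d%:R * (d%:R * (Cf * Cf * (avg_cst2 kap rho / b%:R))).
have k10 : 0 <= k1 by rewrite /k1; do 4!(apply: mulr_ge0 => //).
have k20 : 0 <= k2 by rewrite /k2 !mulr_ge0.
have k30 : 0 <= k3 by rewrite /k3; do 2!(apply: mulr_ge0 => //); apply: mulr_ge0; [exact: mulr_ge0|exact: divr_ge0].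
have E y : cellB y b = k1 * Num.sqrt (16 * C * y) + k2 * y + k3 * 1.
  by rewrite /cellB /k1 /k2 /k3; ring.
under eq_bigr do rewrite E.
rewrite !big_split/= -!mulr_sumr E !mulrDr !(mulrCA n%:R^-1).
by apply: lerD; [apply: lerD|]; apply: ler_wpM2l.
Qed.

Let p' := Num.max p 2.
Definition Xrate (n b L : nat) : R :=
  Num.sqrt (wconst p (C `^ p) * ((L + b)%N%:R / n%:R) `^ (2 / p')) + eta n.

(** A single window may carry a large increment. The average over t of the squared window bounds is
    small, by telescoping of the control, and Jensen's inequality carries this through the square
    roots. *)
Lemma bias_avg (n b L a c : nat) : (0 < n)%N -> (0 < b)%N -> (L <= a)%N -> (a <= c)%N -> (c + b <= n.+1)%N ->
  `|n%:R^-1 * (\sum_(a <= t < c) Ex P (fun w => Zf P eps (Gn n) n b (gL n L) t (x0 eps w)))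
    - (prim avar (c%:R / n%:R) - prim avar (a%:R / n%:R))| <= cellB (Xrate n b L) b.
Proof.
move=> n0 b0 La ac cb; have np : 0 < n%:R :> R by rewrite ltr0n.
have [om [om01 omD]] := LD_control q0 p1 (pvC n).
have Lb0 : (0 < L + b)%N by rewrite addn_gt0 b0 orbT.
pose lam := ((L + b)%N%:R / n%:R : R) `^ (p'^-1).
pose V := C `^ p.
pose B s := lam ^+ 2 + lam `^ (2 - p') * (V `^ p^-1) `^ (p' - p) * (om ((s + (L + b))%N%:R / n%:R) - om (s%:R / n%:R)).
pose th t := Num.sqrt (B (t - L)%N).
have cn : (c <= n)%N by move: b0 cb; clear; lia.
have hD s x y : (s + (L + b) <= n)%N -> s%:R / n%:R <= x -> x <= y -> y <= (s + (L + b))%N%:R / n%:R ->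
    Dn n y x <= Num.sqrt (B s) /\ 0 <= B s.
  move=> sl sx xy ys; have /andP[s0 _] := @frac01 R n s (leq_trans (leq_addr _ _) sl).
  have /andP[_ s1] := @frac01 R n _ sl.
  have h := @D_sq_le R (Dn n) p V om p1 (fun x y => LD_ge0 P eps q (Gn n) y x) om01 omD n (L + b)%N x y _ _ n0 Lb0 s0 sx xy ys s1.
  have B0 : 0 <= B s by apply: le_trans h; exact: sqr_ge0.
  split => //; rewrite -[leLHS](ger0_norm (LD_ge0 _ _ _ _ _ _)) -sqrtr_sqr ler_sqrt//.
apply: (@le_trans _ _ (n%:R^-1 * \sum_(a <= t < c) cellB (th t + eta n) b)).
  apply: (@riemann _ _ avar_max avar_meas avar_bound _ (fun t => cellB (th t + eta n) b) n a c n0 ac cn).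
  move=> t v /andP[at_ tc] hv; have Lt : (L <= t)%N by exact: leq_trans at_.
  apply: cell => //; first by move: tc cb; clear; lia.
  move=> x y h1 h2 h3; apply: (hD _ _ _ _ h1 h2 _).1; first by move: Lt tc cb; clear; lia.
  by rewrite (_ : (t - L + (L + b) = t + b)%N)//; move: Lt; clear; lia.
apply: cellB_avg => // [|t|]; [by move: cn; clear; lia|by rewrite addr_ge0// sqrtr_ge0|].
rewrite big_split/= mulrDr /Xrate; apply: lerD; last first.
  rewrite big_const_nat iter_addr_0 -[X in _ * X]mulr_natl mulrA ler_piMl// mulrC ler_pdivrMr// mul1r ler_nat.
  by move: cn; clear; lia.
(* [jensen_sqrt] asks for nonnegative terms at every index, whereas B is shown nonnegative for
   windows inside the sample. *)
rewrite (_ : \sum_(a <= t < c) th t = \sum_(a <= t < c) Num.sqrt (Num.max (B (t - L)%N) 0)); last first.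
  rewrite !big_nat; apply: eq_bigr => t /andP[at_ tc]; rewrite /th max_l//.
  have sl : ((t - L) + (L + b) <= n)%N by move: (leq_trans La at_) tc cb; clear; lia.
  by apply: (hD _ _ _ sl (lexx _) (lexx _) _).2; apply: frac_le; exact: leq_addr.
apply: jensen_sqrt => // [|t|]; [by move: cn; clear; lia|by rewrite le_max lexx orbT|].
rewrite ler_pdivrMl//.
have [aL|cL] := leqP L c; last by move: (leq_trans La ac) cL; clear; lia.
have hws := window_sum p1 om01 n0 Lb0 (N := (c - L)%N).
apply: le_trans (hws _); last by move: aL cb; clear; lia.
have B0 s : (s < c - L)%N -> 0 <= B s.
  move=> sc; have sl : (s + (L + b) <= n)%N by move: aL sc cb; clear; lia.
  by apply: (hD _ _ _ sl (lexx _) (lexx _) _).2; apply: frac_le; exact: leq_addr.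
(* [window_sum] starts at 0; the windows before a - L contribute nonnegative terms. *)
rewrite [leRHS](big_cat_nat (n := (a - L)%N))//=; last by move: La ac; clear; lia.
rewrite -[leLHS]add0r; apply: lerD.
  rewrite big_nat; apply: sumr_ge0 => s /andP[_ sa]; apply: B0; move: sa La ac; clear; lia.
rewrite (_ : index_iota a c = index_iota (a - L + L) (c - L + L)); last by rewrite !subnK.
rewrite big_addn addnK !big_nat; apply: ler_sum => s /andP[_ sa]; rewrite addnK max_l//; exact: B0.
Qed.

Lemma bias (n b L a : nat) (u : R) : (0 < n)%N -> (0 < b)%N -> (L <= a)%N -> 0 <= u <= 1 ->
  `|n%:R^-1 * (\sum_(a <= t < (Num.truncn (n%:R * u)).+1 - b) Ex P (fun w => Zf P eps (Gn n) n b (gL n L) t (x0 eps w)))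
    - prim avar u| <= cellB (Xrate n b L) b + avar_max * ((a + b)%N%:R / n%:R).
Proof.
move=> n0 b0 La /andP[u0 u1]; have np : 0 < n%:R :> R by rewrite ltr0n.
have nu0 : 0 <= n%:R * u by rewrite mulr_ge0.
have /andP[m1 m2] := truncn_itv nu0; set m := Num.truncn _ in m1 m2 *.
have mn : (m <= n)%N by rewrite -(ler_nat R); apply: le_trans m1 _; rewrite ler_piMr.
have avar_max0 : 0 <= avar_max by rewrite /avar_max !mulr_ge0 ?Cf_ge0 ?Smax_ge0.
have X0 : 0 <= Xrate n b L by rewrite addr_ge0// sqrtr_ge0.
have cB0 : 0 <= cellB (Xrate n b L) b.
  have Cf0 := Cf_ge0; have S0 := Smax_ge0.
  have a1 := avg_cst1_ge0 kap rho01; have a2 := avg_cst2_ge0 kap_ge0 rho01.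
  rewrite /cellB; do 2!(apply: mulr_ge0 => //); apply: addr_ge0; last by rewrite !mulr_ge0.
  apply: mulr_ge0; first exact: mulr_ge0.
  by apply: addr_ge0; [apply: mulr_ge0 => //; exact: sqrtr_ge0|exact: divr_ge0].
have lip x y := @prim_lip _ _ avar_max avar_meas avar_bound x y.
(* If the sum is empty then n u < a + b, and the integral itself is of the order of the error. *)
have [ca|ac] := leqP (m.+1 - b) a.
  rewrite big_geq// mulr0 sub0r normrN -[leLHS]add0r; apply: lerD => //.
  have := lip 0 u (lexx _) u0 u1; rewrite prim0 !subr0 => h; apply: (le_trans h); rewrite mulrC ler_wpM2l//.
  rewrite ler_pdivlMr// mulrC; apply: le_trans (ltW m2) _; rewrite ler_nat.
  by move: ca; clear; lia.
have cb : (m.+1 - b + b <= n.+1)%N by move: mn ac; clear; lia.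
have h1 := bias_avg n0 b0 La (ltnW ac) cb.
have cm : (m.+1 - b <= m)%N by move: b0; clear; lia.
have cu : (m.+1 - b)%N%:R / n%:R <= u.
  by rewrite ler_pdivrMr// mulrC; apply: le_trans m1; rewrite ler_nat.
have c0 : 0 <= (m.+1 - b)%N%:R / n%:R :> R by rewrite divr_ge0.
have h2 := lip _ _ c0 cu u1.
have a0 : 0 <= a%:R / n%:R :> R by rewrite divr_ge0.
have an : a%:R / n%:R <= 1 :> R.
  by rewrite ler_pdivrMr// mul1r ler_nat; move: ac mn b0; clear; lia.
have h3 := lip _ _ (lexx _) a0 an; rewrite prim0 !subr0 in h3.
have h4 : (u - (m.+1 - b)%N%:R / n%:R) * avar_max <= avar_max * (b%:R / n%:R).
  rewrite mulrC ler_wpM2l// lerBlDr -mulrDl ler_pdivlMr// mulrC -natrD.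
  by apply: le_trans (ltW m2) _; rewrite ler_nat; clear; lia.
rewrite natrD mulrDl mulrDr.
rewrite [a%:R / n%:R * avar_max]mulrC in h3.
exact: dist_chain h1 h2 h3 h4.
Qed.

(** * Errors of the pilot estimators *)

Section FixedSample.

Variable muhat : nat -> nat -> Omega -> 'rV[R]_d.
Hypothesis muhP : forall t n (i : 'I_d) (B : set R), measurable B ->
  past_sigma eps t%:Z ((fun w => muhat t n w 0 i) @^-1` B).
Variables (n b L tau : nat) (kappa : R).
Hypotheses (n0 : (0 < n)%N) (b0 : (0 < b)%N) (tau0 : (0 < tau)%N).
Let np : 0 < n%:R :> R. Proof. by rewrite ltr0n. Qed.
Let bp : 0 < b%:R :> R. Proof. by rewrite ltr0n. Qed.
Let Cf0 : 0 <= Cf := Cf_ge0.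

Let X (t : nat) (w : Omega) := Gn n (t%:R / n%:R) (epsseq eps t%:Z w).
Let S (t : nat) k w := sf P eps (Gn n) n b t k (x0 eps w).
Let Z (t : nat) w := Zf P eps (Gn n) n b (gL n L) t (x0 eps w).
Let gg := gL n L.
Let ggC t k : `|gg t k| <= Cf. Proof. exact: gL_le. Qed.

Definition shift_mean (t : nat) k : R :=
  \sum_(1 <= i < b.+1) (Xm P eps (Gn n) n (t + i) k - Xm P eps (Gn n) n (t - L) k).
Definition pilot_err (s : nat) k w : R := muhat s n w 0 k - Xm P eps (Gn n) n s k.
Definition summand (t : nat) w : R := b%:R^-1 *
  ((grad f (muhat (t - L)%N n w)) *m
     (\sum_(1 <= i < b.+1) (X (t + i)%N w - muhat (t - L)%N n w))^T) 0 0 ^+ 2.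
(** The estimated gradient is uncontrolled outside the neighbourhood, hence the cut at 2 Cf: it is
    inactive inside, and makes the variable bounded everywhere while still a function of the past up
    to t - L. *)
Definition grad_err t k w : R := Num.min (2 * Cf) `|grad f (muhat (t - L)%N n w) 0 k - gg t k|.
Definition pilot_sq w : R := \sum_(tau <= t < n.+1)
  enorm (muhat t n w - vexp P (fun w' => Gn n (t%:R / n%:R) (epsseq eps 0 w'))) ^+ 2.

Lemma summandE t w : summand t w = b%:R^-1 *
  (\sum_k grad f (muhat (t - L)%N n w) 0 k * (S t k w + shift_mean t k - b%:R * pilot_err (t - L) k w)) ^+ 2.
Proof.
rewrite /summand; congr (_ * (_ ^+ 2)).
rewrite [LHS]mxE; apply: eq_bigr => k _; rewrite [_^T k 0]mxE summxE; congr (_ * _).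
have -> : b%:R * pilot_err (t - L) k w = \sum_(1 <= i < b.+1) pilot_err (t - L) k w.
  by rewrite big_const_nat subn1 /= iter_addr_0 mulr_natl.
rewrite /S /sf /shift_mean -big_split/= -sumrB; apply: eq_bigr => i _.
by rewrite !mxE /X /pilot_err kf_x0; ring.
Qed.

Lemma summand_bound t w e : 0 < e ->
  nbhd_set (conv_curve mu) delta (muhat (t - L)%N n w) ->
  `|summand t w - Z t w| <=
  (1 + e^-1) * (4 * d%:R * Cf * (\sum_k grad_err t k w * (b%:R^-1 * S t k w ^+ 2)) +
     4 * d%:R * Cf ^+ 2 * \sum_k (b%:R^-1 * shift_mean t k ^+ 2 + b%:R * pilot_err (t - L) k w ^+ 2)) +
  e * Z t w.
Proof.
move=> e0 hw; rewrite summandE; apply: summand_diff => // k.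
exact: (grad_bound k A4 hw).
Qed.

Lemma Xm_vexp s k : (s <= n)%N ->
  Xm P eps (Gn n) n s k = vexp P (fun w' => Gn n (s%:R / n%:R) (epsseq eps 0 w')) 0 k.
Proof.
move=> sn; rewrite mxE /Xm (X_mean_shift meps mepss indep ident (mGn n) q4 C0 (KC n))//.
exact: frac01.
Qed.

Lemma pilot_err_sum s w : (s <= n)%N -> \sum_k pilot_err s k w ^+ 2 =
  enorm (muhat s n w - vexp P (fun w' => Gn n (s%:R / n%:R) (epsseq eps 0 w'))) ^+ 2.
Proof.
move=> sn; rewrite /enorm sqr_sqrtr; last by apply: sumr_ge0 => i _; exact: sqr_ge0.
by apply: eq_bigr => k _; rewrite /pilot_err Xm_vexp// !mxE.
Qed.

(** Summing over t from tau + L is summing over s = t - L from tau, so that the errors fall in the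
    range of [pilot_sq]. *)
Lemma pilot_avg c w : (c <= n.+1)%N ->
  n%:R^-1 * \sum_(tau + L <= t < c) \sum_k (b%:R * pilot_err (t - L) k w ^+ 2) <= b%:R / n%:R * pilot_sq w.
Proof.
move=> cn; rewrite [b%:R / _]mulrC -mulrA ler_wpM2l ?invr_ge0//.
under eq_bigr do rewrite -mulr_sumr.
rewrite -mulr_sumr ler_wpM2l//.
have [ca|ac] := leqP c (tau + L).
  by rewrite big_geq// /pilot_sq; apply: sumr_ge0 => t _; exact: sqr_ge0.
rewrite (_ : index_iota (tau + L) c = index_iota (tau + L) (c - L + L)); last first.
  by rewrite subnK//; move: ac; clear; lia.
rewrite big_addn addnK /pilot_sq [leRHS](big_cat_nat (n := (c - L)%N))//=; first last.
- by move: cn; clear; lia.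
- by move: ac; clear; lia.
rewrite -[leLHS]addr0; apply: lerD; last by apply: sumr_ge0 => t _; exact: sqr_ge0.
rewrite !big_nat; apply: ler_sum => s /andP[_ sc]; rewrite addnK pilot_err_sum//.
by move: sc cn; clear; lia.
Qed.

Definition win : R := ((L + b)%N%:R / n%:R) `^ (2 / p').

(** Cauchy-Schwarz within the block, then for each i the window estimate of length L + i <= L + b
    for the sum over t. The 4 is the square of the factor 2 between Lq norms and means. *)
Lemma shift_mean_avg a c k : (L <= a)%N -> (c + b <= n.+1)%N ->
  n%:R^-1 * \sum_(a <= t < c) b%:R^-1 * shift_mean t k ^+ 2 <= 4 * wconst p (C `^ p) * (b%:R * win).
Proof.
move=> La cb; have [om [om01 omD]] := LD_control q0 p1 (pvC n).
have wc0 : 0 <= wconst p (C `^ p) by rewrite /wconst addr_ge0// mulr_ge0 ?powR_ge0.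
have [ca|ac] := leqP c a.
  by rewrite big_geq// mulr0 !mulr_ge0 ?powR_ge0.
pose Dn := LD P eps q (Gn n).
have hD t i : (L <= t)%N -> (t + i <= n)%N ->
    (Xm P eps (Gn n) n (t + i) k - Xm P eps (Gn n) n (t - L) k) ^+ 2 <=
    4 * Dn ((t - L + (L + i))%N%:R / n%:R) ((t - L)%N%:R / n%:R) ^+ 2.
  move=> Lt ti; rewrite (_ : (t - L + (L + i) = t + i)%N); last by move: Lt; clear; lia.
  have tLn : (t - L <= n)%N by move: ti; clear; lia.
  rewrite !Xm_vexp// !mxE.
  have x1 := @frac01 R n _ ti; have x2 := @frac01 R n _ tLn.
  have [Lg ng] := GnB n 0 k (andP x2).1
     (frac_le n (leq_trans (leq_subr L t) (leq_addr i t))) (andP x1).2.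
  have h := le_trans (Ex_le_N2 (L4_L2 Lg)) (le_trans (N2_le_N4 Lg) ng).
  rewrite (ExB (L2_intg (L4_L2 (XL n 0 k x1).1)) (L2_intg (L4_L2 (XL n 0 k x2).1))) in h.
  rewrite -[leLHS]real_normK ?num_real//.
  have -> : 4 * Dn ((t + i)%:R / n%:R) ((t - L)%:R / n%:R) ^+ 2 = (2 * Dn ((t + i)%:R / n%:R) ((t - L)%:R / n%:R)) ^+ 2 by ring.
  by rewrite lerXn2r ?nnegrE ?mulr_ge0// LD_ge0.
have hS t : (a <= t < c)%N -> b%:R^-1 * shift_mean t k ^+ 2 <=
    \sum_(1 <= i < b.+1) 4 * Dn ((t - L + (L + i))%N%:R / n%:R) ((t - L)%N%:R / n%:R) ^+ 2.
  move=> /andP[at_ tc]; rewrite ler_pdivrMl//.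
  apply: (le_trans (sqr_sum_le _ _)); rewrite size_iota subn1 /= ler_wpM2l// !big_nat.
  apply: ler_sum => i hi; apply: hD; first exact: leq_trans at_.
  by move: tc hi cb; clear; lia.
rewrite ler_pdivrMl//.
apply: (@le_trans _ _ (\sum_(a <= t < c) \sum_(1 <= i < b.+1) 4 * Dn ((t - L + (L + i))%N%:R / n%:R) ((t - L)%N%:R / n%:R) ^+ 2)).
  by rewrite !big_nat; apply: ler_sum => t ht; exact: hS.
rewrite exchange_big/=.
apply: (@le_trans _ _ (\sum_(1 <= i < b.+1) 4 * (n%:R * (wconst p (C `^ p) * win)))); last first.
  rewrite big_const_nat subn1 /= iter_addr_0 -[leLHS]mulr_natl le_eqVlt; apply/orP; left; apply/eqP; ring.
rewrite !big_nat; apply: ler_sum => i /andP[i1 ib]; rewrite -mulr_sumr ler_wpM2l//.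
have Nl : (c - L + (L + i) <= n.+1)%N by move: La ac cb ib; clear; lia.
apply: (@le_trans _ _ (\sum_(0 <= s < c - L) Dn ((s + (L + i))%N%:R / n%:R) (s%:R / n%:R) ^+ 2)).
  rewrite (_ : index_iota a c = index_iota (a - L + L) (c - L + L)); last first.
    by rewrite !subnK//; move: La ac; clear; lia.
  rewrite big_addn addnK; rewrite [leRHS](big_cat_nat (n := (a - L)%N))//=; last by move: La ac; clear; lia.
  rewrite -[leLHS]add0r; apply: lerD; first by apply: sumr_ge0 => s _; exact: sqr_ge0.
  by under eq_bigr do rewrite addnK.
have hws := window_sq p1 (fun x y => LD_ge0 P eps q (Gn n) y x) (fun x => LDxx P eps (Gn n) q0 x) om01 omD n0 Nl.
apply: le_trans hws _.
rewrite ler_wpM2l// ler_wpM2l// /win; apply: ge0_ler_powR; rewrite ?nnegrE ?divr_ge0//.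
  by rewrite le_max ler0n orbT.
by apply: frac_le; rewrite leq_add2l; move: ib; clear; lia.
Qed.

Lemma grad_err_ge0 t k w : 0 <= grad_err t k w <= 2 * Cf.
Proof. by rewrite /grad_err le_min normr_ge0 mulr_ge0//= ge_min lexx. Qed.

Lemma past_muhat s i : past_fun eps s%:Z (fun w => muhat s n w 0 i).
Proof. by move=> B mB; exact: muhP. Qed.

Lemma grad_err_past t k : past_fun eps (t - L)%N%:Z (grad_err t k).
Proof.
apply/past_funE; rewrite /grad_err.
have mi i : measurable_fun (setT : set (Om eps (t - L)%N%:Z)) (fun w => muhat (t - L)%N n w 0 i).
  by apply/past_funE; exact: past_muhat.
have mg := @meas_comp_continuous _ _ _ _ _ mi (fun x => grad f x 0 k) (grad_continuous tdf).
apply: measurable_minr; first exact: measurable_cst.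
by apply: measurableT_comp => //; apply: measurable_funB.
Qed.

Lemma meas_muhat s i : measurable_fun setT (fun w => muhat s n w 0 i).
Proof. exact: (past_fun_meas meps (@past_muhat s i)). Qed.

Definition pilots_in : set Omega := [set w | forall t, (tau <= t <= n)%N ->
  nbhd_set (conv_curve mu) delta (muhat t n w)].
Definition pilots_far : set Omega := [set w | n%:R `^ (1 - kappa) < pilot_sq w].

Lemma meas_pilots_in : measurable pilots_in.
Proof.
rewrite (_ : pilots_in = \bigcap_(t in [set t | (tau <= t <= n)%N]) (muhat t n @^-1` nbhd_set (conv_curve mu) delta)).
  apply: bigcap_measurableType => t _; apply: meas_open_row; last exact: open_nbhd_set.
  by move=> i; exact: meas_muhat.
by apply/seteqP; split => w h t /h.
Qed.

Lemma meas_pilot_sq : measurable_fun setT pilot_sq.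
Proof.
apply: measurable_sum => t; apply: measX; apply: meas_enorm => i.
rewrite (_ : (fun w => _) = (fun w => muhat t n w 0 i - vexp P (fun w' => Gn n (t%:R / n%:R) (epsseq eps 0 w')) 0 i)).
  by apply: measurable_funB; [exact: meas_muhat|exact: measurable_cst].
by apply/funext => w; rewrite !mxE.
Qed.

Lemma meas_gt (Y : Omega -> R) c : measurable_fun setT Y -> measurable [set w | c < Y w].
Proof.
move=> mY; rewrite (_ : [set w | _] = Y @^-1` `]c, +oo[%classic); last first.
  by apply/seteqP; split => w /=; rewrite in_itv/= andbT.
by rewrite -[X in measurable X]setTI; apply: mY.
Qed.

Lemma meas_pilots_far : measurable pilots_far.
Proof. exact: meas_gt meas_pilot_sq. Qed.

Definition bad : set Omega := ~` pilots_in `|` pilots_far.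

Lemma meas_bad : measurable bad.
Proof. by apply: measurableU; [apply: measurableC; exact: meas_pilots_in|exact: meas_pilots_far]. Qed.

(** Chosen with del^2 = n^(-kappa): the average squared pilot error, at most n^(-kappa) on the good
    event, is again del after division by del. *)
Let del : R := n%:R `^ (- (kappa / 2)).
Definition grad_rate : R := d%:R * Cf * ((d%:R + 1) * del + 2 * d%:R * eta n).

Lemma grad_err_near t k w : pilots_in w -> (tau + L <= t <= n)%N ->
  grad_err t k w <= d%:R * Cf * (d%:R * del + 2 * d%:R * eta n +
    enorm (muhat (t - L)%N n w - vexp P (fun w' => Gn n ((t - L)%N%:R / n%:R) (epsseq eps 0 w'))) ^+ 2 / del).
Proof.
move=> hin /andP[tL tn].
have sn : (t - L <= n)%N by move: tn; clear; lia.
have s01 := @frac01 R n _ sn.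
have del0 : 0 < del by rewrite powR_gt0.
rewrite ge_min; apply/orP; right; rewrite /gg /gL tn.
have hn : nbhd_set (conv_curve mu) delta (muhat (t - L)%N n w).
  by apply: hin; move: tL sn; clear; lia.
apply: (le_trans (grad_lip k tdf s01 A4 hn)).
rewrite ler_wpM2l ?mulr_ge0//; apply: (le_trans (enorm_le_sum _)).
rewrite -pilot_err_sum// mulr_suml.
apply: (@le_trans _ _ (\sum_(j < d) (del + 2 * eta n + pilot_err (t - L) j w ^+ 2 / del))).
  apply: ler_sum => j _.
  have h1 := Gn_mean_gap n j s01.
  (* This inequality lets a rate for sums of squares bound sums of absolute values. *)
  have h2 : `|pilot_err (t - L) j w| <= del + pilot_err (t - L) j w ^+ 2 / del.
    have := sqr_ge0 (`|pilot_err (t - L) j w| - del); rewrite sqrrB real_normK ?num_real// => h.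
    rewrite -(ler_pM2r del0) mulrDl divfK ?gt_eqF//.
    have := mulr_ge0 (normr_ge0 (pilot_err (t - L) j w)) (ltW del0).
    move: h; rewrite -expr2; set x := `|_|; lra.
  have -> : (muhat (t - L)%N n w - mu ((t - L)%N%:R / n%:R)) 0 j = pilot_err (t - L) j w +
     (Ex P (fun w => Gn n ((t - L)%N%:R / n%:R) (epsseq eps 0 w) 0 j) - mean ((t - L)%N%:R / n%:R) j).
    by rewrite /pilot_err Xm_vexp// !mxE /mean /Ex /Rintegral; ring.
  apply: (le_trans (ler_normD _ _)); move: h1 h2; lra.
by rewrite !big_split/= !sum_ord_cst le_eqVlt; apply/orP; left; apply/eqP; ring.
Qed.

(** On the bad event the cut gives 2 Cf. Elsewhere the linearised bounds of [grad_err_near] average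
    to a rate, the sum of squares being at most n^(1-kappa). *)
Lemma grad_err_path c k w : (c <= n.+1)%N ->
  n%:R^-1 * \sum_(tau + L <= t < c) grad_err t k w <= 2 * Cf * \1_bad w + grad_rate.
Proof.
move=> cn; have del0 : 0 < del by rewrite powR_gt0.
have rate0 : 0 <= grad_rate.
  by rewrite /grad_rate !mulr_ge0// addr_ge0// !mulr_ge0// ?addr_ge0// ltW.
have sum_cst (x : R) : 0 <= x -> n%:R^-1 * (\sum_(tau + L <= t < c) x) <= x.
  move=> x0; rewrite big_const_nat iter_addr_0 -[X in _ * X]mulr_natl mulrA ler_piMl// mulrC ler_pdivrMr// mul1r ler_nat.
  by move: cn tau0; clear; lia.
case: (pselect (bad w)) => hb.
  rewrite indicE mem_set// mulr1; apply: (@le_trans _ _ (2 * Cf)); last by rewrite lerDl.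
  apply: le_trans (sum_cst (2 * Cf) _); last by rewrite mulr_ge0.
  by rewrite ler_wpM2l ?invr_ge0//; apply: ler_sum => t _; have /andP[] := grad_err_ge0 t k w.
rewrite indicE memNset// mulr0 add0r.
have hin : pilots_in w by apply: contrapT => h; apply: hb; left.
have hfar : pilot_sq w <= n%:R `^ (1 - kappa).
  by rewrite leNgt; apply/negP => h; apply: hb; right.
pose q2 s := enorm (muhat s n w - vexp P (fun w' => Gn n (s%:R / n%:R) (epsseq eps 0 w'))) ^+ 2.
apply: (@le_trans _ _ (n%:R^-1 * \sum_(tau + L <= t < c) d%:R * Cf * (d%:R * del + 2 * d%:R * eta n + q2 (t - L)%N / del))).
  rewrite ler_wpM2l ?invr_ge0// !big_nat; apply: ler_sum => t /andP[tL tc]; apply: grad_err_near => //.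
  by rewrite tL/=; move: tc cn; clear; lia.
rewrite -mulr_sumr mulrCA /grad_rate ler_wpM2l ?mulr_ge0// big_split/= mulrDr.
have h1 := sum_cst (d%:R * del + 2 * d%:R * eta n).
have h2 : n%:R^-1 * \sum_(tau + L <= t < c) q2 (t - L)%N / del <= del.
  rewrite -mulr_suml mulrA ler_pdivrMr// -expr2.
  have -> : del ^+ 2 = n%:R^-1 * n%:R `^ (1 - kappa).
    rewrite -powR_mulrn ?powR_ge0// -powRrM powRB; last by rewrite (gt_eqF np) implybT.
    rewrite powRr1// mulrA mulVf ?gt_eqF// mul1r -powRN; congr (_ `^ _); lra.
  apply: ler_wpM2l; first by rewrite invr_ge0.
  apply: le_trans hfar.
  have [ca|ac] := leqP c (tau + L).
    by rewrite big_geq//; apply: sumr_ge0 => t _; exact: sqr_ge0.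
  rewrite (_ : index_iota (tau + L) c = index_iota (tau + L) (c - L + L)); last first.
    by rewrite subnK//; move: ac; clear; lia.
  rewrite big_addn addnK /pilot_sq [leRHS](big_cat_nat (n := (c - L)%N))//=; first last.
  - by move: cn; clear; lia.
  - by move: ac; clear; lia.
  rewrite -[leLHS]addr0; apply: lerD; last by apply: sumr_ge0 => t _; exact: sqr_ge0.
  by apply: ler_sum => s _; rewrite addnK /q2.
have h3 : 0 <= d%:R * del + 2 * d%:R * eta n by rewrite addr_ge0// !mulr_ge0// ltW.
apply: (le_trans (lerD (h1 h3) h2)).
by rewrite le_eqVlt; apply/orP; left; apply/eqP; ring.
Qed.

Lemma Ex_indic D : measurable D -> Ex P (\1_D) = fine (P D).
Proof. by move=> mD; rewrite /Ex /Rintegral integral_indic// setIT. Qed.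

Definition grad_mean : R := 2 * Cf * fine (P bad) + grad_rate.

Lemma grad_err_intg t k : intg P (grad_err t k).
Proof.
apply: (intg_le _ (intg_cst P (2 * Cf))); first exact: (past_fun_meas meps (@grad_err_past t k)).
move=> w; have /andP[h1 h2] := grad_err_ge0 t k w.
by rewrite !ger0_norm// (le_trans h1).
Qed.

Lemma grad_err_avg c k : (c <= n.+1)%N ->
  n%:R^-1 * \sum_(tau + L <= t < c) Ex P (grad_err t k) <= grad_mean.
Proof.
move=> cn.
have iS : intg P (fun w => \sum_(tau + L <= t < c) grad_err t k w).
  by apply: intg_sum => t _; exact: grad_err_intg.
have i1 : intg P (\1_bad) by exact: L2_intg (L2_indic P meas_bad).
rewrite -(Ex_sum _ (fun t _ => grad_err_intg t k)) -(ExZ _ iS).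
apply: (@le_trans _ _ (Ex P (fun w => 2 * Cf * \1_bad w + grad_rate))).
  apply: le_Ex; [exact: intgZ|apply: intgD; [exact: intgZ|exact: intg_cst]|].
  by move=> w; exact: grad_err_path.
rewrite (ExD (intgZ _ i1) (intg_cst P _)) Ex_cst (ExZ _ i1) Ex_indic//; exact: meas_bad.
Qed.

Let c0 := (n.+1 - b)%N.
Let c0n : (c0 <= n.+1)%N. Proof. exact: leq_subr. Qed.
Let c0b t : (t < c0)%N -> (t + b <= n)%N. Proof. by rewrite /c0; clear; lia. Qed.
Let c0b' : (0 < c0)%N -> (c0 + b <= n.+1)%N. Proof. by rewrite /c0; clear; lia. Qed.

(** Sums of nonnegative terms up to the last admissible index c0, hence a bound for the partial sums
    at all u simultaneously; the remaining errors are deterministic on the good event and form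
    [det_err]. *)
Definition majorant e w : R :=
  (1 + e^-1) * (4 * d%:R * Cf * (n%:R^-1 * \sum_(tau + L <= t < c0) \sum_k grad_err t k w * (b%:R^-1 * S t k w ^+ 2)))
  + e * (n%:R^-1 * \sum_(tau + L <= t < c0) Z t w).
Definition det_err e : R :=
  (1 + e^-1) * (4 * d%:R * Cf ^+ 2 * (d%:R * (4 * wconst p (C `^ p) * (b%:R * win)) + b%:R * n%:R `^ (- kappa))).

Lemma Z_ge0 t w : 0 <= Z t w.
Proof. by rewrite /Z /Zf mulr_ge0 ?sqr_ge0// invr_ge0. Qed.

Lemma path_bound e c w : 0 < e -> pilots_in w -> pilot_sq w <= n%:R `^ (1 - kappa) -> (c <= c0)%N ->
  `|n%:R^-1 * (\sum_(tau + L <= t < c) summand t w) - n%:R^-1 * \sum_(tau + L <= t < c) Z t w| <=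
  majorant e w + det_err e.
Proof.
move=> e0 hin hfar cc0.
have ei : 0 <= 1 + e^-1 by rewrite addr_ge0// invr_ge0 ltW.
pose bnd t := (1 + e^-1) * (4 * d%:R * Cf * (\sum_k grad_err t k w * (b%:R^-1 * S t k w ^+ 2)) +
     4 * d%:R * Cf ^+ 2 * \sum_k (b%:R^-1 * shift_mean t k ^+ 2 + b%:R * pilot_err (t - L) k w ^+ 2)) +
  e * Z t w.
have bi : 0 <= b%:R^-1 :> R by rewrite invr_ge0.
have bnd0 t : 0 <= bnd t.
  apply: addr_ge0; last by apply: mulr_ge0; [exact: ltW|exact: Z_ge0].
  apply: mulr_ge0 => //; apply: addr_ge0.
    apply: mulr_ge0; first by rewrite !mulr_ge0.
    apply: sumr_ge0 => k _; apply: mulr_ge0; first by have /andP[] := grad_err_ge0 t k w.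
    by apply: mulr_ge0 => //; exact: sqr_ge0.
  apply: mulr_ge0; first by rewrite !mulr_ge0// sqr_ge0.
  by apply: sumr_ge0 => k _; apply: addr_ge0; apply: mulr_ge0 => //; exact: sqr_ge0.
have h t : (tau + L <= t < c)%N -> `|summand t w - Z t w| <= bnd t.
  move=> /andP[tL tc]; apply: summand_bound => //; apply: hin.
  by move: tL tc cc0 c0n; clear; lia.
apply: (@le_trans _ _ (n%:R^-1 * \sum_(tau + L <= t < c0) bnd t)).
  rewrite -mulrBr -sumrB normrM ger0_norm ?invr_ge0//; apply: ler_wpM2l; first by rewrite invr_ge0.
  apply: (le_trans (ler_norm_sum _ _ _)).
  apply: (@le_trans _ _ (\sum_(tau + L <= t < c) bnd t)).
    by rewrite !big_nat; apply: ler_sum => t ht; exact: h.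
  have [ca|ac] := leqP c (tau + L).
    by rewrite big_geq//; apply: sumr_ge0 => t _; exact: bnd0.
  rewrite [leRHS](big_cat_nat (n := c))//=; last exact: ltnW.
  by rewrite lerDl; apply: sumr_ge0 => t _; exact: bnd0.
have hE := @pilot_avg c0 w c0n.
have hE2 : b%:R / n%:R * pilot_sq w <= b%:R * n%:R `^ (- kappa).
  rewrite -mulrA; apply: ler_wpM2l => //; rewrite ler_pdivrMl//.
  apply: (le_trans hfar); rewrite powRB; last by rewrite (gt_eqF np) implybT.
  by rewrite powRr1// powRN.
have hD : n%:R^-1 * \sum_(tau + L <= t < c0) \sum_k b%:R^-1 * shift_mean t k ^+ 2 <=
   d%:R * (4 * wconst p (C `^ p) * (b%:R * win)).
  rewrite exchange_big/= mulr_sumr -sum_ord_cst; apply: ler_sum => k _.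
  have [c00|/c0b' cb] := posnP c0.
    rewrite c00 big_geq// mulr0 !mulr_ge0 ?powR_ge0// /wconst addr_ge0// mulr_ge0 ?powR_ge0//.
  by apply: shift_mean_avg => //; exact: leq_addl.
rewrite (eq_bigr (fun t => (1 + e^-1) * (4 * d%:R * Cf * (\sum_k grad_err t k w * (b%:R^-1 * S t k w ^+ 2)) +
   4 * d%:R * Cf ^+ 2 * (\sum_k b%:R^-1 * shift_mean t k ^+ 2 + \sum_k b%:R * pilot_err (t - L) k w ^+ 2)) +
  e * Z t w)); last by move=> t _; rewrite /bnd big_split.
rewrite sum_lin /majorant /det_err.
set A1 := \sum_(tau + L <= t < c0) _; set A2 := \sum_(tau + L <= t < c0) _ in hD *.
set A3' := \sum_(tau + L <= t < c0) _ in hE *; set A4' := \sum_(tau + L <= t < c0) _.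
have -> : n%:R^-1 * ((1 + e^-1) * (4 * d%:R * Cf * A1 + 4 * d%:R * Cf ^+ 2 * (A2 + A3')) + e * A4') =
   (1 + e^-1) * (4 * d%:R * Cf * (n%:R^-1 * A1)) + e * (n%:R^-1 * A4') +
   (1 + e^-1) * (4 * d%:R * Cf ^+ 2 * (n%:R^-1 * A2 + n%:R^-1 * A3')) by ring.
rewrite lerD2l; apply: ler_wpM2l => //; apply: ler_wpM2l; first by rewrite !mulr_ge0// sqr_ge0.
by apply: lerD => //; exact: le_trans hE hE2.
Qed.

Let C2' := C2 C rho Cc.

Definition maj_bound e : R :=
  (1 + e^-1) * (4 * d%:R * Cf * (d%:R * (C2' * grad_mean + 2 * Cf * (Cs * rho ^+ L * (2 * (4 * C))))))
  + e * (d%:R * (d%:R * (Cf ^+ 2 * C2'))).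

Lemma Z_mean t : (t + b <= n)%N -> Ex P (Z t) <= d%:R * (d%:R * (Cf ^+ 2 * C2')).
Proof.
move=> tb; have LS k := (sf_L4 meps mepss indep ident (mGn n) q4 C0 (KC n) k tb).1.
have i1 k : intg P (fun w => S t k w ^+ 2) by exact: L2_intg (L4_sqr (LS k)).
have [LZ _] := Zf_L2 meps mepss indep ident (mGn n) q4 C0 (KC n) b0 Cf0 ggC tb.
have iR : intg P (fun w => b%:R^-1 * (d%:R * Cf ^+ 2) * \sum_k S t k w ^+ 2).
  by apply: intgZ; apply: intg_sum => k _; exact: i1.
apply: (@le_trans _ _ (Ex P (fun w => b%:R^-1 * (d%:R * Cf ^+ 2) * \sum_k S t k w ^+ 2))).
  apply: le_Ex => //; first exact: L2_intg LZ.
  move=> w; rewrite /Z /Zf -mulrA; apply: ler_wpM2l; first by rewrite invr_ge0.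
  rewrite /tf; apply: (le_trans (sqr_sum_ord _)); rewrite -mulrA; apply: ler_wpM2l => //.
  rewrite mulr_sumr; apply: ler_sum => k _; rewrite exprMn; apply: ler_wpM2r; first exact: sqr_ge0.
  by rewrite -[leLHS]real_normK ?num_real// lerXn2r ?nnegrE//; exact: ggC.
rewrite ExZ; last by apply: intg_sum => k _; exact: i1.
rewrite Ex_sum; last by move=> k _; exact: i1.
apply: (@le_trans _ _ (b%:R^-1 * (d%:R * Cf ^+ 2) * (d%:R * (C2' * b%:R)))).
  apply: ler_wpM2l; first by rewrite !mulr_ge0 ?invr_ge0 ?sqr_ge0.
  rewrite -sum_ord_cst; apply: ler_sum => k _.
  exact: (sf_moment2 meps mepss indep ident (mGn n) q4 C0 rho01 (KC n) (fun j => A3 j n) Cc0 Cc_le).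
by rewrite le_eqVlt; apply/orP; left; apply/eqP; field; exact: lt0r_neq0.
Qed.

Lemma majorant_intg e : 0 < e -> intg P (majorant e) /\ Ex P (majorant e) <= maj_bound e.
Proof.
move=> e0; have ei : 0 <= 1 + e^-1 by rewrite addr_ge0// invr_ge0 ltW.
pose good t := (tau + L <= t < c0)%N.
have LZ t : good t -> intg P (Z t).
  move=> /andP[_ /c0b tb].
  have [LZ _] := Zf_L2 meps mepss indep ident (mGn n) q4 C0 (KC n) b0 Cf0 ggC tb; exact: L2_intg LZ.
pose Y t k w := grad_err t k w * S t k w ^+ 2.
pose c1 := 2 * Cf * (Cs * rho ^+ L * (2 * (b%:R * (4 * C)))).
have hW t k : good t -> intg P (Y t k) /\ Ex P (Y t k) <= C2' * b%:R * Ex P (grad_err t k) + c1.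
  move=> /andP[tL /c0b tb].
  (* The gradient error is known at time t - L and the block begins after t; this lag yields the
     factor rho^L. *)
  have ts : t%:Z = (t - L)%N%:Z + L%:Z by move: tL; clear; lia.
  apply: (W_bound meps mepss indep ident (mGn n) q4 C0 rho01 (KC n) (fun j => A3 j n) Cc0 Cc_le Cs_le k tb ts).
  - exact: grad_err_past.
  - by rewrite mulr_ge0.
  - exact: grad_err_ge0.
have E : majorant e = (fun w => (1 + e^-1) * (4 * d%:R * Cf * n%:R^-1 * b%:R^-1) *
     (\sum_(tau + L <= t < c0 | good t) \sum_k Y t k w) + e * n%:R^-1 * \sum_(tau + L <= t < c0 | good t) Z t w).
  apply/funext => w; rewrite /majorant.
  have -> : \sum_(tau + L <= t < c0) \sum_k grad_err t k w * (b%:R^-1 * S t k w ^+ 2) =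
     b%:R^-1 * \sum_(tau + L <= t < c0 | good t) \sum_k Y t k w.
    rewrite big_nat mulr_sumr; apply: eq_bigr => t _; rewrite mulr_sumr; apply: eq_bigr => k _.
    by rewrite /Y; ring.
  by rewrite [X in e * (_ * X)]big_nat; ring.
have iY : intg P (fun w => \sum_(tau + L <= t < c0 | good t) \sum_k Y t k w).
  by apply: intg_sum => t gt; apply: intg_sum => k _; exact: (hW t k gt).1.
have iZ : intg P (fun w => \sum_(tau + L <= t < c0 | good t) Z t w) by exact: intg_sum.
rewrite E; split; first by apply: intgD; exact: intgZ.
rewrite (ExD (intgZ _ iY) (intgZ _ iZ)) (ExZ _ iY) (ExZ _ iZ) /maj_bound.
have np' : 0 <= n%:R^-1 :> R by rewrite invr_ge0.
have bp' : 0 <= b%:R^-1 :> R by rewrite invr_ge0.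
have cnt (x : R) : 0 <= x -> n%:R^-1 * (\sum_(tau + L <= t < c0) x) <= x.
  move=> x0; rewrite big_const_nat iter_addr_0 -[X in _ * X]mulr_natl mulrA ler_piMl// mulrC ler_pdivrMr// mul1r ler_nat.
  by move: c0n tau0; clear; lia.
apply: lerD; last first.
  rewrite -mulrA; apply: ler_wpM2l; first exact: ltW.
  rewrite (Ex_sum _ LZ).
  have z0 : 0 <= d%:R * (d%:R * (Cf ^+ 2 * C2')) :> R.
    do 3!(apply: mulr_ge0 => //); first exact: sqr_ge0.
    exact: C2_ge0.
  apply: le_trans (cnt _ z0); apply: ler_wpM2l => //; rewrite [leRHS]big_nat; apply: ler_sum => t gt.
  by apply: Z_mean; case/andP: gt => _ /c0b.
rewrite -[leLHS]mulrA; apply: ler_wpM2l => //.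
have -> : 4 * d%:R * Cf * n%:R^-1 * b%:R^-1 * Ex P (fun w => \sum_(tau + L <= t < c0 | good t) \sum_k Y t k w) =
  4 * d%:R * Cf * (n%:R^-1 * (b%:R^-1 * Ex P (fun w => \sum_(tau + L <= t < c0 | good t) \sum_k Y t k w))) by ring.
apply: ler_wpM2l; first by rewrite !mulr_ge0.
rewrite Ex_sum; last by move=> t gt; apply: intg_sum => k _; exact: (hW t k gt).1.
have c10 : 0 <= 2 * Cf * (Cs * rho ^+ L * (2 * (4 * C))).
  by rewrite !mulr_ge0// exprn_ge0// ltW.
apply: (@le_trans _ _ (n%:R^-1 * \sum_(tau + L <= t < c0) \sum_k (C2' * Ex P (grad_err t k) + 2 * Cf * (Cs * rho ^+ L * (2 * (4 * C)))))).
  apply: ler_wpM2l => //; rewrite [leRHS]big_nat mulr_sumr; apply: ler_sum => t gt.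
  rewrite Ex_sum; last by move=> k _; exact: (hW t k gt).1.
  rewrite mulr_sumr; apply: ler_sum => k _; rewrite ler_pdivrMl//.
  apply: (le_trans (hW t k gt).2).
  by rewrite le_eqVlt; apply/orP; left; apply/eqP; rewrite /c1; ring.
rewrite exchange_big/= mulr_sumr -[leRHS]sum_ord_cst; apply: ler_sum => k _.
rewrite big_split/= mulrDr; apply: lerD; last exact: cnt.
rewrite -mulr_sumr mulrCA; apply: ler_wpM2l; first exact: C2_ge0.
exact: grad_err_avg.
Qed.

(** * Uniformity in u and the probability of a large deviation *)

Let mx0 : measurable_fun setT (x0 eps) := meas_x0 meps mepss.
Let M0 : 0 <= avar_max.
Proof. by apply: le_trans (avar_bound (v := 0) _); rewrite ?normr_ge0// lexx ler01. Qed.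

Definition stop (u : R) : nat := ((Num.truncn (n%:R * u)).+1 - b)%N.
Definition Qsum c w : R := n%:R^-1 * \sum_(tau + L <= t < c) summand t w.
Definition Zsum c w : R := n%:R^-1 * \sum_(tau + L <= t < c) Z t w.

Lemma stop_le u : 0 <= u <= 1 -> (stop u <= c0)%N.
Proof.
move=> /andP[u0 u1]; rewrite /stop /c0 leq_sub2r// ltnS -(ler_nat R).
have nu0 : 0 <= n%:R * u by rewrite mulr_ge0.
by have /andP[h _] := truncn_itv nu0; apply: (le_trans h); rewrite ler_piMr.
Qed.

Lemma stop_mono u v : 0 <= u -> u <= v -> (stop u <= stop v)%N.
Proof.
by move=> u0 uv; rewrite /stop leq_sub2r// ltnS; apply: le_truncn; rewrite ler_wpM2l.
Qed.

Lemma Zsum_mono c c' w : (c <= c')%N -> Zsum c w <= Zsum c' w.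
Proof.
move=> cc; rewrite /Zsum; apply: ler_wpM2l; first by rewrite invr_ge0.
have [ca|ac] := leqP c (tau + L).
  by rewrite big_geq//; apply: sumr_ge0 => t _; exact: Z_ge0.
rewrite [leRHS](big_cat_nat (n := c))//=; last exact: ltnW.
by rewrite lerDl; apply: sumr_ge0 => t _; exact: Z_ge0.
Qed.

Definition grid_err (m : nat) w : R :=
  \sum_(j < m.+1) `|Zsum (stop (j%:R / m%:R)) w - prim avar (j%:R / m%:R)|.

(** [Zsum] at u lies between its values at the neighbouring grid points; for [prim] the Lipschitz
    constant avar_max accounts for the mesh. *)
Lemma grid_bound m u w : (0 < m)%N -> 0 <= u <= 1 ->
  `|Zsum (stop u) w - prim avar u| <= grid_err m w + avar_max / m%:R.
Proof.
move=> m0 /andP[u0 u1]; have mp : 0 < m%:R :> R by rewrite ltr0n.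
have mu0 : 0 <= m%:R * u by rewrite mulr_ge0.
have /andP[j1 j2] := truncn_itv mu0; set j := Num.truncn _ in j1 j2.
have jm : (j <= m)%N by rewrite -(ler_nat R); apply: (le_trans j1); rewrite ler_piMr.
(* At u = 1 the left grid point is already the last one. *)
pose j' := minn j.+1 m.
have jm' : (j' <= m)%N by exact: geq_minr.
have one i (im : (i <= m)%N) : `|Zsum (stop (i%:R / m%:R)) w - prim avar (i%:R / m%:R)| <= grid_err m w.
  have im' : (i < m.+1)%N by [].
  rewrite /grid_err (bigD1 (Ordinal im'))//= lerDl; exact: sumr_ge0.
have h1 := one j jm; have h2 := one j' jm'.
have uj : j%:R / m%:R <= u by rewrite ler_pdivrMr// mulrC.
have uj' : u <= j'%:R / m%:R.
  rewrite ler_pdivlMr// mulrC /j' /minn; case: ltnP => _; first exact: ltW.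
  by rewrite ler_piMr.
have /andP[a0 _] := @frac01 R m j jm; have /andP[_ a1] := @frac01 R m j' jm'.
have z1 := Zsum_mono w (stop_mono a0 uj).
have z2 := Zsum_mono w (stop_mono u0 uj').
have p1' := prim_lip avar_meas avar_bound a0 uj u1; have p2' := prim_lip avar_meas avar_bound u0 uj' a1.
have d1 : (u - j%:R / m%:R) * avar_max <= avar_max / m%:R.
  rewrite mulrC ler_wpM2l// lerBlDr -[X in X + _]mul1r -mulrDl ler_pdivlMr// mulrC addrC natr1.
  exact: ltW.
have d2 : (j'%:R / m%:R - u) * avar_max <= avar_max / m%:R.
  rewrite mulrC ler_wpM2l// lerBlDr -[X in X + _]mul1r ler_pdivrMr// mulrDl divfK ?gt_eqF// mulrC [_ * u]mulrC.
  apply: (@le_trans _ _ (1 + j%:R)); last by rewrite lerD2l mulrC.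
  by rewrite addrC natr1 ler_nat geq_minl.
move: h1 h2 z1 z2 p1' p2' d1 d2.
set x1 := Zsum _ w; set x2 := Zsum _ w; set x3 := Zsum _ w.
set y1 := prim avar _; set y2 := prim avar _; set y3 := prim avar _.
set g := grid_err m w; set c1 := (u - _) * avar_max; set c2 := (_ - u) * avar_max; set c3 := avar_max / _.
rewrite !ler_norml => /andP[? ?] /andP[? ?] ? ? /andP[? ?] /andP[? ?] ? ?; apply/andP; split; lra.
Qed.

Definition var_rate : R := K1 (d := d) C Cf * (b%:R ^+ 3 / n%:R) + K2 (d := d) C Cs Cf * (b%:R * rho ^+ b).
Definition bias_rate : R := cellB (Xrate n b L) b + avar_max * ((tau + L + b)%N%:R / n%:R).

Lemma Zsum_mean u : 0 <= u <= 1 ->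
  intg P (fun w => `|Zsum (stop u) w - prim avar u|) /\
  Ex P (fun w => `|Zsum (stop u) w - prim avar u|) <= Num.sqrt var_rate + bias_rate.
Proof.
move=> u01.
have hac t : (tau + L <= t < stop u)%N -> (t + b <= n)%N.
  by move=> /andP[_ tc]; apply: c0b; apply: leq_trans tc (stop_le u01).
have [LZ hZ] := var_avg meps mepss indep ident (mGn n) q4 C0 rho01 (KC n) (fun j => A3 j n) Cc0 Cs0 Cc_le Cs_le n0 b0 Cf0 ggC hac.
have hB := bias n0 b0 (leq_addl tau L) u01.
set EZ := n%:R^-1 * _ in hB; rewrite -[n%:R^-1 * _]/EZ in hZ.
have LZ' : L2 P (Zsum (stop u)) by exact: LZ.
have LD1 : L2 P (fun w => Zsum (stop u) w - EZ) by apply: L2B LZ' (L2_cst _ _).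
have LD2 : L2 P (fun w => Zsum (stop u) w - prim avar u) by apply: L2B LZ' (L2_cst _ _).
split; first by apply: intg_abs; exact: L2_intg.
apply: (le_trans (Exabs_le_N2 LD2)).
rewrite (_ : (fun w => _) = (fun w => (Zsum (stop u) w - EZ) + (EZ - prim avar u))); last by apply/funext => w; ring.
apply: (le_trans (N2D LD1 (L2_cst _ _))); rewrite N2_cst; apply: lerD => //.
rewrite -[leLHS]ger0_norm ?N2_ge0// -sqrtr_sqr ler_sqrt//.
exact: le_trans (sqr_ge0 _) hZ.
Qed.

Lemma meas_summand t : measurable_fun setT (summand t).
Proof.
rewrite (_ : summand t = fun w => b%:R^-1 *
  (\sum_k grad f (muhat (t - L)%N n w) 0 k * (S t k w + shift_mean t k - b%:R * pilot_err (t - L) k w)) ^+ 2); last first.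
  by apply/funext => w; exact: summandE.
apply: measurable_funM; first exact: measurable_cst.
apply: measX; apply: measurable_sum => k; apply: measurable_funM.
  exact: (@meas_comp_continuous _ _ _ _ _ (fun i => @meas_muhat (t - L)%N i) (fun x => grad f x 0 k) (grad_continuous tdf)).
apply: measurable_funB.
  apply: measurable_funD; last exact: measurable_cst.
  by apply: measurableT_comp mx0; exact: meas_sf.
apply: measurable_funM; first exact: measurable_cst.
by apply: measurable_funB; [exact: meas_muhat|exact: measurable_cst].
Qed.

Definition large_dev (x : R) : set Omega :=
  [set w | exists u : R, 0 <= u <= 1 /\ x < `|Qsum (stop u) w - prim avar u|].

(** The union over u is uncountable, but [Qsum (stop u)] depends on u only through the integer part
    k of n u. For fixed k the event is the preimage of a union of open half-lines, which is open. *)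
Lemma meas_large_dev x : measurable (large_dev x).
Proof.
pose O k := \bigcup_(u in [set u : R | 0 <= u <= 1 /\ Num.truncn (n%:R * u) = k])
  ([set y : R | y < prim avar u - x] `|` [set y : R | prim avar u + x < y]).
rewrite (_ : large_dev x = \bigcup_k (Qsum (k.+1 - b) @^-1` O k)).
  apply: bigcupT_measurable => k; rewrite -[X in measurable X]setTI.
  have mq : measurable_fun setT (Qsum (k.+1 - b)).
    apply: measurable_funM; first exact: measurable_cst.
    by apply: measurable_sum => t; exact: meas_summand.
  apply: mq => //; apply: open_measurable; apply: bigcup_open => u _.
  by apply: openU; [exact: open_lt|exact: open_gt].
apply/seteqP; split => w.
  move=> [u [u01 h]]; exists (Num.truncn (n%:R * u)) => //=; exists u => //=.
  by move: h; rewrite ltr_normr /stop => /orP[h|h]; [right|left]; move: h; rewrite /=; lra.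
move=> [k _ [u [u01 uk]]] h; exists u; split => //; rewrite /stop uk ltr_normr.
by case: h => /= h; apply/orP; [right|left]; move: h; lra.
Qed.

Lemma majorant_ge0 e w : 0 < e -> 0 <= majorant e w.
Proof.
move=> e0; have ei : 0 <= 1 + e^-1 by rewrite addr_ge0// invr_ge0 ltW.
have ni : 0 <= n%:R^-1 :> R by rewrite invr_ge0.
apply: addr_ge0; apply: mulr_ge0 => //.
- apply: mulr_ge0; first by rewrite !mulr_ge0.
  apply: mulr_ge0 => //; apply: sumr_ge0 => t _; apply: sumr_ge0 => k _; apply: mulr_ge0.
    by have /andP[] := grad_err_ge0 t k w.
  by apply: mulr_ge0; [rewrite invr_ge0|exact: sqr_ge0].
- exact: ltW.
- by apply: mulr_ge0 => //; apply: sumr_ge0 => t _; exact: Z_ge0.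
Qed.

(** Half of x absorbs the deterministic terms, so outside the bad event the random part exceeds x/2,
    and Markov's inequality applies to it. Each of the m + 1 grid points contributes one mean. *)
Lemma large_dev_prob (x e : R) (m : nat) : 0 < x -> 0 < e -> (0 < m)%N -> det_err e + avar_max / m%:R <= x / 2 ->
  fine (P (large_dev x)) <= fine (P bad) +
    2 / x * (maj_bound e + m.+1%:R * (Num.sqrt var_rate + bias_rate)).
Proof.
move=> x0 e0 m0 hx.
pose H w := majorant e w + grid_err m w.
have [iM hM] := majorant_intg e0.
have fr (j : 'I_m.+1) := @frac01 R m j (ltn_ord j).
have iG : intg P (grid_err m) by apply: intg_sum => j _; exact: (Zsum_mean (fr j)).1.
have iH : intg P H by exact: intgD.
have hH : Ex P H <= maj_bound e + m.+1%:R * (Num.sqrt var_rate + bias_rate).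
  rewrite (ExD iM iG); apply: lerD => //; rewrite /grid_err Ex_sum; last first.
    by move=> j _; exact: (Zsum_mean (fr j)).1.
  by rewrite -[leRHS]sum_ord_cst; apply: ler_sum => j _; exact: (Zsum_mean (fr j)).2.
have mH : measurable [set w | x / 2 < H w] by apply: meas_gt; exact: (intg_meas iH).
have sub : large_dev x `<=` bad `|` [set w | x / 2 < H w].
  move=> w [u [u01 h]]; case: (pselect (bad w)) => hb; [by left|right => /=].
  have hin : pilots_in w by apply: contrapT => hh; apply: hb; left.
  have hfar : pilot_sq w <= n%:R `^ (1 - kappa).
    by rewrite leNgt; apply/negP => hh; apply: hb; right.
  have k1 := path_bound e0 hin hfar (stop_le u01).
  have k2 := grid_bound w m0 u01.
  have k3 : `|Qsum (stop u) w - prim avar u| <= (majorant e w + det_err e) + (grid_err m w + avar_max / m%:R).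
    have -> : Qsum (stop u) w - prim avar u = (Qsum (stop u) w - Zsum (stop u) w) + (Zsum (stop u) w - prim avar u) by ring.
    exact: le_trans (ler_normD _ _) (lerD k1 k2).
  have := lt_le_trans h k3; rewrite /H; move: hx x0; set c1 := avar_max / _; lra.
have H0 w : 0 <= H w by rewrite /H addr_ge0 ?majorant_ge0//; apply: sumr_ge0.
have fin A : measurable A -> P A \is a fin_num by move=> mA; exact: fin_num_measure.
have pH : fine (P [set w | x / 2 < H w]) <= 2 / x * Ex P H.
  have i1 : intg P (fun w => x / 2 * \1_[set w | x / 2 < H w] w) by apply: intgZ; exact: L2_intg (L2_indic P mH).
  have h : x / 2 * fine (P [set w | x / 2 < H w]) <= Ex P H.
    rewrite -Ex_indic// -(ExZ _ (L2_intg (L2_indic P mH))).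
    apply: le_Ex => // w; rewrite indicE; case: (pselect (x / 2 < H w)) => hw.
      by rewrite mem_set// mulr1 ltW.
    by rewrite memNset// mulr0.
  rewrite (_ : fine (P [set w | x / 2 < H w]) = 2 / x * (x / 2 * fine (P [set w | x / 2 < H w]))); last first.
    by field; exact: lt0r_neq0.
  by apply: ler_wpM2l => //; rewrite divr_ge0// ltW.
have h1 : fine (P (large_dev x)) <= fine (P bad) + fine (P [set w | x / 2 < H w]).
  rewrite -fineD ?fin//; last exact: meas_bad.
  apply: fine_le; rewrite ?fin//; [exact: meas_large_dev|by rewrite fin_numD !fin//; exact: meas_bad|].
  apply: le_trans (measureU2 _ meas_bad mH).
  by apply: le_measure sub; rewrite inE; [exact: meas_large_dev|apply: measurableU => //; exact: meas_bad].
apply: (le_trans h1); rewrite lerD2l; apply: (le_trans pH); apply: ler_wpM2l => //.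
by rewrite divr_ge0// ltW.
Qed.

End FixedSample.

(** * Limits *)

Section Limit.

Variable muhat : nat -> nat -> Omega -> 'rV[R]_d.
Hypothesis muhP : forall t n (i : 'I_d) (B : set R), measurable B ->
  past_sigma eps t%:Z ((fun w => muhat t n w 0 i) @^-1` B).
Variables (b L tau : nat -> nat) (kappa : R).
Hypotheses (tau0 : forall n, (0 < tau n)%N) (kappa0 : 0 < kappa).
Hypothesis L_infty : (fun n => (L n)%:R : R) @ \oo --> (+oo : set_system R).
Hypothesis tau_n : (fun n => (tau n)%:R / n%:R : R) @ \oo --> 0.
Hypothesis L_n : (fun n => (L n)%:R / n%:R `^ ((2 * p)^-1) : R) @ \oo --> 0.
Hypothesis b_infty : (fun n => (b n)%:R : R) @ \oo --> (+oo : set_system R).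
Hypothesis b_n : (fun n => (b n)%:R / n%:R `^ (2 / (3 * Num.max p 2)) : R) @ \oo --> 0.
Hypothesis b_k : (fun n => (b n)%:R / n%:R `^ ((kappa * q - 2) / (q + 2)) : R) @ \oo --> 0.
Hypothesis hfar : (fun n => P (pilots_far muhat n (tau n) kappa)) @ \oo --> 0%E.
Hypothesis hin : (fun n => P (pilots_in muhat n (tau n))) @ \oo --> 1%E.

Let pb n : R := fine (P (bad muhat n (tau n) kappa)).
Let Cf0 : 0 <= Cf := Cf_ge0.

Lemma bad_cvg : pb n @[n --> \oo] --> 0.
Proof.
have f1 : fine (P (pilots_far muhat n (tau n) kappa)) @[n --> \oo] --> 0 by exact: fine_cvg hfar.
have f2 : fine (P (pilots_in muhat n (tau n))) @[n --> \oo] --> (1 : R) by exact: fine_cvg hin.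
have f3 : (1 - fine (P (pilots_in muhat n (tau n))) + fine (P (pilots_far muhat n (tau n) kappa))) @[n --> \oo] --> (0 : R).
  apply: cvg0D f1; rewrite -(subrr (1 : R)); apply: cvgB f2; exact: cvg_cst.
apply: (cvg0_le f3); near=> n.
have mi := meas_pilots_in muhP n (tau n).
have mf := meas_pilots_far muhP n (tau n) kappa.
have mc := measurableC mi.
rewrite fine_ge0//= /pb.
have fin A : measurable A -> P A \is a fin_num by move=> mA; exact: fin_num_measure.
have -> : 1 - fine (P (pilots_in muhat n (tau n))) = fine (P (~` pilots_in muhat n (tau n))).
  by rewrite probability_setC// fineB// fin.
rewrite -fineD ?fin//; apply: fine_le; rewrite ?fin//.
- exact: (meas_bad muhP).
- by rewrite fin_numD !fin.
- exact: measureU2.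
Unshelve. all: by end_near.
Qed.

Lemma grad_mean_cvg : grad_mean muhat n (tau n) kappa @[n --> \oo] --> 0.
Proof.
apply: cvg0D; first by apply: cvg0M; exact: bad_cvg.
apply: cvg0M; apply: cvg0D; apply: cvg0M => //.
by apply: cvg0_inv_pow; rewrite divr_gt0.
Qed.

Lemma inv_cvg : ((b n)%:R^-1 : R) @[n --> \oo] --> 0.
Proof.
apply/gtr0_cvgV0 => //; have := b_pos b_infty; apply: filterS => n; by rewrite ltr0n.
Qed.

Lemma Xrate_cvg : Xrate n (b n) (L n) @[n --> \oo] --> 0.
Proof.
apply: cvg0D => //; apply: cvg0_sqrt; apply: cvg0M; exact: (cvg_win0 p1 L_n b_infty b_n).
Qed.

Lemma bias_rate_cvg : bias_rate n (b n) (L n) (tau n) @[n --> \oo] --> 0.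
Proof.
apply: cvg0D; last by apply: cvg0M; exact: (cvg_abn p1 tau_n L_n b_n).
rewrite /cellB; do 2! apply: cvg0M; apply: cvg0D.
  apply: cvg0M; apply: cvg0D; apply: cvg0M; last exact: inv_cvg.
  by apply: cvg0_sqrt; apply: cvg0M; exact: Xrate_cvg.
rewrite (_ : (fun n => _) = (fun n => (2 * (Cf * (d%:R * Cf * (d%:R * 4)) * Smax)) * Xrate n (b n) (L n))).
  by apply: cvg0M; exact: Xrate_cvg.
by apply/funext => n; ring.
Qed.

Lemma var_rate_cvg : var_rate n (b n) @[n --> \oo] --> 0.
Proof.
by apply: cvg0D; apply: cvg0M; [exact: (cvg_b3 b_n)|exact: (cvg_brho rho01 b_infty)].
Qed.

Lemma det_err_cvg e : det_err n (b n) (L n) kappa e @[n --> \oo] --> 0.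
Proof.
do 2! apply: cvg0M; apply: cvg0D; last exact: (cvg_bk kappa0 q4 b_k).
by do 2! apply: cvg0M; exact: (cvg_win p1 L_n b_n).
Qed.

(** For fixed e only e times the bound for the mean of Z survives; it is subtracted here and made
    small later by the choice of e. *)
Lemma maj_bound_cvg e : (maj_bound muhat n (L n) (tau n) kappa e
   - e * (d%:R * (d%:R * (Cf ^+ 2 * C2 C rho Cc)))) @[n --> \oo] --> 0.
Proof.
rewrite /maj_bound; under eq_cvg do rewrite addrK.
do 3! apply: cvg0M; apply: cvg0D; apply: cvg0M; first exact: grad_mean_cvg.
rewrite (_ : (fun n => _) = (fun n => (Cs * (2 * (4 * C))) * rho ^+ L n)); last by apply/funext => n; ring.
by apply: cvg0M; exact: cvg_rhoL.
Qed.

Lemma large_dev_cvg (x : R) : 0 < x -> P (large_dev muhat n (b n) (L n) (tau n) x) @[n --> \oo] --> 0%E.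
Proof.
move=> x0; pose ld n := large_dev muhat n (b n) (L n) (tau n) x.
have mld n : measurable (ld n) by exact: (meas_large_dev muhP).
apply/fine_cvgP; split; first by apply: nearW => n; exact: (fin_num_measure P _ (mld n)).
apply/cvgr0Pnorm_lt => g' g0; pose g : R := g'; rewrite -[g']/g in g0 *.
pose K := d%:R * (d%:R * (Cf ^+ 2 * C2 C rho Cc)).
have K0 : 0 <= K by do 3!(apply: mulr_ge0 => //); [exact: sqr_ge0|exact: C2_ge0].
(* Fixed before n: after Markov's factor 2/x the surviving term is at most g/4. The divisor is K + 1
   because K may be 0. *)
pose e := g * x / (8 * (K + 1)).
have K1 : 0 < K + 1 by rewrite ltr_wpDl.
have e0 : 0 < e by rewrite /e divr_gt0// !mulr_gt0.
have he : 2 / x * (e * K) <= g / 4.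
  have -> : 2 / x * (e * K) = g / 4 * (K / (K + 1)) by rewrite /e; field; rewrite !lt0r_neq0.
  by rewrite ler_piMr ?divr_ge0 ?(ltW g0)// ler_pdivrMr// mul1r lerDl.
pose M := avar_max.
have M0 : 0 <= M.
  apply: le_trans (avar_bound (v := 0) _).
    exact: normr_ge0.
  by rewrite lexx ler01.
(* The mesh term takes x/4; [det_err] takes the other x/4 for large n. *)
pose m := (Num.truncn (4 * M / x)).+1.
have hm : M / m%:R <= x / 4.
  have h : 0 <= 4 * M / x by apply: divr_ge0; [exact: mulr_ge0|exact: ltW].
  have /andP[_ /ltW hm] := truncn_itv h; rewrite -/m in hm.
  rewrite ler_pdivrMr//; move: hm; rewrite ler_pdivrMr// => hm.
  have -> : x / 4 * m%:R = m%:R * x / 4 by rewrite mulrAC [x * _]mulrC.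
  by rewrite ler_pdivlMr// mulrC.
pose rate n := pb n + 2 / x * ((maj_bound muhat n (L n) (tau n) kappa e - e * K) +
   m.+1%:R * (Num.sqrt (var_rate n (b n)) + bias_rate n (b n) (L n) (tau n))).
have hr : rate n @[n --> \oo] --> 0.
  apply: cvg0D; first exact: bad_cvg.
  apply: cvg0M; apply: cvg0D; first exact: maj_bound_cvg.
  by apply: cvg0M; apply: cvg0D; [apply: cvg0_sqrt; exact: var_rate_cvg|exact: bias_rate_cvg].
have g2 : 0 < g / 2 by rewrite divr_gt0.
have x4 : 0 < x / 4 by rewrite divr_gt0.
near=> n.
have n0 : (0 < n)%N by near: n; exact: near_infty_pos.
have b0 : (0 < b n)%N by near: n; exact: (b_pos b_infty).
have hd : det_err n (b n) (L n) kappa e < x / 4.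
  apply: le_lt_trans (ler_norm _) _; near: n; apply: cvgr0_norm_lt => //; exact: det_err_cvg.
have hrn : rate n < g / 2.
  by apply: le_lt_trans (ler_norm _) _; near: n; exact: cvgr0_norm_lt.
have hx : det_err n (b n) (L n) kappa e + M / m%:R <= x / 2 by move: hd hm; lra.
have hp := large_dev_prob muhP n0 b0 (tau0 n) x0 e0 (ltn0Sn _) hx.
rewrite /= ger0_norm; last by apply: fine_ge0; exact: measure_ge0.
apply: (le_lt_trans hp).
have -> : fine (P (bad muhat n (tau n) kappa)) + 2 / x *
  (maj_bound muhat n (L n) (tau n) kappa e +
   m.+1%:R * (Num.sqrt (var_rate n (b n)) + bias_rate n (b n) (L n) (tau n))) =
  rate n + 2 / x * (e * K) by rewrite /rate /pb; ring.
by move: hrn he g0; lra.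
Unshelve. all: by end_near.
Qed.

End Limit.

End LimitKernel.

(** * Passage from extended real suprema to uniform real constants *)

Unset Implicit Arguments.
Set Strict Implicit.

Theorem theoremC7
  (R : realType) (d0 : measure_display) (Omega : measurableType d0)
  (P : probability Omega R) (d : nat)
  (* innovations (eps_i)_{i in Z} and an independent copy (eps*_i) *)
  (eps epss : int -> Omega -> R)
  (* kernels G_n, G *)
  (Gn : nat -> R -> (nat -> R) -> 'rV[R]_d) (G : R -> (nat -> R) -> 'rV[R]_d)
  (f : 'rV[R]_d -> R)
  (* pilot estimators muhat_{t,n} *)
  (muhat : nat -> nat -> Omega -> 'rV[R]_d)
  (tau L b : nat -> nat)
  (q p kappa rho C_G C_f a : R) (delta : \bar R) :
  (* the paper's exponents *)
  4 < q -> 1 <= p < 4 -> 0 < kappa <= 2^-1 ->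
  (* i.i.d. structure *)
  (forall i, measurable_fun setT (eps i)) -> (forall i, measurable_fun setT (epss i)) ->
  mutual_indep P (fun ib : bool * int => if ib.1 then epss ib.2 else eps ib.2) ->
  ident_distr P (fun ib : bool * int => if ib.1 then epss ib.2 else eps ib.2) ->
  (* measurable kernels *)
  (forall n, kernel_measurable (Gn n)) -> kernel_measurable G ->
  (* (A.1) *)
  (fun n => ereal_sup [set LqN P q (fun w => Gn n u (epsseq eps 0 w) - G u (epsseq eps 0 w))
                       | u in [set u : R | 0 <= u <= 1]]) @ \oo --> 0%E ->
  (* (A.2) *)
  (ereal_sup [set z | exists (n : nat) (u : R), (0 <= u <= 1)%R /\
                z = LqN P q (fun w => Gn n u (epsseq eps 0 w))]
   + ereal_sup [set pvariation P eps q p (Gn n) | n in [set: nat]] <= C_G%:E)%E ->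
  (* (A.3) *)
  0 < rho < 1 ->
  (forall (j n : nat) (u : R) (t : int), 0 <= u <= 1 ->
     (LqN P q (fun w => (Gn n u (epsseq eps t w) - Gn n u (epstilde eps epss t j w))%R)
       <= (C_G * rho ^+ j)%:E)%E) ->
  (* f twice differentiable, (A.4) *)
  twice_differentiable f ->
  (0 < delta)%E ->
  (let mu := fun u => vexp P (fun w => G u (epsseq eps 0 w)) in
   forall x, nbhd_set (conv_curve mu) delta x ->
     `|f x| + enorm (grad f x) + fnorm (hessian f x) <= C_f) ->
  (* pilot estimators: muhat_{t,n} is sigma(eps_t, eps_{t-1}, ...)-measurable *)
  (forall t n (i : 'I_d) (B : set R), measurable B ->
     past_sigma eps t%:Z ((fun w => muhat t n w 0 i) @^-1` B)) ->
  (* tau_n >= 1, L_n -> oo, L_n / tau_n -> 0 *)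
  (forall n, (1 <= tau n)%N) ->
  (fun n => (L n)%:R : R) @ \oo --> (+oo : set_system R) ->
  (fun n => (L n)%:R / (tau n)%:R : R) @ \oo --> 0 ->
  (* (C.5-star) *)
  (forall e : R, 0 < e ->
     (fun n => P [set w | e * n%:R `^ (1 - kappa) <
        \sum_(tau n <= t < n.+1)
           enorm (muhat t n w - vexp P (fun w' => Gn n (t%:R / n%:R) (epsseq eps 0 w'))) ^+ 2])
     @ \oo --> 0%E) ->
  (* (A.6) *)
  (fun n => P [set w | forall t, (tau n <= t <= n)%N ->
     nbhd_set (conv_curve (fun u => vexp P (fun w' => G u (epsseq eps 0 w')))) delta
              (muhat t n w)]) @ \oo --> 1%E ->
  (* further rate conditions *)
  (fun n => (tau n)%:R / n%:R : R) @ \oo --> 0 ->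
  0 < a < 1 ->
  (fun n => ln (n%:R : R) `^ (1 + a) / (L n)%:R) @ \oo --> 0 ->
  (fun n => (L n)%:R / n%:R `^ (p^-1 - 4^-1) : R) @ \oo --> 0 ->
  (fun n => (L n)%:R / n%:R `^ ((2 * p)^-1) : R) @ \oo --> 0 ->
  (* block lengths b_n *)
  (fun n => (b n)%:R : R) @ \oo --> (+oo : set_system R) ->
  (fun n => (b n)%:R / n%:R `^ (2 / (3 * Num.max p 2)) : R) @ \oo --> 0 ->
  (fun n => (b n)%:R / n%:R `^ ((kappa * q - 2) / (q + 2)) : R) @ \oo --> 0 ->
  (* conclusion: sup_{u in [0,1]} |Q_n(u) - Q(u)| -> 0 in probability *)
  let X := fun (t n : nat) (w : Omega) => Gn n (t%:R / n%:R) (epsseq eps t%:Z w) in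
  let mu := fun u => vexp P (fun w => G u (epsseq eps 0 w)) in
  let Sigma := long_run_cov P eps G in
  let Qn := fun (n : nat) (w : Omega) (u : R) =>
    n%:R^-1 * \sum_(tau n + L n <= t < (Num.truncn (n%:R * u)).+1 - b n)
       (b n)%:R^-1 *
       ((grad f (muhat (t - L n)%N n w)) *m
          (\sum_(1 <= i < (b n).+1) (X (t + i)%N n w - muhat (t - L n)%N n w))^T) 0 0 ^+ 2 in
  let Q := fun u : R =>
    (\int[lebesgue_measure]_(v in `[0%R, u]) ((grad f (mu v) *m Sigma v *m (grad f (mu v))^T) 0 0)%:E)%E in
  forall e : R, 0 < e ->
    (fun n => P [set w | exists u : R, 0 <= u <= 1 /\ (e%:E < `|(Qn n w u)%:E - Q u|)%E])
    @ \oo --> 0%E.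
Proof.
move=> q4 /andP[p1 p4] /andP[kappa0 _] meps mepss indep ident mGn mG A1 A2 rho01 A3 tdf delta_gt0 A4 muhP
  tau1 L_infty L_tau C5 A6 tau_n a01 logL L_n1 L_n b_infty b_n b_k X mu Sigma Qn Q e e0.
pose SN := ereal_sup [set z | exists (n : nat) (u : R), (0 <= u <= 1)%R /\
  z = LqN P q (fun w => Gn n u (epsseq eps 0 w))].
pose SV := ereal_sup [set pvariation P eps q p (Gn n) | n in [set: nat]].
have SN_ub n u : 0 <= u <= 1 -> (LqN P q (fun w => Gn n u (epsseq eps 0 w)) <= SN)%E.
  by move=> u01; apply: ereal_sup_ubound; exists n, u.
have SV_ub n : (pvariation P eps q p (Gn n) <= SV)%E by apply: ereal_sup_ubound; exists n.
have SN0 : (0 <= SN)%E.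
  by apply: le_trans (SN_ub 0%N 0 _); [exact: Lnorm_ge0|rewrite lexx ler01].
have SV0 : (0 <= SV)%E.
  (* The partition 0, 1 shows that the supremum of the variations is nonnegative, so that each term
     of the assumed sum is itself at most C_G. *)
  pose s (i : nat) : R := i%:R.
  apply: le_trans (SV_ub 0%N).
  apply: (@le_trans _ _ ((\sum_(i < 1) (LqN P q (fun w => (Gn 0%N (s i.+1) (epsseq eps 0 w) - Gn 0%N (s i) (epsseq eps 0 w))%R)
      `^ p)%E) `^ p^-1)%E); first exact: poweR_ge0.
  apply: ereal_sup_ubound; exists 1%N, s; split => //; split => //; split => // i i1.
  by rewrite /s ltr_nat.
have SNC : (SN <= C_G%:E)%E by apply: le_trans A2; rewrite leeDl.
have SVC : (SV <= C_G%:E)%E by apply: le_trans A2; rewrite leeDr.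
have C0 : 0 <= C_G by rewrite -lee_fin; exact: le_trans SNC.
pose E n := ereal_sup [set LqN P q (fun w => Gn n u (epsseq eps 0 w) - G u (epsseq eps 0 w))
                       | u in [set u : R | 0 <= u <= 1]].
have /fine_cvgP[[N0 _ EN] Ecvg] : E n @[n --> \oo] --> 0%E by exact: A1.
(* The suprema of (A.1) may be infinite for finitely many n; those kernels are replaced. *)
pose Gn' n := Gn (maxn n N0); pose eta n := fine (E (maxn n N0)).
have Efin n : E (maxn n N0) \is a fin_num by apply: EN => /=; exact: leq_maxr.
have E_ub n u : 0 <= u <= 1 -> (LqN P q (fun w => (Gn n u (epsseq eps 0 w) - G u (epsseq eps 0 w))%R) <= E n)%E.
  by move=> u01; apply: ereal_sup_ubound; exists u.
have eta0 n : 0 <= eta n.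
  apply: fine_ge0; apply: le_trans (E_ub _ 0 _); [exact: Lnorm_ge0|by rewrite lexx ler01].
have big : \forall n \near \oo, maxn n N0 = n.
  by exists N0 => // n /= /maxn_idPl.
have eta_cvg : eta n @[n --> \oo] --> 0.
  by apply: cvg_trans Ecvg; apply: near_eq_cvg; apply: filterS big => n h; rewrite /eta /= h.
have GnG n u : 0 <= u <= 1 -> (LqN P q (fun w => (Gn' n u (epsseq eps 0 w) - G u (epsseq eps 0 w))%R) <= (eta n)%:E)%E.
  by move=> u01; rewrite /eta fineK//; exact: E_ub.
have KC n u : 0 <= u <= 1 -> (LqN P q (fun w => Gn' n u (epsseq eps 0 w)) <= C_G%:E)%E.
  by move=> u01; apply: le_trans SNC; exact: SN_ub.
have pvC n : (pvariation P eps q p (Gn' n) <= C_G%:E)%E by apply: le_trans SVC; exact: SV_ub.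
have A3' (j n : nat) (u : R) (t : int) : 0 <= u <= 1 ->
    (LqN P q (fun w => (Gn' n u (epsseq eps t w) - Gn' n u (epstilde eps epss t j w))%R) <= (C_G * rho ^+ j)%:E)%E.
  exact: A3.
have r1 : 0 < 1 - rho by case/andP: rho01 => _; rewrite subr_gt0.
pose Cc := 2 * C_G / (1 - rho); pose Cs := Cc / (1 - rho).
have Cc0 : 0 <= Cc by rewrite /Cc divr_ge0 ?mulr_ge0// ltW.
have Cs0 : 0 <= Cs by rewrite /Cs divr_ge0// ltW.
(* The far event is that of the assumed pilot rate with constant 1, for all n beyond N0. *)
have hfar : P (pilots_far P eps Gn' muhat n (tau n) kappa) @[n --> \oo] --> 0%E.
  apply: cvg_trans (C5 1 ltr01); apply: near_eq_cvg; apply: filterS big => n h.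
  by rewrite /pilots_far /pilot_sq /Gn' h; congr (P _); apply/seteqP; split => w /=; rewrite mul1r.
have main := large_dev_cvg meps mepss indep ident (fun n => mGn (maxn n N0)) mG q4 p1 C0 rho01 KC A3' pvC eta0 eta_cvg GnG
  Cc0 Cs0 (lexx _) (lexx _) tdf delta_gt0 A4 muhP tau1 kappa0 L_infty tau_n L_n b_infty b_n b_k hfar A6 e0.
have mF := avar_meas meps mepss indep ident (fun n => mGn (maxn n N0)) mG q4 p1 C0 rho01 KC A3' pvC eta0 eta_cvg GnG
  Cc0 (lexx _) tdf.
have avar_le := avar_bound meps mepss indep ident (fun n => mGn (maxn n N0)) mG q4 p1 C0 rho01 KC A3' pvC eta0 eta_cvg GnG
  Cc0 (lexx _) delta_gt0 A4.
(* Q is an extended real integral; the bounded measurable integrand makes it the real primitive. *)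
have QE u : 0 <= u <= 1 -> Q u = (prim (avar P eps G f) u)%:E.
  by move=> /andP[_ u1]; exact: (prim_EFin mF avar_le u1).
apply: cvg_trans main; apply: near_eq_cvg; apply: filterS big => n h; congr (P _).
have Gn'E : Gn' n = Gn n by rewrite /Gn' h.
have QnE u w : Qn n w u = Qsum eps Gn' f muhat n (b n) (L n) (tau n) (stop n (b n) u) w.
  by rewrite /Qn /Qsum /summand /stop /X Gn'E.
by apply/seteqP; split => w [u [u01 hu]]; exists u; split => //; move: hu;
  rewrite QnE QE// -EFinB abse_EFin lte_fin.
Qed.
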